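(* Assume the minimax problem, the standing assumptions (C1)–(C4) and the Acc-MDA algorithm described in the context, with $\mathcal{X}=\mathbb{R}^{d_1}$. Let $\{x_t,y_t\}_{t=1}^T$ be generated by the algorithm with $\eta_t=\frac{k}{(m+t)^{1/3}}$ for all $t\ge0$, $c_1\ge\frac{2}{3k^3}+\frac{9\tau^2}{4}$, $c_2\ge\frac{2}{3k^3}+\frac{75L_f^2}{2}$, $k>0$, $m\ge\max\big(2,k^3,(c_1k)^3,(c_2k)^3\big)$, $0<\lambda\le\min\big(\frac{1}{6L_f},\frac{27b\tau}{16}\big)$ and $0<\gamma\le\min\Big(\frac{\lambda\tau}{2L_f}\sqrt{\frac{2b}{8\lambda^2+75\kappa_y^2b}},\frac{m^{1/3}}{2L_gk}\Big)$. Then $$\frac1T\sum_{t=1}^T\mathbb{E}\|\nabla F(x_t)\|\le\frac{\sqrt{2M''}\,m^{1/6}}{T^{1/2}}+\frac{\sqrt{2M''}}{T^{1/3}},$$ where $\Delta_1=\|y_1-y^*(x_1)\|^2$ and $$M''=\frac{F(x_1)-F^*}{\gamma k}+\frac{9L_f^2\Delta_1}{k\lambda\tau}+\frac{2m^{1/3}\delta^2}{b\tau^2k^2}+\frac{2(c_1^2+c_2^2)\delta^2k^2}{b\tau^2}\ln(m+T).$$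
   Context: Problem: $\min_{x\in\mathcal{X}}\max_{y\in\mathcal{Y}}f(x,y)$, $f(x,y)=\mathbb{E}_{\xi\sim\mathcal{D}'}[f(x,y;\xi)]$, with $f(\cdot,\cdot;\xi)$ differentiable, $\xi$ a random variable with distribution $\mathcal{D}'$, $\mathcal{X}=\mathbb{R}^{d_1}$, and $\mathcal{Y}\subset\mathbb{R}^{d_2}$ compact convex or $\mathcal{Y}=\mathbb{R}^{d_2}$. $\|\cdot\|$ is the Euclidean norm; $\mathcal{P}_{\mathcal{Y}}$ is the Euclidean projection. $\nabla_x,\nabla_y$ are partial gradients and $\nabla f=(\nabla_xf,\nabla_yf)$. For a mini-batch $\mathcal{B}=\{\xi_1,\dots,\xi_b\}$, $\nabla_xf(x,y;\mathcal{B})=\frac1b\sum_{i=1}^b\nabla_xf(x,y;\xi_i)$, and likewise for $\nabla_y$. Standing assumptions. (C1) There is $\delta>0$ such that for all $x,y$: $\mathbb{E}\|\nabla_xf(x,y;\xi)-\nabla_xf(x,y)\|^2\le\delta^2$ and $\mathbb{E}\|\nabla_yf(x,y;\xi)-\nabla_yf(x,y)\|^2\le\delta^2$. (C2) $\|\nabla f(x,y;\xi)-\nabla f(x',y';\xi)\|\le L_f\|(x,y)-(x',y')\|$ for all $x,x'\in\mathcal{X}$, $y,y'\in\mathcal{Y}$. (C3) $f$ is $\tau$-strongly concave in $y$ ($\tau>0$): $f(x,y)\le f(x,y')+\langle\nabla_yf(x,y'),y-y'\rangle-\frac\tau2\|y-y'\|^2$ for $x\in\mathcal{X}$, $y,y'\in\mathcal{Y}$.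 (C4) $F^*=\inf_{x\in\mathcal{X}}F(x)>-\infty$. Notation: $y^*(x)=\arg\max_{y\in\mathcal{Y}}f(x,y)$, $F(x)=\max_{y\in\mathcal{Y}}f(x,y)=f(x,y^*(x))$, $\kappa_y=L_f/\tau$, $L_g=L_f+L_f^2/\tau$. Acc-MDA algorithm (case $\mathcal{X}=\mathbb{R}^{d_1}$), with parameters $\gamma,\lambda,k,m,c_1,c_2$, batch size $b\ge1$, horizon $T$, initial $x_1\in\mathcal{X}$, $y_1\in\mathcal{Y}$: draw a mini-batch $\mathcal{B}_1$ of $b$ i.i.d. samples; set $v_1=\nabla_xf(x_1,y_1;\mathcal{B}_1)$, $w_1=\nabla_yf(x_1,y_1;\mathcal{B}_1)$. For $t=1,\dots,T$: $\eta_t=\frac{k}{(m+t)^{1/3}}$; $x_{t+1}=x_t-\gamma\eta_tv_t$; $\tilde y_{t+1}=\mathcal{P}_{\mathcal{Y}}(y_t+\lambda w_t)$, $y_{t+1}=y_t+\eta_t(\tilde y_{t+1}-y_t)$; $\alpha_{t+1}=c_1\eta_t^2$, $\beta_{t+1}=c_2\eta_t^2$; draw a fresh independent mini-batch $\mathcal{B}_{t+1}$ of $b$ i.i.d. samples; $v_{t+1}=\nabla_xf(x_{t+1},y_{t+1};\mathcal{B}_{t+1})+(1-\alpha_{t+1})[v_t-\nabla_xf(x_t,y_t;\mathcal{B}_{t+1})]$, $w_{t+1}=\nabla_yf(x_{t+1},y_{t+1};\mathcal{B}_{t+1})+(1-\beta_{t+1})[w_t-\nabla_yf(x_t,y_t;\mathcal{B}_{t+1})]$.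 *)

(* Defs.v *)
From HB Require Import structures.
From mathcomp Require Import all_boot all_order all_algebra.
From mathcomp Require Import all_classical all_reals all_analysis.

Set Implicit Arguments.
Unset Strict Implicit.
Unset Printing Implicit Defensive.

Import Order.TTheory GRing.Theory Num.Theory.
Import numFieldNormedType.Exports.

Local Open Scope classical_set_scope.
Local Open Scope ring_scope.

(* The library norm `|v| on 'rV[R]_n is the max norm, hence enorm. *)
Definition enorm (R : realType) (n : nat) (v : 'rV[R]_n) : R :=
  Num.sqrt (\sum_(i < n) v 0 i ^+ 2).

Definition dotp (R : realType) (n : nat) (u v : 'rV[R]_n) : R :=
  \sum_(i < n) u 0 i * v 0 i.

Definition grad (R : realType) (n : nat) (g : 'rV[R]_n -> R) (x : 'rV[R]_n) :
    'rV[R]_n :=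
  \row_(i < n) 'D_(delta_mx 0 i) (g : 'rV[R]_n -> R^o) x.

Definition is_projection (R : realType) (n : nat) (Y : set 'rV[R]_n)
    (u p : 'rV[R]_n) : Prop :=
  Y p /\ forall q, Y q -> enorm (u - p) <= enorm (u - q).

(* [get] returns an arbitrary value when no projection exists; for Y nonempty,
   closed and convex the projection exists and is unique. *)
Definition projection (R : realType) (n : nat) (Y : set 'rV[R]_n)
    (u : 'rV[R]_n) : 'rV[R]_n :=
  get (is_projection Y u).

Section minimax.
Context {R : realType} {d1 d2 : nat}.
Implicit Types (g : 'rV[R]_d1 -> 'rV[R]_d2 -> R) (Y : set 'rV[R]_d2).

Definition gradx g (x : 'rV[R]_d1) (y : 'rV[R]_d2) : 'rV[R]_d1 :=
  grad (fun x' => g x' y) x.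

Definition grady g (x : 'rV[R]_d1) (y : 'rV[R]_d2) : 'rV[R]_d2 :=
  grad (fun y' => g x y') y.

Definition gradxy g (x : 'rV[R]_d1) (y : 'rV[R]_d2) : 'rV[R]_(d1 + d2) :=
  row_mx (gradx g x y) (grady g x y).

(* Frechet differentiability, in the ambient space, at the points of R^d1 x Y;
   no constraint is put on g away from R^d1 x Y. *)
Definition differentiable_on Y g : Prop :=
  forall x y, Y y ->
    differentiable (fun z : 'rV[R]_d1 * 'rV[R]_d2 => g z.1 z.2 : R^o) (x, y).

Definition lipschitz_gradient Y (L : R) g : Prop :=
  forall x x' y y', Y y -> Y y' ->
    enorm (gradxy g x y - gradxy g x' y') <=
    L * enorm (row_mx x y - row_mx x' y').

Definition strongly_concave Y (tau : R) g : Prop :=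
  forall x y y', Y y -> Y y' ->
    g x y <= g x y' + dotp (grady g x y') (y - y')
             - tau / 2 * enorm (y - y') ^+ 2.

Definition primal Y g (x : 'rV[R]_d1) : R := sup [set g x y | y in Y].

Definition is_argmax Y g (x : 'rV[R]_d1) (y : 'rV[R]_d2) : Prop :=
  Y y /\ forall y', Y y' -> g x y' <= g x y.

Definition ystar Y g (x : 'rV[R]_d1) : 'rV[R]_d2 := get (is_argmax Y g x).

End minimax.

Section stochastic.
Context {R : realType} {d1 d2 : nat} {d : measure_display}
  {Xi : measurableType d}.
Implicit Types (D : probability Xi R) (f : Xi -> 'rV[R]_d1 -> 'rV[R]_d2 -> R)
  (Y : set 'rV[R]_d2).

(* The expectation is made real by [fine]; it is meaningful at the points
   where f(x, y; .) is integrable. *)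
Definition objective D f (x : 'rV[R]_d1) (y : 'rV[R]_d2) : R :=
  fine 'E_D[fun s => f s x y].

Definition bounded_variance D f Y (delta : R) : Prop :=
  forall x y, Y y ->
    ('E_D[fun s => (enorm (gradx (f s) x y - gradx (objective D f) x y) ^+ 2)%R]
      <= (delta ^+ 2)%:E)%E /\
    ('E_D[fun s => (enorm (grady (f s) x y - grady (objective D f) x y) ^+ 2)%R]
      <= (delta ^+ 2)%:E)%E.

Definition minibatch_mean (b n : nat) (G : Xi -> 'rV[R]_n) (B : 'I_b -> Xi) :
    'rV[R]_n :=
  b%:R^-1 *: \sum_(i < b) G (B i).

Definition gradx_batch (b : nat) f x y (B : 'I_b -> Xi) : 'rV[R]_d1 :=
  minibatch_mean (fun s => gradx (f s) x y) B.

Definition grady_batch (b : nat) f x y (B : 'I_b -> Xi) : 'rV[R]_d2 :=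
  minibatch_mean (fun s => grady (f s) x y) B.

Definition step_size (k m : R) (t : nat) : R := k / (m + t%:R) `^ 3^-1.

(* One realization of the algorithm: B t is the mini-batch drawn at time t.
   The sequences start at index 1; their values at index 0 and beyond T.+1
   are unconstrained. *)
Record acc_mda_run (b : nat) f Y (gamma lambda k m c1 c2 : R) (T : nat)
    (x1 : 'rV[R]_d1) (y1 : 'rV[R]_d2) (B : nat -> 'I_b -> Xi)
    (x : nat -> 'rV[R]_d1) (y : nat -> 'rV[R]_d2)
    (v : nat -> 'rV[R]_d1) (w : nat -> 'rV[R]_d2) : Prop := AccMdaRun {
  run_x1 : x 1%N = x1;
  run_y1 : y 1%N = y1;
  run_v1 : v 1%N = gradx_batch f x1 y1 (B 1%N);
  run_w1 : w 1%N = grady_batch f x1 y1 (B 1%N);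
  run_x : forall t, (1 <= t <= T)%N ->
    x t.+1 = x t - (gamma * step_size k m t) *: v t;
  run_y : forall t, (1 <= t <= T)%N ->
    y t.+1 = y t + step_size k m t *:
                     (projection Y (y t + lambda *: w t) - y t);
  run_v : forall t, (1 <= t <= T)%N ->
    v t.+1 = gradx_batch f (x t.+1) (y t.+1) (B t.+1) +
             (1 - c1 * step_size k m t ^+ 2) *:
               (v t - gradx_batch f (x t) (y t) (B t.+1));
  run_w : forall t, (1 <= t <= T)%N ->
    w t.+1 = grady_batch f (x t.+1) (y t.+1) (B t.+1) +
             (1 - c2 * step_size k m t ^+ 2) *:
               (w t - grady_batch f (x t) (y t) (B t.+1))
}.

End stochastic.

Section sampling.
Context {R : realType} {d d' : measure_display} {Omega : measurableType d}
  {Xi : measurableType d'} {I : choiceType}.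

Definition mutually_independent (P : probability Omega R) (J : set I)
    (X : I -> {RV P >-> Xi}) : Prop :=
  forall (s : seq I) (A : I -> set Xi),
    uniq s -> (forall i, i \in s -> J i) -> (forall i, measurable (A i)) ->
    P (\bigcap_(i in [set` s]) (X i @^-1` A i)) =
    (\prod_(i <- s) P (X i @^-1` A i))%E.

Definition iid (P : probability Omega R) (D : probability Xi R) (J : set I)
    (X : I -> {RV P >-> Xi}) : Prop :=
  (forall i A, J i -> measurable A -> distribution P (X i) A = D A) /\
  mutually_independent J X.

End sampling.

(* Main.v *)
(* With X_t = E|v_t - grad_x f|^2 and Z_t the analogous mean square error of w_t at
   (x_t, y_t), the potential
     E F(x_t) + (9 gamma L_f^2 / (lambda tau)) E|y_t - y*(x_t)|^2
       + (gamma / (tau^2 eta_(t-1))) (X_t + Z_t)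
   decreases at step t by at least gamma eta_t E|grad F(x_t)|^2 / 2, up to a noise of
   order eta_t^3.  F has L_g-Lipschitz gradient grad_x f(x, y*(x)), which gives the
   primal descent; strong concavity makes the projected dual step a contraction
   towards y*(x_t); and since batch t+1 is independent of the iterates up to time
   t+1, conditioning on the past (Fubini for the product law) shows that the
   momentum errors satisfy X_(t+1) <= (1 - alpha)^2 X_t + noise + drift.  The bounds
   on c1, c2, lambda and gamma are exactly what makes the coefficients of X, Z,
   E|y~ - y|^2 and E|v|^2 nonpositive.  The noise sums to k^3 ln (m + T), and AM-GM
   passes from second to first moments.

   As the data are only constrained on R^d1 x Y, the ambient gradient grad_y f need
   only be the mean of the sampled ones in directions tangent to Y.  Projecting w
   orthogonally onto the span of Y - Y leaves the projected step unchanged, and the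
   error estimate is run on the projection. *)

Require Import Defs.
From HB Require Import structures.
From mathcomp Require Import all_boot all_order all_algebra.
From mathcomp Require Import all_classical all_reals all_analysis.
From mathcomp Require Import measurable_realfun ring lra.

Set Implicit Arguments.
Unset Strict Implicit.
Unset Printing Implicit Defensive.

Import Order.TTheory GRing.Theory Num.Theory.
Import numFieldNormedType.Exports.

Local Open Scope classical_set_scope.
Local Open Scope ring_scope.

(** * Euclidean norm, projections and gradients *)

(** The terms in [F] and in the distance to [ystar] are telescoped along each realization, so their
    expectations never enter. Only the momentum errors, the steps and the gradients of the primal
    function are integrated, and the induction along a run has to carry just the adaptedness and
    square integrability of a few vectors. The interchange of gradient and expectation and the joint
    measurability in sample and iterate both come from the Lipschitz gradients: the difference
    quotients of [f s] with step [1 / (n + 1)] differ from the derivative by at most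
    [L / 2 * |u|^2 / (n + 1)], uniformly in [s], and a function measurable in one variable and
    Lipschitz in the other is jointly measurable. The weight [9 gamma L^2 / (lambda tau)] is such
    that the dual contraction [eta tau lambda / 4] returns [9/4 gamma eta L^2], more than the
    [gamma eta L^2] lost by the primal step. The summand [2 / (3 k^3)] of [c1] and [c2] pays for the
    growth of the weight [1 / eta], the other summand for the errors of [v] and [w] in the
    descent. *)

Section euclid.
Context {R : realType}.

Section fixed_dim.
Context {n : nat}.
Implicit Types u v w : 'rV[R]_n.

Lemma enorm_ge0 u : 0 <= enorm u. Proof. exact: sqrtr_ge0. Qed.

Lemma sqr_enorm u : enorm u ^+ 2 = dotp u u.
Proof.
rewrite /enorm sqr_sqrtr; last by apply: sumr_ge0 => i _; exact: sqr_ge0.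
by apply: eq_bigr => i _; rewrite expr2.
Qed.

Lemma dotp_ge0 u : 0 <= dotp u u.
Proof. by rewrite -sqr_enorm sqr_ge0. Qed.

Lemma dotpC u v : dotp u v = dotp v u.
Proof. by apply: eq_bigr => i _; rewrite mulrC. Qed.

Lemma dotpDl u v w : dotp (u + v) w = dotp u w + dotp v w.
Proof. by rewrite /dotp -big_split; apply: eq_bigr => i _; rewrite !mxE mulrDl. Qed.

Lemma dotpZl a u w : dotp (a *: u) w = a * dotp u w.
Proof. by rewrite /dotp mulr_sumr; apply: eq_bigr => i _; rewrite !mxE mulrA. Qed.

Lemma dotpNl u w : dotp (- u) w = - dotp u w.
Proof. by rewrite -scaleN1r dotpZl mulN1r. Qed.

Lemma dotpBl u v w : dotp (u - v) w = dotp u w - dotp v w.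
Proof. by rewrite dotpDl dotpNl. Qed.

Lemma dotpDr u v w : dotp w (u + v) = dotp w u + dotp w v.
Proof. by rewrite !(dotpC w) dotpDl. Qed.

Lemma dotpZr a u w : dotp w (a *: u) = a * dotp w u.
Proof. by rewrite !(dotpC w) dotpZl. Qed.

Lemma dotpNr u w : dotp w (- u) = - dotp w u.
Proof. by rewrite !(dotpC w) dotpNl. Qed.

Lemma dotpBr u v w : dotp w (u - v) = dotp w u - dotp w v.
Proof. by rewrite dotpDr dotpNr. Qed.

Lemma dotp0l u : dotp 0 u = 0.
Proof. by rewrite -(scale0r 0) dotpZl mul0r. Qed.

Lemma dotp0r u : dotp u 0 = 0.
Proof. by rewrite dotpC dotp0l. Qed.

Definition dotpE := (dotpDl, dotpDr, dotpNl, dotpNr, dotpZl, dotpZr).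

Lemma dotp_delta u i : dotp u (delta_mx 0 i) = u 0 i.
Proof.
rewrite /dotp (bigD1 i)//= big1 => [|j ji]; rewrite mxE !eqxx ?mulr1 ?addr0//.
by rewrite (negbTE ji) andbF mulr0.
Qed.

Lemma enormN u : enorm (- u) = enorm u.
Proof. by rewrite /enorm; congr Num.sqrt; apply: eq_bigr => i _; rewrite mxE sqrrN. Qed.

Lemma enormB u v : enorm (u - v) = enorm (v - u).
Proof. by rewrite -enormN opprB. Qed.

Lemma enorm_eq0 u : enorm u = 0 -> u = 0.
Proof.
move=> u0; apply/rowP => i; rewrite mxE; apply/eqP; rewrite -sqrf_eq0.
have /eqP : dotp u u = 0 by rewrite -sqr_enorm u0 expr0n.
rewrite psumr_eq0 => [/allP/(_ i)|j _]; last by rewrite -expr2 sqr_ge0.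
by rewrite mem_index_enum => /(_ isT); rewrite -expr2.
Qed.

Lemma enorm0 : enorm (0 : 'rV[R]_n) = 0.
Proof. by apply/eqP; rewrite -sqrf_eq0 sqr_enorm dotp0l. Qed.

Lemma enormZ a u : enorm (a *: u) = `|a| * enorm u.
Proof.
apply/eqP; rewrite -(@eqrXn2 _ 2)// ?enorm_ge0 ?mulr_ge0 ?enorm_ge0//.
by rewrite exprMn !sqr_enorm !dotpE real_normK ?num_real// expr2 mulrA.
Qed.

Lemma dotp_le u v : dotp u v <= enorm u * enorm v.
Proof.
have [v0|v0] := eqVneq (enorm v) 0.
  by rewrite v0 (enorm_eq0 v0) dotp0r mulr0.
have vp : 0 < enorm v by rewrite lt0r v0 enorm_ge0.
apply: le_trans (ler_norm _) _.
rewrite -(@ler_pXn2r _ 2)// ?nnegrE ?mulr_ge0 ?enorm_ge0//.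
rewrite real_normK ?num_real// exprMn.
have := dotp_ge0 (enorm v ^+ 2 *: u - dotp u v *: v).
rewrite !dotpE -!sqr_enorm (dotpC v u) => h.
have {}h : 0 <= enorm v ^+ 2 * (enorm u ^+ 2 * enorm v ^+ 2 - dotp u v ^+ 2).
  by apply: le_trans h _; rewrite le_eqVlt; apply/orP; left; apply/eqP; ring.
by move: h; rewrite pmulr_rge0 ?subr_ge0// exprn_gt0.
Qed.

Lemma enorm_triangle u v : enorm (u + v) <= enorm u + enorm v.
Proof.
rewrite -(@ler_pXn2r _ 2)// ?nnegrE ?addr_ge0 ?enorm_ge0//.
rewrite sqr_enorm !dotpE -!sqr_enorm (dotpC v u).
by have := dotp_le u v; nra.
Qed.

Lemma enorm_sqrD_le u v :
  enorm (u + v) ^+ 2 <= 2 * enorm u ^+ 2 + 2 * enorm v ^+ 2.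
Proof.
have := dotp_ge0 (u - v).
by rewrite !sqr_enorm !dotpE (dotpC v u); lra.
Qed.

Lemma enorm_sqrB u v :
  enorm (u - v) ^+ 2 = enorm u ^+ 2 - 2 * dotp u v + enorm v ^+ 2.
Proof. by rewrite !sqr_enorm !dotpE (dotpC v u); ring. Qed.

Lemma enorm_sqrD u v :
  enorm (u + v) ^+ 2 = enorm u ^+ 2 + 2 * dotp u v + enorm v ^+ 2.
Proof. by rewrite !sqr_enorm !dotpE (dotpC v u); ring. Qed.

Lemma dotp_young c u v : 0 < c ->
  dotp u v <= c * enorm u ^+ 2 + enorm v ^+ 2 / (4 * c).
Proof.
move=> c0; have := dotp_ge0 (2 * c *: u - v).
rewrite !dotpE (dotpC v u) -!sqr_enorm => h.
have c4 : 0 < 4 * c by lra.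
have -> : c * enorm u ^+ 2 + enorm v ^+ 2 / (4 * c) =
    (4 * c ^+ 2 * enorm u ^+ 2 + enorm v ^+ 2) / (4 * c).
  by field; rewrite gt_eqF.
by rewrite ler_pdivlMr//; lra.
Qed.

Lemma abs_coord_le u i : `|u 0 i| <= enorm u.
Proof.
rewrite -(@ler_pXn2r _ 2)// ?nnegrE ?enorm_ge0//.
rewrite real_normK ?num_real// sqr_enorm /dotp (bigD1 i)//= -expr2 lerDl.
by apply: sumr_ge0 => j _; rewrite -expr2 sqr_ge0.
Qed.

Lemma norm_le_enorm u : `|u| <= enorm u.
Proof.
have -> : `|u| = mx_norm u by [].
rewrite mx_normrE; apply: bigmax_le => [|[i j] _]; first exact: enorm_ge0.
by rewrite ord1; exact: abs_coord_le.
Qed.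

Lemma coord_le_norm u i : `|u 0 i| <= `|u|.
Proof.
have -> : `|u| = mx_norm u by [].
rewrite mx_normrE.
exact: (@le_bigmax _ R _ 0 (fun ij : 'I_1 * 'I_n => `|u ij.1 ij.2|) (0, i)).
Qed.

Lemma enorm_le_norm u : enorm u <= Num.sqrt n%:R * `|u|.
Proof.
rewrite -(@ler_pXn2r _ 2)// ?nnegrE ?mulr_ge0 ?enorm_ge0 ?sqrtr_ge0//.
rewrite sqr_enorm exprMn sqr_sqrtr ?ler0n//.
have -> : n%:R * `|u| ^+ 2 = \sum_(i < n) `|u| ^+ 2.
  by rewrite sumr_const card_ord mulr_natl.
apply: ler_sum => i _; rewrite -expr2 -[leLHS]real_normK ?num_real//.
by rewrite lerXn2r ?nnegrE// coord_le_norm.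
Qed.

End fixed_dim.

(** The topology is that of the max norm, so a Euclidean Lipschitz bound is transferred at the price
    of a factor [sqrt n]. *)
Lemma enorm_lip_continuous (n : nat) (C : R) (g : 'rV[R]_n -> R) (x : 'rV[R]_n) :
  (forall y, (`|g y - g x| <= C * enorm (y - x))%R) -> {for x, continuous g}.
Proof.
move=> H; apply/(@cvgrPdist_le _ R^o _ (nbhs x)) => /= e e0.
pose K := `|C| * Num.sqrt n%:R + 1.
have K0 : 0 < K by rewrite ltr_wpDl ?mulr_ge0 ?sqrtr_ge0.
have /cvgrPdist_le/(_ (e / K) (divr_gt0 e0 K0)) xK :
  (id : 'rV[R]_n -> 'rV[R]_n) @ x --> x by exact: cvg_id.
near=> y.
rewrite distrC (le_trans (H y))// (le_trans (ler_norm _))// normrM.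
rewrite [`|enorm _|]ger0_norm ?enorm_ge0//.
apply: (@le_trans _ _ (K * `|y - x|)).
  apply: (@le_trans _ _ (`|C| * (Num.sqrt n%:R * `|y - x|))).
    by rewrite ler_wpM2l// enorm_le_norm.
  by rewrite mulrA ler_wpM2r// /K lerDl.
by rewrite -ler_pdivlMl// mulrC distrC; near: y.
Unshelve. all: by end_near. Qed.

Lemma dotp_row_mx (n1 n2 : nat) (a c : 'rV[R]_n1) (b d : 'rV[R]_n2) :
  dotp (row_mx a b) (row_mx c d) = dotp a c + dotp b d.
Proof.
rewrite /dotp big_split_ord/=.
by congr (_ + _); apply: eq_bigr => i _; rewrite ?row_mxEl ?row_mxEr.
Qed.

Lemma sqr_enorm_row_mx (n1 n2 : nat) (a : 'rV[R]_n1) (b : 'rV[R]_n2) :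
  enorm (row_mx a b) ^+ 2 = enorm a ^+ 2 + enorm b ^+ 2.
Proof. by rewrite !sqr_enorm dotp_row_mx. Qed.

Lemma enorm_row_mx0r (n1 n2 : nat) (a : 'rV[R]_n1) :
  enorm (row_mx a (0 : 'rV[R]_n2)) = enorm a.
Proof.
apply/eqP; rewrite -(@eqrXn2 _ 2)// ?enorm_ge0//.
by rewrite sqr_enorm_row_mx enorm0 expr0n addr0.
Qed.

Lemma enorm_row_mx0l (n1 n2 : nat) (b : 'rV[R]_n2) :
  enorm (row_mx (0 : 'rV[R]_n1) b) = enorm b.
Proof.
apply/eqP; rewrite -(@eqrXn2 _ 2)// ?enorm_ge0//.
by rewrite sqr_enorm_row_mx enorm0 expr0n add0r.
Qed.

Lemma row_mxBB (n1 n2 : nat) (a c : 'rV[R]_n1) (b d : 'rV[R]_n2) :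
  row_mx a b - row_mx c d = row_mx (a - c) (b - d).
Proof. by rewrite opp_row_mx add_row_mx. Qed.

Lemma enorm_row_mx_ge_l (n1 n2 : nat) (a : 'rV[R]_n1) (b : 'rV[R]_n2) :
  enorm a <= enorm (row_mx a b).
Proof.
rewrite -(@ler_pXn2r _ 2)// ?nnegrE ?enorm_ge0//.
by rewrite sqr_enorm_row_mx lerDl sqr_ge0.
Qed.

Lemma enorm_row_mx_ge_r (n1 n2 : nat) (a : 'rV[R]_n1) (b : 'rV[R]_n2) :
  enorm b <= enorm (row_mx a b).
Proof.
rewrite -(@ler_pXn2r _ 2)// ?nnegrE ?enorm_ge0//.
by rewrite sqr_enorm_row_mx lerDr sqr_ge0.
Qed.

End euclid.

(** * Maximizers on closed sets and the Euclidean projection *)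

Section projection.
Context {R : realType} {n : nat}.
Implicit Types (Y : set 'rV[R]_n) (u p q : 'rV[R]_n).

(** The points of [Y] that do at least as well as [y0] lie in a ball around it, so a maximizer over
    the compact part of [Y] in that ball is global. The lemma serves both for the projection, with
    minus the distance, and for [ystar]. *)
Lemma closed_coercive_argmax Y (g : 'rV[R]_n -> R) y0 (r : R) :
  closed Y -> Y y0 -> (forall y, Y y -> {for y, continuous g}) ->
  (forall y, Y y -> g y0 <= g y -> enorm (y - y0) <= r) ->
  exists y, Y y /\ forall y', Y y' -> g y' <= g y.
Proof.
move=> cY Yy0 cg coer.
pose h y := enorm (y - y0).
have ch : continuous h.
  move=> y; apply: (@enorm_lip_continuous _ _ 1) => z; rewrite mul1r /h.
  have h1 := enorm_triangle (z - y) (y - y0).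
  have h2 := enorm_triangle (y - z) (z - y0).
  rewrite ler_norml; move: h1 h2; rewrite !addrA !subrK (enormB y z).
  lra.
pose K := Y `&` (h @^-1` [set t | t <= r]).
have cK : compact K.
  apply: bounded_closed_compact.
    exists (`|r| + enorm y0); split; first exact: num_real.
    move=> M hM y [_ /= hy].
    apply: (le_trans (norm_le_enorm y)).
    have := enorm_triangle (y - y0) y0; rewrite subrK => /le_trans; apply.
    apply: le_trans (ltW hM); rewrite lerD2r.
    by apply: le_trans hy _; exact: ler_norm.
  apply: closedI => //.
  by apply: closed_comp => [y _|]; [exact: ch|exact: closed_le].
have Ky0 : K y0.
  by split => //; rewrite /= /h; apply: (coer y0).
have [|||c cin cmax] := @compact_EVT_max _ R g K.
- by exists y0.
- exact: cK.
- rewrite continuous_subspace_in => y yK; have [Yy _] := set_mem yK.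
  by apply: continuous_subspaceT_for (set_mem yK) _; exact: cg.
move/set_mem : cin => [Yc _].
exists c; split => // y' Yy'.
have [hy'|/ltW hy'] := leP (g y0) (g y').
  by apply: cmax; apply/mem_set; split => //; exact: coer.
by apply: le_trans hy' _; apply: cmax; exact/mem_set.
Qed.

Lemma is_projection_var Y u p q :
  (forall y y' (t : R), Y y -> Y y' -> 0 <= t <= 1 -> Y (y + t *: (y' - y))) ->
  is_projection Y u p -> Y q -> dotp (u - p) (q - p) <= 0.
Proof.
move=> cvx [Yp hp] Yq; rewrite leNgt; apply/negP => d0.
set d := dotp _ _ in d0.
have q0 : 0 <= enorm (q - p) ^+ 2 by rewrite sqr_ge0.
(* Moving from [p] towards [q] by [t] changes the squared distance to [u] by
   [t * (t * |q - p|^2 - 2 * d)]. This [t] stays in the unit interval and keeps [t * |q - p|^2]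
   below [d], so the distance would decrease. *)
pose t := d / (d + enorm (q - p) ^+ 2).
have D0 : 0 < d + enorm (q - p) ^+ 2 by lra.
have t0 : 0 < t by exact: divr_gt0.
have t1 : t <= 1 by rewrite /t ler_pdivrMr//; lra.
have tE : t * (d + enorm (q - p) ^+ 2) = d by rewrite /t divfK// gt_eqF.
have := hp _ (cvx p q t Yp Yq _); rewrite t1 (ltW t0) => /(_ isT).
rewrite -(@ler_pXn2r _ 2)// ?nnegrE ?enorm_ge0//.
rewrite opprD addrA (enorm_sqrB (u - p)) dotpZr -/d enormZ exprMn (gtr0_norm t0).
move: tE; set N := enorm (q - p) ^+ 2 in q0 *; move=> tE h.
have : t * (t * N - 2 * d) >= 0.
  by move: h; lra.
rewrite pmulr_rge0// => h'.
by have := mulr_gt0 t0 d0; move: tE; lra.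
Qed.

Lemma is_projection_of_var Y u p : Y p ->
  (forall q, Y q -> dotp (u - p) (q - p) <= 0) -> is_projection Y u p.
Proof.
move=> Yp h; split => // q Yq.
rewrite -(@ler_pXn2r _ 2)// ?nnegrE ?enorm_ge0//.
have -> : u - q = (u - p) - (q - p) by rewrite opprB addrA subrK.
rewrite (enorm_sqrB (u - p)).
by have := h q Yq; have := sqr_ge0 (enorm (q - p)); lra.
Qed.

Section closed_convex.
Variable Y : set 'rV[R]_n.
Hypothesis Ycl : closed Y.
Hypothesis Y0 : Y !=set0.
Hypothesis Ycvx : forall y y' (t : R),
  Y y -> Y y' -> 0 <= t <= 1 -> Y (y + t *: (y' - y)).

Lemma projectionP u : is_projection Y u (projection Y u).
Proof.
case: Y0 => y0 Yy0.
have [||p [Yp hp]] := @closed_coercive_argmax Y (fun y => - enorm (u - y)) y0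
  (2 * enorm (u - y0)) Ycl Yy0.
- move=> y Yy; apply: (@enorm_lip_continuous _ _ 1) => z; rewrite mul1r.
  have h1 := enorm_triangle (u - z) (z - y).
  have h2 := enorm_triangle (u - y) (y - z).
  rewrite ler_norml; move: h1 h2; rewrite !addrA !subrK (enormB y z).
  lra.
- move=> y Yy; rewrite lerN2 => h.
  have := enorm_triangle (y - u) (u - y0); rewrite addrA subrK (enormB y u).
  lra.
apply: (@getPex _ (is_projection Y u)).
by exists p; split => // q Yq; have := hp q Yq; lra.
Qed.

Lemma projection_in u : Y (projection Y u).
Proof. by case: (projectionP u). Qed.

Lemma projection_var u q : Y q ->
  dotp (u - projection Y u) (q - projection Y u) <= 0.
Proof. exact/is_projection_var/projectionP. Qed.

(** Each variational inequality is tested at the other projection; their sum reads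
    [|p - p'|^2 <= <u - u', p - p'>], and Cauchy-Schwarz concludes. *)
Lemma projection_lip u u' :
  enorm (projection Y u - projection Y u') <= enorm (u - u').
Proof.
set p := projection Y u; set p' := projection Y u'.
have h1 := projection_var u (projection_in u').
have h2 := projection_var u' (projection_in u).
rewrite -/p -/p' in h1 h2.
have h3 : enorm (p - p') ^+ 2 <= dotp (u - u') (p - p').
  rewrite sqr_enorm; move: h1 h2.
  by rewrite !dotpE !(dotpC u) !(dotpC u') (dotpC p' p); lra.
have := dotp_le (u - u') (p - p').
move: h3; have := enorm_ge0 (p - p'); have := enorm_ge0 (u - u').
set a := enorm (p - p'); set c := enorm (u - u'); nra.
Qed.

Lemma projection_id u : Y u -> projection Y u = u.
Proof.
move=> Yu; apply/eqP; rewrite -subr_eq0; apply/eqP/enorm_eq0/eqP.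
have := projection_var u Yu; rewrite -sqr_enorm enormB => h.
by rewrite -sqrf_eq0 eq_le h sqr_ge0.
Qed.

End closed_convex.

Lemma feasible_closed_convex Y :
  (compact Y /\ convex_set Y) \/ Y = setT ->
  closed Y /\ forall y y' (t : R),
    Y y -> Y y' -> 0 <= t <= 1 -> Y (y + t *: (y' - y)).
Proof.
case=> [[cY vY]|->]; last by split => //; exact: closedT.
split; first by apply: compact_closed cY; exact: norm_hausdorff.
move=> y y' t Yy Yy' /andP[t0 t1].
(* The convex combination of the library puts the weight [t] on its first argument, hence the order
   [y'], [y]. *)
have := vY y' y (Itv01 t0 t1) (mem_set Yy') (mem_set Yy) => /set_mem.
rewrite /conv/= => h; have -> : y + t *: (y' - y) = t *: y' + (1 - t) *: y; last exact: h.
by rewrite scalerBl scale1r scalerBr [RHS]addrCA addrA.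
Qed.

End projection.

(** * Descent on a segment and directional derivatives *)

Section one_dim.
Context {R : realType}.

(** The mean value theorem is applied to [phi] minus the parabola with slope [dphi 0 + K t], whose
    derivative dominates that of [phi]. The bound on [dphi] is one-sided, so lower bounds follow by
    applying it to [- phi]. *)
Lemma descent_1d (phi dphi : R -> R) (K : R) :
  (forall t : R, 0 <= t <= 1 -> is_derive t 1 (phi : R -> R^o) (dphi t)) ->
  (forall t : R, 0 <= t <= 1 -> dphi t - dphi 0 <= K * t) ->
  phi 1 <= phi 0 + dphi 0 + K / 2.
Proof.
move=> hd hK.
pose psi : R -> R := fun t => phi t - (dphi 0 * t + K / 2 * t ^+ 2).
pose dpsi := fun t => dphi t - (dphi 0 + K * t).
have hpsi (t : R) : 0 <= t <= 1 -> is_derive t 1 (psi : R -> R^o) (dpsi t).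
  move=> /hd h.
  have -> : psi = (phi : R -> R^o) - ((dphi 0 *: (id : R -> R^o)) + ((K / 2) *: ((id : R -> R^o) ^+ 2))).
    by apply/funext => s; rewrite !fctE.
  have h1 := @is_deriveX R R^o id 2 t 1 1 (is_derive_id _ _).
  have h2 := is_deriveD (is_deriveZ (dphi 0) (is_derive_id (t : R^o) 1)) (is_deriveZ (K / 2) h1).
  apply: is_derive_eq (is_deriveB h h2) _.
  rewrite /dpsi; congr (_ - (_ + _)); first by rewrite [LHS]mulr1.
  by rewrite /GRing.scale/= expr1; lra.
have [||c] := @MVT R psi dpsi 0 1 ltr01.
- by move=> t; rewrite in_itv/= => /andP[/ltW t0 /ltW t1]; apply: hpsi; rewrite t0 t1.
- rewrite continuous_subspace_in => t tin.
  have := set_mem tin; rewrite /= in_itv/= => ht.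
  apply: continuous_subspaceT_for; first exact: set_mem tin.
  apply: differentiable_continuous; apply/derivable1_diffP.
  by have [] := hpsi t ht.
rewrite in_itv/= => /andP[c0 c1]; rewrite subr0 mulr1 /psi/dpsi.
have := hK c; rewrite (ltW c0) (ltW c1) => /(_ isT).
by rewrite expr1n expr0n/=; lra.
Qed.

(** A derivative written as the limit of a sequence, the form required for limits of measurable
    functions and of integrals. *)
Lemma derive_seq (V : normedModType R) (F : V -> R^o) (x u : V) (c : R) :
  is_derive x u F c ->
  (fun n => n.+1%:R * (F (x + n.+1%:R^-1 *: u) - F x)) @ \oo --> c.
Proof.
case=> dF <-.
have g0 : (fun n => n.+1%:R^-1 : R) @ \oo --> (0 : R)^'.
  move=> A [e /= e0 hA].
  have /cvgrPdist_lt/(_ e e0) := @cvg_harmonic R.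
  apply: filterS => n hn; apply: hA; first by rewrite /ball/=.
  by rewrite /= invr_eq0 pnatr_eq0.
have -> : (fun n => n.+1%:R * (F (x + n.+1%:R^-1 *: u) - F x)) =
    (fun h => h^-1 *: ((F \o shift x) (h *: u) - F x)) \o (fun n => n.+1%:R^-1).
  by apply/funext => n /=; rewrite invrK (addrC _ x).
exact: cvg_comp _ _ g0 dF.
Qed.

(** Dividing the remainder by [h] leaves [C * |h|]. This is how the primal function, defined as a
    supremum, gets its directional derivatives. *)
Lemma is_derive_quadratic (V : normedModType R) (F : V -> R^o) (x u : V) (c C : R) :
  (forall h, `|F (x + h *: u) - F x - h * c| <= C * h ^+ 2) ->
  is_derive x u F c.
Proof.
move=> H.
have cv : (fun h => h^-1 *: ((F \o shift x) (h *: u) - F x)) @ 0^' --> c.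
  apply/(@cvgrPdist_le _ R^o) => e e0.
  have C0 : 0 < `|C| + 1 by rewrite ltr_wpDl.
  near=> h.
  have h0 : h != 0 by near: h; exact: nbhs_dnbhs_neq.
  have he : `|h| <= e / (`|C| + 1).
    near: h; apply: dnbhs0_le; exact: divr_gt0.
  rewrite /= distrC (addrC _ x).
  have -> : h^-1 * (F (x + h *: u) - F x) - c = h^-1 * (F (x + h *: u) - F x - h * c).
    by rewrite [RHS]mulrBr mulKf.
  rewrite normrM normfV ler_pdivrMl ?normr_gt0//.
  apply: le_trans (H h) _.
  have -> : C * h ^+ 2 = `|h| * (C * `|h|).
    by rewrite [RHS]mulrCA -expr2 real_normK ?num_real.
  rewrite ler_wpM2l//.
  rewrite ler_pdivlMr// in he.
  apply: le_trans he; rewrite mulrC ler_wpM2l//.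
  by rewrite (le_trans (ler_norm _))// lerDl.
by split; [apply/cvg_ex; exists c|exact: cvg_lim].
Unshelve. all: by end_near. Qed.

End one_dim.

(** A directional derivative depends only on the increments along its line; this transports
    derivatives between the product space, its factors and the real line. *)
Lemma is_derive_quotient {R : realType} (V V' : normedModType R) (F : V -> R^o)
    (F' : V' -> R^o) x u x' u' c :
  (forall h : R, F (h *: u + x) - F x = F' (h *: u' + x') - F' x') ->
  is_derive x u F c -> is_derive x' u' F' c.
Proof.
move=> H [].
have E : (fun h : R => h^-1 *: ((F \o shift x) (h *: u) - F x)) =
   (fun h : R => h^-1 *: ((F' \o shift x') (h *: u') - F' x')).
  by apply/funext => h; congr (_ *: _); exact: H.
by rewrite /derivable /derive E => ? ?; split.
Qed.

Section gradient.
Context {R : realType} {d1 d2 : nat}.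
Implicit Types g : 'rV[R]_d1 -> 'rV[R]_d2 -> R.

(** [gradx] and [grady] collect derivatives along coordinate vectors; linearity of the differential
    extends them to every direction of the product. *)
Lemma derive_pair g x y a b :
  differentiable (fun z : 'rV[R]_d1 * 'rV[R]_d2 => g z.1 z.2 : R^o) (x, y) ->
  is_derive (x, y) (a, b) (fun z : 'rV[R]_d1 * 'rV[R]_d2 => g z.1 z.2 : R^o)
    (dotp (gradx g x y) a + dotp (grady g x y) b).
Proof.
move=> dg; set G := fun z : _ * _ => _ in dg *.
split; first exact: diff_derivable.
rewrite deriveE//.
have -> : (a, b) = \sum_(i < d1) a 0 i *: (delta_mx 0 i, 0)
   + \sum_(j < d2) b 0 j *: (0, delta_mx 0 j) :> 'rV[R]_d1 * 'rV[R]_d2.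
  rewrite {1}(row_sum_delta a) {1}(row_sum_delta b).
  apply: injective_projections => /=; rewrite raddf_sum/= raddf_sum/=.
    by rewrite [X in _ + X]big1 ?addr0// => i _; rewrite scaler0.
  by rewrite [X in X + _]big1 ?add0r// => i _; rewrite scaler0.
rewrite /dotp linearD !linear_sum/=; congr (_ + _); apply: eq_bigr => i _.
  rewrite linearZ; have -> : 'd G (x, y) (delta_mx 0 i, 0) = gradx g x y 0 i.
    rewrite mxE -(deriveE _ dg).
    have := @derivableP _ _ _ G (x, y) (delta_mx 0 i, 0) (diff_derivable dg).
    move/(is_derive_quotient (F' := fun x' => g x' y : R^o) (x' := x) (u' := delta_mx 0 i)).
    by case=> // h; rewrite /G/= scaler0 add0r.
  exact: mulrC.
rewrite linearZ; have -> : 'd G (x, y) (0, delta_mx 0 i) = grady g x y 0 i.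
  rewrite mxE -(deriveE _ dg).
  have := @derivableP _ _ _ G (x, y) (0, delta_mx 0 i) (diff_derivable dg).
  move/(is_derive_quotient (F' := fun y' => g x y' : R^o) (x' := y) (u' := delta_mx 0 i)).
  by case=> // h; rewrite /G/= scaler0 add0r.
exact: mulrC.
Qed.

Lemma derive_line g x y a b t :
  differentiable (fun z : 'rV[R]_d1 * 'rV[R]_d2 => g z.1 z.2 : R^o)
    (x + t *: a, y + t *: b) ->
  is_derive t 1 (fun s : R => g (x + s *: a) (y + s *: b) : R^o)
    (dotp (gradxy g (x + t *: a) (y + t *: b)) (row_mx a b)).
Proof.
move=> /(@derive_pair g _ _ a b).
rewrite /gradxy dotp_row_mx; apply: is_derive_quotient => h /=.
rewrite [h *: 1]mulr1; congr (g _ _ - _).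
all: by rewrite addrCA -scalerDl.
Qed.

End gradient.

(** * Expected gradients *)

Section real_integrable.
Context {R : realType} {d : measure_display} {T : measurableType d}.
Variable P : probability T R.
Implicit Types X Z : T -> R.

Lemma integrableD_EFin X Z : P.-integrable setT (EFin \o X) ->
  P.-integrable setT (EFin \o Z) -> P.-integrable setT (EFin \o (fun o => X o + Z o)).
Proof.
move=> hX hZ; have -> : EFin \o (fun o => X o + Z o) = ((EFin \o X) \+ (EFin \o Z))%E by [].
exact: integrableD.
Qed.

Lemma integrableZ_EFin c X : P.-integrable setT (EFin \o X) ->
  P.-integrable setT (EFin \o (fun o => c * X o)).
Proof.
by move=> hX; apply: (@integrableZl _ _ _ _ _ measurableT c (EFin \o X)).
Qed.

Lemma integrableB_EFin X Z : P.-integrable setT (EFin \o X) ->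
  P.-integrable setT (EFin \o Z) -> P.-integrable setT (EFin \o (fun o => X o - Z o)).
Proof.
move=> hX hZ; have -> : EFin \o (fun o => X o - Z o) = ((EFin \o X) \- (EFin \o Z))%E by [].
exact: integrableB.
Qed.

Lemma integrable_cst_EFin c : P.-integrable setT (EFin \o (fun=> c)).
Proof. exact: finite_measure_integrable_cst. Qed.

Lemma integrable_sum_EFin (I : eqType) (r : seq I) (X : I -> T -> R) :
  (forall i, i \in r -> P.-integrable setT (EFin \o X i)) ->
  P.-integrable setT (EFin \o (fun o => \sum_(i <- r) X i o)).
Proof.
elim: r => [_|i r IH hX].
  by under [_ \o _]eq_fun do rewrite big_nil; exact: integrable_cst_EFin.
under [_ \o _]eq_fun do rewrite big_cons.
apply: integrableD_EFin; first exact: hX (mem_head _ _).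
by apply: IH => j jr; apply: hX; rewrite inE jr orbT.
Qed.

Lemma le_integrable_EFin X Z : measurable_fun setT X ->
  (forall o, `|X o| <= Z o) -> P.-integrable setT (EFin \o Z) ->
  P.-integrable setT (EFin \o X).
Proof.
move=> mX hle hZ; apply: (le_integrable measurableT _ _ hZ).
  exact/measurable_EFinP.
by move=> o _ /=; rewrite lee_fin (le_trans (hle o))// ler_norm.
Qed.

Lemma Rintegral_cst1 c : \int[P]_o c = c.
Proof.
rewrite Rintegral_cst//; have := probability_setT P => /= PT.
by rewrite PT mulr1.
Qed.

Lemma Rintegral_sum (I : eqType) (r : seq I) (X : I -> T -> R) :
  (forall i, i \in r -> P.-integrable setT (EFin \o X i)) ->
  \int[P]_o (\sum_(i <- r) X i o) = \sum_(i <- r) \int[P]_o X i o.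
Proof.
elim: r => [_|i r IH hX].
  by under eq_Rintegral do rewrite big_nil; rewrite big_nil Rintegral_cst1.
have hr j : j \in r -> P.-integrable setT (EFin \o X j).
  by move=> jr; apply: hX; rewrite inE jr orbT.
under eq_Rintegral do rewrite big_cons.
rewrite big_cons RintegralD ?IH//; first exact: hX (mem_head _ _).
exact: integrable_sum_EFin.
Qed.

End real_integrable.

Section segment_descent.
Context {R : realType} {d1 d2 : nat}.
Variable Y : set 'rV[R]_d2.
Hypothesis Ycvx : forall y y' (t : R),
  Y y -> Y y' -> 0 <= t <= 1 -> Y (y + t *: (y' - y)).
Implicit Types g : 'rV[R]_d1 -> 'rV[R]_d2 -> R.

(** By convexity of [Y] the segment stays in the region where [g] is differentiable, and
    [descent_1d] applies to the restriction of [g] to it. *)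
Lemma segment_descent_le g x x' y y' (K : R) : differentiable_on Y g ->
  Y y -> Y y' ->
  (forall t : R, 0 <= t <= 1 ->
    dotp (gradxy g (x + t *: (x' - x)) (y + t *: (y' - y)) - gradxy g x y)
      (row_mx (x' - x) (y' - y)) <= K * t) ->
  g x' y' <= g x y + dotp (gradxy g x y) (row_mx (x' - x) (y' - y)) + K / 2.
Proof.
move=> dg Yy Yy' hK.
pose u := row_mx (x' - x) (y' - y).
have := @descent_1d R (fun t => g (x + t *: (x' - x)) (y + t *: (y' - y)))
  (fun t => dotp (gradxy g (x + t *: (x' - x)) (y + t *: (y' - y))) u) K.
rewrite !scale0r !addr0 !scale1r !(addrC _ (_ - _)) !subrK; apply.
- by move=> t ht; apply: derive_line; apply: dg; exact: Ycvx.
- by move=> t ht; rewrite -dotpBl; have := hK t ht; rewrite (addrC x) (addrC y).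
Qed.

Lemma segment_descent_ge g x x' y y' (K : R) : differentiable_on Y g ->
  Y y -> Y y' ->
  (forall t : R, 0 <= t <= 1 ->
    - (K * t) <=
    dotp (gradxy g (x + t *: (x' - x)) (y + t *: (y' - y)) - gradxy g x y)
      (row_mx (x' - x) (y' - y))) ->
  g x y + dotp (gradxy g x y) (row_mx (x' - x) (y' - y)) - K / 2 <= g x' y'.
Proof.
move=> dg Yy Yy' hK.
pose u := row_mx (x' - x) (y' - y).
have := @descent_1d R (fun t => - g (x + t *: (x' - x)) (y + t *: (y' - y)))
  (fun t => - dotp (gradxy g (x + t *: (x' - x)) (y + t *: (y' - y))) u) K.
rewrite !scale0r !addr0 !scale1r !(addrC _ (_ - _)) !subrK => H.
suff : - g x' y' <= - g x y - dotp (gradxy g x y) u + K / 2 by rewrite -/u; lra.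
apply: H.
- move=> t ht.
  have := @is_deriveN R R^o R^o (fun s : R => g (x + s *: (x' - x)) (y + s *: (y' - y))) t 1 _
   (derive_line (dg (x + t *: (x' - x)) (y + t *: (y' - y)) (Ycvx Yy Yy' ht))).
  by rewrite ?(addrC x) ?(addrC y).
- move=> t ht; have := hK t ht; rewrite dotpBl (addrC x) (addrC y) -/u; lra.
Qed.

(** For the sampled functions the remainder depends on the sample only through [L]; this uniformity
    is what lets the derivative pass under the expectation. *)
Lemma lipschitz_gradient_quadratic (L : R) g x x' y y' :
  differentiable_on Y g -> lipschitz_gradient Y L g -> Y y -> Y y' ->
  `|g x' y' - g x y - dotp (gradxy g x y) (row_mx (x' - x) (y' - y))| <=
  L / 2 * enorm (row_mx (x' - x) (y' - y)) ^+ 2.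
Proof.
move=> dg lg Yy Yy'; set u := row_mx _ _.
have H (t : R) : 0 <= t <= 1 -> `|dotp (gradxy g (x + t *: (x' - x)) (y + t *: (y' - y))
    - gradxy g x y) u| <= L * enorm u ^+ 2 * t.
  move=> ht; set v := _ - gradxy g x y.
  have := lg (x + t *: (x' - x)) x _ y (Ycvx Yy Yy' ht) Yy.
  rewrite -/v row_mxBB !(addrC _ (t *: _)) !addrK -scale_row_mx enormZ.
  case/andP: (ht) => t0 _; rewrite (ger0_norm t0) -/u => h.
  have h1 := dotp_le v u; have := dotp_le (- v) u; rewrite enormN dotpNl => h2.
  have hu := enorm_ge0 u.
  have h3 : enorm v * enorm u <= L * (t * enorm u) * enorm u by rewrite ler_wpM2r.
  by rewrite ler_norml; apply/andP; split; lra.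
have hle := @segment_descent_le g x x' y y' (L * enorm u ^+ 2) dg Yy Yy'.
have hge := @segment_descent_ge g x x' y y' (L * enorm u ^+ 2) dg Yy Yy'.
rewrite -/u in hle hge.
have {}hle : g x' y' <= g x y + dotp (gradxy g x y) u + L * enorm u ^+ 2 / 2.
  by apply: hle => t /H; rewrite ler_norml => /andP[].
have {}hge : g x y + dotp (gradxy g x y) u - L * enorm u ^+ 2 / 2 <= g x' y'.
  by apply: hge => t /H; rewrite ler_norml => /andP[].
by rewrite ler_norml; apply/andP; split; lra.
Qed.

End segment_descent.

Section expected_gradient.
Context {R : realType} {d1 d2 : nat} {d : measure_display} {Xi : measurableType d}.
Variables (D : probability Xi R) (f : Xi -> 'rV[R]_d1 -> 'rV[R]_d2 -> R).
Variables (Y : set 'rV[R]_d2) (L : R).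
Hypothesis Ycvx : forall y y' (t : R),
  Y y -> Y y' -> 0 <= t <= 1 -> Y (y + t *: (y' - y)).
Hypothesis f_meas : forall x y, measurable_fun setT (fun s => f s x y).
Hypothesis f_int : forall x y, Y y -> D.-integrable setT (fun s => (f s x y)%:E).
Hypothesis f_diff : forall s, differentiable_on Y (f s).
Hypothesis obj_diff : differentiable_on Y (objective D f).
Hypothesis f_lip : forall s, lipschitz_gradient Y L (f s).

Implicit Types (g : 'rV[R]_d1 -> 'rV[R]_d2 -> R).
Implicit Types (x a : 'rV[R]_d1) (y b : 'rV[R]_d2).

Lemma derive_line0 g x y a b : differentiable_on Y g -> Y y ->
  (fun n => n.+1%:R * (g (x + n.+1%:R^-1 *: a) (y + n.+1%:R^-1 *: b) - g x y))
    @ \oo --> (dotp (gradxy g x y) (row_mx a b) : R).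
Proof.
move=> dg Yy; have := @derive_line R d1 d2 g x y a b 0.
rewrite !scale0r !addr0 => /(_ (dg _ _ Yy)) /derive_seq.
under eq_fun do rewrite add0r [_ *: 1]mulr1 !scale0r !addr0.
by [].
Qed.

(** A pointwise limit of difference quotients. The points [y + b / (n + 1)] may leave [Y], but
    [f_meas] holds at all points. *)
Lemma measurable_grad x y a b : Y y ->
  measurable_fun setT (fun s => dotp (gradxy (f s) x y) (row_mx a b)).
Proof.
move=> Yy.
apply: (@measurable_fun_cvg _ _ _ setT (fun n s => n.+1%:R * (f s (x + n.+1%:R^-1 *: a) (y + n.+1%:R^-1 *: b) - f s x y))).
- by move=> n; apply: measurable_funM => //; exact: measurable_funB.
- by move=> s _; exact: derive_line0.
Qed.

Lemma measurable_gradx x y i : Y y ->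
  measurable_fun setT (fun s => gradx (f s) x y 0 i).
Proof.
move=> /(@measurable_grad x y (delta_mx 0 i) 0).
by under eq_fun do rewrite /gradxy dotp_row_mx dotp0r addr0 dotp_delta.
Qed.

Lemma measurable_grady x y i : Y y ->
  measurable_fun setT (fun s => grady (f s) x y 0 i).
Proof.
move=> /(@measurable_grad x y 0 (delta_mx 0 i)).
by under eq_fun do rewrite /gradxy dotp_row_mx dotp0r add0r dotp_delta.
Qed.

(** The quotients [q n] converge to the derivative at rate [C / (n + 1)] uniformly in the sample, so
    their means converge to the mean derivative; these means are also the quotients of the
    objective. The [y] direction must be of the form [y' - y], since [f] is integrable on [Y]
    only. *)
Lemma expected_grad x y a y' : Y y -> Y y' ->
  D.-integrable setT (fun s => (dotp (gradxy (f s) x y) (row_mx a (y' - y)))%:E) /\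
  \int[D]_s dotp (gradxy (f s) x y) (row_mx a (y' - y)) =
  dotp (gradxy (objective D f) x y) (row_mx a (y' - y)).
Proof.
move=> Yy Yy'; set u := row_mx _ _.
pose q n s := n.+1%:R * (f s (x + n.+1%:R^-1 *: a) (y + n.+1%:R^-1 *: (y' - y)) - f s x y).
pose C := L / 2 * enorm u ^+ 2.
have Yn n : Y (y + n.+1%:R^-1 *: (y' - y)).
  by apply: Ycvx => //; rewrite invr_ge0 ler0n/= invf_le1// ler1n.
have hq n s : `|q n s - dotp (gradxy (f s) x y) u| <= C / n.+1%:R.
  have := @lipschitz_gradient_quadratic R d1 d2 Y Ycvx L (f s) x
    (x + n.+1%:R^-1 *: a) y _ (f_diff s) (f_lip s) Yy (Yn n).
  rewrite !(addrC _ (n.+1%:R^-1 *: _)) !addrK -scale_row_mx -/u dotpZr enormZ.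
  rewrite (gtr0_norm (_ : 0 < n.+1%:R^-1)) ?invr_gt0// => h.
  have n0 : 0 < n.+1%:R :> R by [].
  rewrite /q -(@ler_pM2l _ n.+1%:R^-1) ?invr_gt0//.
  have -> : n.+1%:R^-1 * (C / n.+1%:R) = L / 2 * (n.+1%:R^-1 * enorm u) ^+ 2.
    by rewrite /C; ring.
  apply: le_trans h; rewrite -[X in X * `|_|](gtr0_norm (_ : 0 < n.+1%:R^-1)) ?invr_gt0//.
  by rewrite -normrM mulrBr mulKf ?gt_eqF// !(addrC _ (n.+1%:R^-1 *: _)).
have iq n : D.-integrable setT (EFin \o q n).
  by apply: integrableZ_EFin; apply: integrableB_EFin; exact: f_int.
pose X s := dotp (gradxy (f s) x y) u.
(* The quotient of index 0 is integrable and lies within [|C|] of [X]. *)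
have ih : D.-integrable setT (EFin \o X).
  apply: (@le_integrable_EFin _ _ _ D _ (fun s => `|q 0%N s| + `|C|)).
  - exact: measurable_grad.
  - move=> s; have := hq 0%N s; rewrite divr1 => h.
    have -> : X s = q 0%N s - (q 0%N s - X s) by rewrite subKr.
    by rewrite (le_trans (ler_normB _ _))// lerD2l (le_trans h)// ler_norm.
  - by apply: integrableD_EFin; [exact: integrable_norm (iq 0%N)|exact: integrable_cst_EFin].
split => //.
have oE x0 y0 : Y y0 -> \int[D]_s f s x0 y0 = objective D f x0 y0.
  by rewrite /objective unlock.
have Iq n : \int[D]_s q n s = n.+1%:R * (objective D f (x + n.+1%:R^-1 *: a)
    (y + n.+1%:R^-1 *: (y' - y)) - objective D f x y).
  rewrite /q RintegralZl//; last by apply: integrableB_EFin; exact: f_int.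
  rewrite RintegralB//; try exact: f_int.
  by rewrite !oE.
have c1 : (fun n => \int[D]_s q n s) @ \oo --> (dotp (gradxy (objective D f) x y) u : R).
  by under eq_fun do rewrite Iq; exact: derive_line0.
have c2 : (fun n => \int[D]_s q n s) @ \oo --> (\int[D]_s X s : R).
  have c0 : (fun n => `|C| * n.+1%:R^-1) @ \oo --> (0 : R).
    by rewrite -(mulr0 `|C|); apply: cvgM; [exact: cvg_cst|exact: cvg_harmonic].
  apply/cvgrPdist_le => e e0.
  move/cvgrPdist_le : c0 => /(_ e e0); apply: filterS => n /=.
  rewrite sub0r normrN => hn; rewrite -RintegralB//.
  apply: (le_trans (le_normr_Rintegral _ _)) => //.
    exact: integrableB_EFin.
  apply: le_trans hn; rewrite normrM normr_id ger0_norm ?invr_ge0//.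
  have -> : `|C| * n.+1%:R^-1 = \int[D]_s (`|C| * n.+1%:R^-1).
    by rewrite Rintegral_cst1.
  apply: le_Rintegral => //.
  - by apply: integrable_norm; exact: integrableB_EFin.
  - exact: finite_measure_integrable_cst.
  - move=> s _; rewrite distrC (le_trans (hq n s))// ler_wpM2r ?invr_ge0//.
    exact: ler_norm.
exact: (cvg_unique _ c2 c1).
Qed.

End expected_gradient.

(** * Joint measurability of Lipschitz integrands *)

Section caratheodory.
Context {R : realType} {d : measure_display} {T : measurableType d}.

Lemma measurable_enorm n (Z : T -> 'rV[R]_n) :
  (forall i, measurable_fun setT (fun o => Z o 0 i)) ->
  measurable_fun setT (fun o => enorm (Z o)).
Proof.
move=> mZ; apply: measurableT_comp => //.
  by apply: continuous_measurable_fun; exact: sqrt_continuous.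
by apply: measurable_sum => i; apply: measurable_funX.
Qed.

Lemma enorm_rat_approx n (z : 'rV[R]_n) (e : R) : 0 < e ->
  exists q : 'rV[rat]_n, enorm (z - map_mx ratr q) < e.
Proof.
move=> e0; pose K := Num.sqrt n%:R + 1 : R.
have K0 : 0 < K by rewrite ltr_wpDl// sqrtr_ge0.
have ex i : exists q : rat, ratr q \in `](z 0 i - e / K), (z 0 i)[%R.
  by apply: rat_in_itvoo; rewrite ltrBlDr ltrDl divr_gt0.
have [q qP] := choice ex.
exists (\row_i q i).
apply: le_lt_trans (enorm_le_norm _) _.
have le1 : `|z - map_mx ratr (\row_i q i)| <= e / K.
  rewrite [leLHS](_ : _ = mx_norm (z - map_mx ratr (\row_i q i)))// mx_normrE.
  apply: bigmax_le => [|[i j] _]; first by rewrite divr_ge0// ltW.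
  rewrite ord1 !mxE /=.
  have := qP j; rewrite in_itv/= => /andP[q1 q2].
  by rewrite gtr0_norm; lra.
apply: le_lt_trans (ler_wpM2l (sqrtr_ge0 _) le1) _.
by rewrite mulrCA gtr_pMr// ltr_pdivrMr// mul1r /K ltrDl.
Qed.

Context {d' : measure_display} {S : measurableType d'}.

(* An L-Lipschitz function is the infimum over rational q of h s q + L |z - q|;
   this reduces joint measurability to countably many sections. *)
Lemma measurable_caratheodory n (h : S -> 'rV[R]_n -> R) (L : R)
    (xi : T -> S) (Z : T -> 'rV[R]_n) :
  (forall z, measurable_fun setT (h ^~ z)) ->
  (forall s z z', `|h s z - h s z'| <= L * enorm (z - z')) ->
  measurable_fun setT xi ->
  (forall i, measurable_fun setT (fun o => Z o 0 i)) ->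
  measurable_fun setT (fun o => h (xi o) (Z o)).
Proof.
move=> mh lh mxi mZ.
apply: (measurability _ (RGenInftyO.measurableE R)) => //.
move=> _ [_ [a ->] <-]; rewrite setTI.
pose r (q : 'rV[rat]_n) : 'rV[R]_n := map_mx ratr q.
pose U q := (fun o => h (xi o) (r q) + `|L| * enorm (Z o - r q)) @^-1` `]-oo, a[.
have -> : (fun o => h (xi o) (Z o)) @^-1` `]-oo, a[ = \bigcup_q U q.
  apply/seteqP; split => [ o| o [q _]]; rewrite /U /= !in_itv/= => hlt.
    (* The distance to the rational point is paid twice, once by the variation of [h] and once by
       the penalty; [2 * |L| * e] is still below the gap to [a]. *)
    pose e := (a - h (xi o) (Z o)) / (2 * `|L| + 1).
    have D0 : 0 < 2 * `|L| + 1 by rewrite ltr_wpDl// mulr_ge0.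
    have e0 : 0 < e by rewrite divr_gt0// subr_gt0.
    have [q hq] := enorm_rat_approx (Z o) e0.
    exists q => //; rewrite /= in_itv/=.
    have := lh (xi o) (r q) (Z o); rewrite enormB ler_norml => /andP[_ h2].
    have h3 : L * enorm (Z o - r q) <= `|L| * enorm (Z o - r q).
      by rewrite ler_wpM2r ?enorm_ge0// ler_norm.
    have h4 : e * (2 * `|L| + 1) = a - h (xi o) (Z o) by rewrite /e divfK// gt_eqF.
    have h5 : `|L| * enorm (Z o - r q) <= `|L| * e by rewrite ler_wpM2l// ltW.
    lra.
  have := lh (xi o) (Z o) (r q); rewrite ler_norml => /andP[_ h2].
  have h3 : L * enorm (Z o - r q) <= `|L| * enorm (Z o - r q).
    by rewrite ler_wpM2r ?enorm_ge0// ler_norm.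
  lra.
apply: countable_bigcupT_measurable; first exact: countableP.
move=> q; rewrite /U -[X in measurable X]setTI.
have mm : measurable_fun setT (fun o => h (xi o) (r q) + `|L| * enorm (Z o - r q)).
  apply: measurable_funD; first exact: (measurableT_comp (mh (r q)) mxi).
  apply: measurable_funM => //; apply: measurable_enorm => i.
  under eq_fun do rewrite !mxE.
  exact: measurable_funB.
exact: mm.
Qed.

End caratheodory.

(** * Independence and mini-batches *)

Section independence.
Context {R : realType} {d d' : measure_display} {Omega : measurableType d}
  {Xi : measurableType d'} {I : choiceType}.
Variables (P : probability Omega R) (D : probability Xi R) (K : set I).
Variable xi : I -> {RV P >-> Xi}.
Hypothesis xi_iid : iid D K xi.

(* The pi-system of finite rectangles generating the sigma-algebra of the xi i, i in J. *)
Definition past (J : set I) : set_system Omega := [set A | exists (s : seq I) (B : I -> set Xi),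
  [/\ uniq s, (forall i, i \in s -> J i), (forall i, measurable (B i)) &
      A = \bigcap_(i in [set` s]) (xi i @^-1` B i)]].

Local Notation OJ J := (g_sigma_algebraType (past J)).

Lemma past_measurable J : past J `<=` measurable.
Proof.
move=> _ [s [B [us sJ mB ->]]].
apply: fin_bigcap_measurable => [|i _]; first exact: finite_seq.
by rewrite -[X in measurable X]setTI; exact: measurable_funP.
Qed.

Lemma past_setI_closed J : setI_closed (past J).
Proof.
move=> _ _ [s1 [B1 [us1 sJ1 mB1 ->]]] [s2 [B2 [us2 sJ2 mB2 ->]]].
exists (undup (s1 ++ s2)).
exists (fun i => (if i \in s1 then B1 i else setT) `&` (if i \in s2 then B2 i else setT)).
split; first exact: undup_uniq.
- by move=> i; rewrite mem_undup mem_cat => /orP[/sJ1|/sJ2].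
- by move=> i; apply: measurableI; case: ifP.
apply/seteqP; split => o /=.
  move=> [h1 h2] i /=; rewrite mem_undup mem_cat => _; split.
    by case: ifP => // i1; exact: h1.
  by case: ifP => // i2; exact: h2.
move=> h; split => i /= i12.
  by have := h i; rewrite /= mem_undup mem_cat i12 => /(_ isT)[].
by have := h i; rewrite /= mem_undup mem_cat i12 orbT => /(_ isT)[].
Qed.

Lemma past_subset J J' : J `<=` J' -> past J `<=` past J'.
Proof.
move=> JJ' _ [s [B [us sJ mB ->]]]; exists s, B; split => // i /sJ; exact: JJ'.
Qed.

Lemma measurable_past J (A : set (OJ J)) : measurable A -> @measurable d Omega A.
Proof.
exact: (smallest_sub (@sigma_algebra_measurable _ Omega) (@past_measurable J)).
Qed.

Lemma measurable_id_past J : measurable_fun setT (id : Omega -> OJ J).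
Proof. by move=> _ A mA; rewrite setTI preimage_id; exact: (@measurable_past J A). Qed.

Lemma measurable_id_pastS J J' : J `<=` J' ->
  measurable_fun setT (id : OJ J' -> OJ J).
Proof.
move=> JJ' _ A mA; rewrite setTI preimage_id.
exact: (sub_smallest2r (smallest_sigma_algebra _ _) (past_subset JJ') mA).
Qed.

Lemma measurable_xi_past J q : J q -> measurable_fun setT (xi q : OJ J -> Xi).
Proof.
move=> Jq _ A mA; rewrite setTI; apply: sub_gen_smallest.
exists [:: q], (fun=> A); split => //.
  by move=> i; rewrite inE => /eqP ->.
apply/seteqP; split => o; first by move=> h i /=; rewrite inE => /eqP ->.
by move/(_ q); apply; rewrite /= inE.
Qed.

(** As functions of [A] both sides are finite measures, [P] restricted to the event on [xi q] and
    [P] scaled by [D B]. They agree on the pi-system [past J], where the claim is independence for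
    one more index, hence on the sigma-algebra it generates. *)
Lemma independent_past J q (A : set Omega) B : J `<=` K -> K q -> ~ J q ->
  <<s past J >> A -> measurable B ->
  P (A `&` (xi q @^-1` B)) = (P A * D B)%E.
Proof.
move=> JK Kq Jq sA mB.
have mC : measurable (xi q @^-1` B).
  by rewrite -[X in measurable X]setTI; exact: measurable_funP.
have DB : (fine (D B))%:E = D B by rewrite fineK// fin_num_measure.
have D0 : 0 <= fine (D B) by exact: fine_ge0.
pose r : {nonneg R} := NngNum D0.
have rE X : mscale r P X = (D B * P X)%E by rewrite -DB.
have PT : past J setT.
  by exists [::], (fun=> setT); split => //; apply/seteqP; split.
have := @g_sigma_algebra_measure_unique _ R Omega (past J) (@past_measurable J)
   (fun=> setT) (fun=> PT) _ (mrestr P mC) (mscale r P).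
rewrite bigcup_const// => /(_ erefl (@past_setI_closed J)).
move=> /(_ _ _ A sA) H.
transitivity (mscale r P A).
  apply: H => [_ [s [E [us sJ mE ->]]]|_]; last first.
    by rewrite /= /mrestr setTI (le_lt_trans (probability_le1 _ _))// ltry.
  rewrite [RHS]rE /= /mrestr.
  (* Placing [B] at the index [q], absent from [s], turns the intersection into a single cylinder
     over [q :: s]. *)
  pose E' i := if i == q then B else E i.
  have qs : q \notin s by apply/negP => /sJ.
  have sE i : i \in s -> E' i = E i.
    by move=> si; rewrite /E'; case: eqP => // iq; rewrite -iq si in qs.
  have -> : \bigcap_(i in [set` s]) (xi i @^-1` E i) `&` (xi q @^-1` B) =
     \bigcap_(i in [set` q :: s]) (xi i @^-1` E' i).
    apply/seteqP; split => o.
      move=> [h hq] i /=; rewrite inE => /orP[/eqP ->|si]; first by rewrite /E' eqxx.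
      by rewrite sE//; exact: h.
    move=> h; split.
      by move=> i /= si; have := h i; rewrite /= inE si orbT sE// => /(_ isT).
    by have := h q; rewrite /= inE eqxx /E' eqxx => /(_ isT).
  have [dist ind] := xi_iid.
  rewrite (ind (q :: s) E').
  - rewrite big_cons {1}/E' eqxx.
    have -> : P (xi q @^-1` B) = D B by exact: (dist q B Kq mB).
    congr (_ * _)%E; rewrite (ind s E us) => [|i /sJ /JK//|//].
    by rewrite !big_seq; apply: eq_bigr => i si; rewrite sE.
  - by rewrite /= qs.
  - by move=> i; rewrite inE => /orP[/eqP ->//|/sJ /JK].
  - by move=> i; rewrite /E'; case: ifP.
by rewrite [LHS]rE muleC.
Qed.

Section fresh_sample.
Variables (J : set I) (q : I).
Hypotheses (JK : J `<=` K) (Kq : K q) (Jq : ~ J q).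

(** The identity seen as a random variable whose target carries the sigma-algebra of the past; its
    law is the restriction of [P] to the past. *)
Let idJ : Omega -> OJ J := id.
Let idJ_mixin := isMeasurableFun.Build _ _ _ _ idJ (@measurable_id_past J).
Let idJ_fun : {RV P >-> OJ J} := MeasurableFun.Pack (MeasurableFun.Class idJ_mixin).

Let phi : Omega -> (OJ J * Xi)%type := fun o => (o, xi q o).

Let mphi : measurable_fun setT phi.
Proof.
by apply/measurable_fun_pairP; split => //=; exact: measurable_id_past.
Qed.

(** Independence in product form: the pair of past and fresh sample has a product law, by uniqueness
    on rectangles. Conditioning on the past thereby becomes integration over the second factor. *)
Let joint_law (X : set (OJ J * Xi)) : measurable X ->
  pushforward P phi X = (distribution P idJ_fun \x D)%E X.
Proof.
move=> mX; have := @product_measure_unique _ _ _ _ R (distribution P idJ_fun) D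
  (distribution P (MeasurableFun.Pack (MeasurableFun.Class
     (isMeasurableFun.Build _ _ _ _ phi mphi)))).
move=> /(_ _ X mX) => <- // A B mA mB.
exact: (@independent_past J q A B JK Kq Jq mA mB).
Qed.

Lemma ge0_integral_fresh (g : OJ J * Xi -> \bar R) :
  measurable_fun setT g -> (forall z, 0 <= g z)%E ->
  (\int[P]_o g (o, xi q o) = \int[P]_o \int[D]_s g (o, s))%E.
Proof.
move=> mg g0.
transitivity (\int[pushforward P phi]_z g z)%E.
  by rewrite ge0_integral_pushforward.
transitivity (\int[distribution P idJ_fun \x D]_z g z)%E.
  by apply: eq_measure_integral => A mA _; exact: joint_law.
rewrite fubini_tonelli1// ge0_integral_distribution//.
- exact: measurable_fun_fubini_tonelli_F.
- by move=> o; exact: integral_ge0.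
Qed.

(** Fubini for a signed integrand that is centred given the past; integrability for the product law
    is inherited from the one along [xi q]. *)
Lemma integral_fresh (g : OJ J * Xi -> \bar R) :
  measurable_fun setT g -> P.-integrable setT (fun o => g (o, xi q o)) ->
  (forall o, \int[D]_s g (o, s) = 0)%E ->
  (\int[P]_o g (o, xi q o) = 0)%E.
Proof.
move=> mg ig g0.
transitivity (\int[pushforward P phi]_z g z)%E.
  by rewrite integral_pushforward.
transitivity (\int[distribution P idJ_fun \x D]_z g z)%E.
  by apply: eq_measure_integral => A mA _; exact: joint_law.
rewrite -integral12_prod_meas1.
  by apply: integral0_eq => o _; exact: g0.
apply/integrableP; split => //.
have /integrableP[_] := integrable_pushforward mphi mg ig measurableT.
apply: le_lt_trans.
rewrite le_eqVlt; apply/orP; left; apply/eqP.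
by apply: eq_measure_integral => A mA _; exact/esym/joint_law.
Qed.

End fresh_sample.
End independence.

(** * Centred noise from a fresh mini-batch *)

Section minibatch.
Context {R : realType} {d d' : measure_display} {Omega : measurableType d}
  {Xi : measurableType d'} {I : choiceType}.
Variables (P : probability Omega R) (D : probability Xi R) (K : set I).
Variable xi : I -> {RV P >-> Xi}.
Hypothesis xi_iid : iid D K xi.

Local Notation OJ J := (g_sigma_algebraType (past xi J)).

Definition adapted (J : set I) n (X : Omega -> 'rV[R]_n) :=
  forall i, measurable_fun (setT : set (OJ J)) (fun o => X o 0 i).

Lemma adapted_measurable J n (X : Omega -> 'rV[R]_n) i :
  adapted J X -> measurable_fun (setT : set Omega) (fun o => X o 0 i).
Proof.
by move=> /(_ i) mX; exact: (measurableT_comp mX (@measurable_id_past _ _ _ _ _ _ P xi J)).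
Qed.

Lemma adaptedS J J' n (X : Omega -> 'rV[R]_n) :
  J `<=` J' -> adapted J X -> adapted J' X.
Proof.
by move=> JJ' mX i; exact: (measurableT_comp (mX i) (measurable_id_pastS JJ')).
Qed.

(** The joint measurability lemma with a one-point sample space. *)
Lemma adapted_lipschitz J N n (L : R) (h : 'rV[R]_N -> 'rV[R]_n) (Z : Omega -> 'rV[R]_N) :
  (forall z z', enorm (h z - h z') <= L * enorm (z - z')) ->
  adapted J Z -> adapted J (fun o => h (Z o)).
Proof.
move=> hL mZ i.
apply: (@measurable_caratheodory _ _ (OJ J) _ unit N (fun _ z => h z 0 i) L (fun=> tt) Z) => //.
move=> _ z z'; apply: le_trans (hL z z').
by have := abs_coord_le (h z - h z') i; rewrite !mxE.
Qed.

Variable n : nat.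
Implicit Types (e : Omega -> 'rV[R]_n) (g : Omega -> Xi -> 'rV[R]_n).

(** In [g o s], [o] carries the past and [s] is a fresh sample. The conditions say that [g] is
    centred given the past and that [V] is an integrable bound of its conditional second moment. *)
Definition noise (J : set I) g (V : Omega -> R) := [/\
  forall i, measurable_fun (setT : set (OJ J * Xi)) (fun z => g z.1 z.2 0 i),
  forall o i, D.-integrable setT (EFin \o (fun s => g o s 0 i)),
  forall o i, \int[D]_s g o s 0 i = 0,
  forall o, (\int[D]_s (enorm (g o s) ^+ 2)%:E <= (V o)%:E)%E &
  P.-integrable setT (EFin \o V)].

Lemma noiseS J J' g V : J `<=` J' -> noise J g V -> noise J' g V.
Proof.
move=> JJ' [mg ig g0 gV iV]; split => // i.
have mid : measurable_fun (setT : set (OJ J' * Xi)) (fun z => (z.1, z.2) : OJ J * Xi).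
  apply/measurable_fun_pairP; split; last exact: measurable_snd.
  have h := @measurableT_comp _ _ _ (OJ J' * Xi)%type (OJ J') (OJ J) id setT fst
    (measurable_id_pastS JJ') measurable_fst.
  exact: h.
exact: (measurableT_comp (mg i) mid).
Qed.

(** Pythagoras in mean square: [e] is known from the past and the noise is centred given the past,
    so the cross term integrates to zero. *)
Lemma fresh_sample_sqr J q e g V c : J `<=` K -> K q -> ~ J q ->
  adapted J e -> P.-integrable setT (EFin \o (fun o => enorm (e o) ^+ 2)) ->
  noise J g V ->
  P.-integrable setT (EFin \o (fun o => enorm (e o + c *: g o (xi q o)) ^+ 2)) /\
  \int[P]_o (enorm (e o + c *: g o (xi q o)) ^+ 2) <=
  \int[P]_o (enorm (e o) ^+ 2) + c ^+ 2 * \int[P]_o V o.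
Proof.
move=> JK Kq Jq me ie [mg ig g0 gV iV].
have mgq i : measurable_fun (setT : set Omega) (fun o => g o (xi q o) 0 i).
  have mphi : measurable_fun (setT : set Omega) (fun o => (o, xi q o) : OJ J * Xi).
    by apply/measurable_fun_pairP; split => //=; exact: measurable_id_past.
  exact: (measurableT_comp (mg i) mphi).
have mg2 : measurable_fun (setT : set (OJ J * Xi)) (fun z => (enorm (g z.1 z.2) ^+ 2)%:E).
  by apply/measurable_EFinP/measurable_funX; exact: measurable_enorm.
have g20 (z : OJ J * Xi) : (0 <= (enorm (g z.1 z.2) ^+ 2)%:E)%E by rewrite lee_fin sqr_ge0.
have leV : (\int[P]_o (enorm (g o (xi q o)) ^+ 2)%:E <= \int[P]_o (V o)%:E)%E.
  rewrite (ge0_integral_fresh xi_iid JK Kq Jq mg2 g20).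
  apply: ge0_le_integral => //.
  - by move=> o _; apply: integral_ge0 => s _; rewrite lee_fin sqr_ge0.
  - have h : measurable_fun (setT : set (OJ J)) (fubini_F D
        (fun z : OJ J * Xi => (enorm (g z.1 z.2) ^+ 2)%:E)).
      exact: measurable_fun_fubini_tonelli_F.
    exact: (measurableT_comp h (@measurable_id_past _ _ _ _ _ _ P xi J)).
  - exact: measurable_int iV.
  - by move=> o _; exact: gV.
have ig2 : P.-integrable setT (EFin \o (fun o => enorm (g o (xi q o)) ^+ 2)).
  apply/integrableP; split.
    by apply/measurable_EFinP/measurable_funX; exact: measurable_enorm.
  under eq_integral do rewrite gee0_abs ?lee_fin ?sqr_ge0//.
  by apply: le_lt_trans leV _; exact: integrable_lty.
have leVr : \int[P]_o (enorm (g o (xi q o)) ^+ 2) <= \int[P]_o V o.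
  by apply: fine_le => //; exact: integrable_fin_num.
have meq i : measurable_fun (setT : set Omega) (fun o => e o 0 i) by exact: adapted_measurable me.
(* Both factors are square integrable, so the product is dominated by the sum of squares; this
   integrability is what signed Fubini requires. *)
have icross i : P.-integrable setT (EFin \o (fun o => e o 0 i * g o (xi q o) 0 i)).
  apply: (@le_integrable_EFin _ _ _ P _
    (fun o => enorm (e o) ^+ 2 + enorm (g o (xi q o)) ^+ 2)).
  - exact: measurable_funM.
  - move=> o; rewrite normrM.
    have h1 := abs_coord_le (e o) i; have h2 := abs_coord_le (g o (xi q o)) i.
    have := ler_pM (normr_ge0 _) (normr_ge0 _) h1 h2.
    have := sqr_ge0 (enorm (e o) - enorm (g o (xi q o))).
    have := sqr_ge0 (enorm (e o)); have := sqr_ge0 (enorm (g o (xi q o))).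
    by lra.
  - exact: integrableD_EFin.
have cross0 i : \int[P]_o (e o 0 i * g o (xi q o) 0 i) = 0.
  rewrite /Rintegral.
  have mz : measurable_fun (setT : set (OJ J * Xi)) (fun z => (e z.1 0 i * g z.1 z.2 0 i)%:E).
    apply/measurable_EFinP/measurable_funM => //.
    exact: (measurableT_comp (me i) measurable_fst).
  have h0 := integral_fresh xi_iid JK Kq Jq mz (icross i).
  rewrite h0//= => o; rewrite (_ : (fun s => _) = (fun s => (e o 0 i)%:E * (g o s 0 i)%:E)%E)//.
  rewrite integralZl//; last exact: ig.
  by rewrite -(fineK (integrable_fin_num measurableT (ig o i))) -EFinM [fine _]g0 mulr0.
have sqE : forall o, enorm (e o + c *: g o (xi q o)) ^+ 2 = enorm (e o) ^+ 2 +
    (2 * c * \sum_(i < n) e o 0 i * g o (xi q o) 0 i + c ^+ 2 * enorm (g o (xi q o)) ^+ 2).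
  move=> o.
  by rewrite enorm_sqrD dotpZr enormZ exprMn real_normK ?num_real// mulrA addrA.
have i1 : P.-integrable setT (EFin \o (fun o =>
    2 * c * \sum_(i < n) e o 0 i * g o (xi q o) 0 i)).
  by apply: integrableZ_EFin; apply: integrable_sum_EFin => i _; exact: icross.
have i2 := integrableZ_EFin (c ^+ 2) ig2.
split.
  rewrite (_ : (fun o => _) = (fun o => enorm (e o) ^+ 2 +
    (2 * c * \sum_(i < n) e o 0 i * g o (xi q o) 0 i + c ^+ 2 * enorm (g o (xi q o)) ^+ 2))).
    by apply: integrableD_EFin => //; exact: integrableD_EFin.
  by apply/funext => o; exact: sqE.
under eq_Rintegral do rewrite sqE.
rewrite RintegralD//; last exact: integrableD_EFin.
rewrite RintegralD// RintegralZl//; last by apply: integrable_sum_EFin => i _; exact: icross.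
rewrite RintegralZl// Rintegral_sum; last by move=> i _; exact: icross.
rewrite big1// mulr0 add0r lerD2l.
by rewrite ler_wpM2l ?sqr_ge0.
Qed.

Lemma adapted_fresh J q e g V c : adapted J e -> noise J g V ->
  adapted (J `|` [set q]) (fun o => e o + c *: g o (xi q o)).
Proof.
move=> me [mg _ _ _ _] i; under eq_fun do rewrite !mxE.
have JJ' : J `<=` J `|` [set q] by exact: subsetUl.
apply: measurable_funD; first exact: adaptedS JJ' me i.
apply: measurable_funM => //.
have mphi : measurable_fun (setT : set (OJ (J `|` [set q]))) (fun o => (o, xi q o) : OJ J * Xi).
  apply/measurable_fun_pairP; split => /=; first exact: measurable_id_pastS JJ'.
  by apply: measurable_xi_past; right.
exact: (measurableT_comp (mg i) mphi).
Qed.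

(** The samples are added one at a time, each joining the past before the next, so the variances add
    up. With [c = 1 / b] and [b] samples the total is the factor [1 / b]. *)
Lemma fresh_batch_sqr (r : seq I) J e g V c : J `<=` K -> uniq r ->
  (forall q, q \in r -> K q /\ ~ J q) ->
  adapted J e -> P.-integrable setT (EFin \o (fun o => enorm (e o) ^+ 2)) ->
  noise J g V ->
  P.-integrable setT (EFin \o (fun o => enorm (e o + \sum_(q <- r) c *: g o (xi q o)) ^+ 2)) /\
  \int[P]_o (enorm (e o + \sum_(q <- r) c *: g o (xi q o)) ^+ 2) <=
  \int[P]_o (enorm (e o) ^+ 2) + (size r)%:R * (c ^+ 2 * \int[P]_o V o).
Proof.
elim: r J e => [|q r IH] J e JK.
  move=> _ _ me ie _; split.
    by under [_ \o _]eq_fun do rewrite big_nil addr0.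
  by under eq_Rintegral do rewrite big_nil addr0; rewrite mul0r addr0.
move=> /= /andP[qr ur] hr me ie ng.
have [Kq Jq] := hr q (mem_head _ _).
have [ie' le'] := fresh_sample_sqr c JK Kq Jq me ie ng.
have JJ' : J `<=` J `|` [set q] by exact: subsetUl.
have JqK : J `|` [set q] `<=` K by move=> p [/JK//|->].
have hr' p : p \in r -> K p /\ ~ (J `|` [set q]) p.
  move=> pr; have pqr : p \in q :: r by rewrite inE pr orbT.
  have [Kp Jp] := hr p pqr; split => // Jqp; case: Jqp => [/Jp//|pq].
  by move: qr; rewrite -pq pr.
have [i2 le2] := IH _ _ JqK ur hr' (@adapted_fresh _ q _ _ _ c me ng) ie' (noiseS JJ' ng).
have E o : e o + \sum_(p <- q :: r) c *: g o (xi p o) =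
    e o + c *: g o (xi q o) + \sum_(p <- r) c *: g o (xi p o).
  by rewrite big_cons addrA.
split.
  by under [_ \o _]eq_fun do rewrite E.
under eq_Rintegral do rewrite E.
apply: le_trans le2 _; rewrite -nat1r mulrDl mul1r addrA.
by rewrite lerD2r.
Qed.

End minibatch.

Section variance_bounds.
Context {R : realType} {d : measure_display} {T : measurableType d}.
Variable P : probability T R.
Implicit Type X : T -> R.

Lemma ge0_integrable_le X c : measurable_fun setT X -> (forall o, 0 <= X o) ->
  (\int[P]_o (X o)%:E <= c%:E)%E ->
  P.-integrable setT (EFin \o X) /\ \int[P]_o X o <= c.
Proof.
move=> mX X0 le; have iX : P.-integrable setT (EFin \o X).
  apply/integrableP; split; first exact/measurable_EFinP.
  under eq_integral do rewrite gee0_abs ?lee_fin//.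
  by apply: le_lt_trans le _; rewrite ltry.
split => //; rewrite -lee_fin /Rintegral fineK//.
exact: integrable_fin_num.
Qed.

Lemma integral_EFin X : P.-integrable setT (EFin \o X) ->
  (\int[P]_o (X o)%:E = (\int[P]_o X o)%:E)%E.
Proof. by move=> iX; rewrite /Rintegral fineK//; exact: integrable_fin_num. Qed.

End variance_bounds.

(** * The recursive momentum estimator *)

Section storm.
Context {R : realType} {d d' : measure_display} {Omega : measurableType d}
  {Xi : measurableType d'} {N n b : nat}.
Variables (P : probability Omega R) (D : probability Xi R) (T : nat).
Hypothesis b_gt0 : (0 < b)%N.
Variable xi : nat * 'I_b -> {RV P >-> Xi}.
Hypothesis xi_iid : iid D [set p | (1 <= p.1 <= T.+1)%N] xi.
Variables (h : Xi -> 'rV[R]_N -> 'rV[R]_n) (hbar : 'rV[R]_N -> 'rV[R]_n).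
Variables (L delta : R).
Hypothesis L_ge0 : 0 <= L.
Hypothesis h_meas : forall z i, measurable_fun setT (fun s => h s z 0 i).
Hypothesis h_lip : forall s z z', enorm (h s z - h s z') <= L * enorm (z - z').
Hypothesis h_int : forall z i, D.-integrable setT (EFin \o (fun s => h s z 0 i)).
Hypothesis h_mean : forall z i, \int[D]_s h s z 0 i = hbar z 0 i.
Hypothesis h_var : forall z,
  (\int[D]_s (enorm (h s z - hbar z) ^+ 2)%:E <= (delta ^+ 2)%:E)%E.

Definition history (t : nat) : set (nat * 'I_b) := [set p | (1 <= p.1 <= t)%N].

Lemma historyS t : history t `<=` history t.+1.
Proof. by move=> p /andP[p1 p2]; rewrite /history/= p1 leqW. Qed.

Lemma integrable_dotp (c : 'rV[R]_n) (X : Xi -> 'rV[R]_n) :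
  (forall i, D.-integrable setT (EFin \o (fun s => X s 0 i))) ->
  D.-integrable setT (EFin \o (fun s => dotp c (X s))).
Proof.
by move=> iX; apply: integrable_sum_EFin => i _; exact: integrableZ_EFin.
Qed.

Lemma Rintegral_dotp (c : 'rV[R]_n) (X : Xi -> 'rV[R]_n) :
  (forall i, D.-integrable setT (EFin \o (fun s => X s 0 i))) ->
  \int[D]_s dotp c (X s) = \sum_i c 0 i * \int[D]_s X s 0 i.
Proof.
move=> iX; rewrite Rintegral_sum => [|i _]; last exact: integrableZ_EFin.
by apply: eq_bigr => i _; rewrite RintegralZl.
Qed.

Let diff_int z z' i : D.-integrable setT (EFin \o (fun s => (h s z - h s z') 0 i)).
Proof.
rewrite (_ : (fun s => _) = (fun s => h s z 0 i - h s z' 0 i)).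
  exact: integrableB_EFin.
by apply/funext => s; rewrite !mxE.
Qed.

Let diff_mean z z' i : \int[D]_s ((h s z - h s z') 0 i) = (hbar z - hbar z') 0 i.
Proof.
under eq_Rintegral do rewrite !mxE.
by rewrite RintegralB// !h_mean !mxE.
Qed.

Let diff_dotp z z' c : \int[D]_s dotp c (h s z - h s z') = dotp c (hbar z - hbar z').
Proof.
by rewrite Rintegral_dotp//; apply: eq_bigr => i _; rewrite diff_mean.
Qed.

(** Jensen's inequality through a scalar test: [|c|^2] is the mean of [<c, h s z - h s z'>], at most
    [|c| * L * |z - z'|]. *)
Lemma mean_lip z z' : enorm (hbar z - hbar z') <= L * enorm (z - z').
Proof.
set c := hbar z - hbar z'.
have : enorm c ^+ 2 <= enorm c * (L * enorm (z - z')).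
  rewrite sqr_enorm -diff_dotp -[leRHS](Rintegral_cst1 D).
  apply: le_Rintegral => //.
  - exact: integrable_dotp.
  - exact: integrable_cst_EFin.
  - move=> s _; apply: le_trans (dotp_le _ _) _.
    by rewrite ler_wpM2l ?enorm_ge0.
have c0 := enorm_ge0 c; rewrite expr2.
move: c0; rewrite le_eqVlt => /orP[/eqP <- _|c0]; last by rewrite ler_pM2l.
by rewrite mulr_ge0 ?enorm_ge0.
Qed.

(** A variance is at most the second moment. [W] is the expanded square with the sampled difference
    replaced by its Lipschitz bound; its mean is [(L |z - z'|)^2 - |c|^2]. *)
Lemma diff_var z z' :
  D.-integrable setT (EFin \o (fun s => enorm ((hbar z - hbar z') - (h s z - h s z')) ^+ 2)) /\
  \int[D]_s (enorm ((hbar z - hbar z') - (h s z - h s z')) ^+ 2) <= (L * enorm (z - z')) ^+ 2.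
Proof.
set c := hbar z - hbar z'.
pose W s := (L * enorm (z - z')) ^+ 2 + enorm c ^+ 2 - 2 * dotp c (h s z - h s z').
have iW : D.-integrable setT (EFin \o W).
  apply: integrableB_EFin; first exact: integrable_cst_EFin.
  by apply: integrableZ_EFin; exact: integrable_dotp.
have le s : enorm (c - (h s z - h s z')) ^+ 2 <= W s.
  rewrite enorm_sqrB /W.
  have := h_lip s z z'; rewrite -(@ler_pXn2r _ 2)// ?nnegrE ?mulr_ge0 ?enorm_ge0//.
  lra.
have mX : measurable_fun setT (fun s => enorm (c - (h s z - h s z')) ^+ 2).
  apply: measurable_funX; apply: measurable_enorm => i.
  under eq_fun do rewrite !mxE.
  by apply: measurable_funB => //; exact: measurable_funB.
have iX : D.-integrable setT (EFin \o (fun s => enorm (c - (h s z - h s z')) ^+ 2)).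
  apply: le_integrable_EFin iW => // s.
  by rewrite ger0_norm ?sqr_ge0.
split => //.
apply: le_trans (le_Rintegral _ iX iW _) _ => //.
rewrite /W RintegralB//; last first.
- by apply: integrableZ_EFin; exact: integrable_dotp.
- exact: integrable_cst_EFin.
rewrite RintegralZl//; last exact: integrable_dotp.
rewrite Rintegral_cst1 diff_dotp -/c -sqr_enorm.
have := sqr_ge0 (enorm c); lra.
Qed.

Let err_int z : D.-integrable setT (EFin \o (fun s => enorm (hbar z - h s z) ^+ 2)) /\
  \int[D]_s (enorm (hbar z - h s z) ^+ 2) <= delta ^+ 2.
Proof.
apply: ge0_integrable_le.
- apply: measurable_funX; apply: measurable_enorm => i.
  by under eq_fun do rewrite !mxE; exact: measurable_funB.
- by move=> s; rewrite sqr_ge0.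
- by under eq_integral do rewrite enormB; exact: h_var.
Qed.

Local Notation OJ J := (g_sigma_algebraType (past xi J)).

Lemma adapted_mean J (Z : Omega -> 'rV[R]_N) : adapted xi J Z -> adapted xi J (hbar \o Z).
Proof. exact: adapted_lipschitz mean_lip. Qed.

Lemma measurable_sample dS (S : measurableType dS) (q : S -> Xi) (Z : S -> 'rV[R]_N) i :
  measurable_fun setT q -> (forall j, measurable_fun setT (fun o => Z o 0 j)) ->
  measurable_fun setT (fun o => h (q o) (Z o) 0 i).
Proof.
move=> mq mZ.
apply: (@measurable_caratheodory _ _ S _ Xi N (fun s z => h s z 0 i) L) => //.
move=> s z z'; apply: le_trans (h_lip s z z').
by have := abs_coord_le (h s z - h s z') i; rewrite !mxE.
Qed.

(** The noise is [a] times the sampling error at the new point plus [1 - a] times the centred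
    increment between the two points. The first costs [delta^2], the second only the squared
    displacement. *)
Lemma storm_noise J (a : R) (Z Z' : Omega -> 'rV[R]_N) : adapted xi J Z -> adapted xi J Z' ->
  P.-integrable setT (EFin \o (fun o => enorm (Z' o - Z o) ^+ 2)) ->
  noise D xi J (fun o s => (hbar (Z' o) - h s (Z' o)) - (1 - a) *: (hbar (Z o) - h s (Z o)))
    (fun o => 2 * a ^+ 2 * delta ^+ 2 + 2 * (1 - a) ^+ 2 * L ^+ 2 * enorm (Z' o - Z o) ^+ 2).
Proof.
move=> mZ mZ' iZ.
have fstE (X : Omega -> 'rV[R]_N) : adapted xi J X ->
    forall j, measurable_fun (setT : set (OJ J * Xi)) (fun z => X z.1 0 j).
  by move=> mX j; exact: (measurableT_comp (mX j) measurable_fst).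
have mpart (X : Omega -> 'rV[R]_N) i : adapted xi J X -> measurable_fun (setT : set (OJ J * Xi))
    (fun z => hbar (X z.1) 0 i - h z.2 (X z.1) 0 i).
  move=> mX; apply: measurable_funB.
    exact: (measurableT_comp (adapted_mean mX i) measurable_fst).
  by apply: measurable_sample; [exact: measurable_snd|exact: fstE].
have ipart z i : D.-integrable setT (EFin \o (fun s => hbar z 0 i - h s z 0 i)).
  by apply: integrableB_EFin => //; exact: integrable_cst_EFin.
have part0 z i : \int[D]_s (hbar z 0 i - h s z 0 i) = 0.
  rewrite RintegralB//; last exact: integrable_cst_EFin.
  by rewrite Rintegral_cst1 h_mean subrr.
split.
- move=> i; under eq_fun do rewrite !mxE.
  by apply: measurable_funB; [exact: mpart|apply: measurable_funM => //; exact: mpart].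
- move=> o i; rewrite (_ : (fun s => _) = (fun s => (hbar (Z' o) 0 i - h s (Z' o) 0 i)
    - (1 - a) * (hbar (Z o) 0 i - h s (Z o) 0 i))).
    by apply: integrableB_EFin => //; exact: integrableZ_EFin.
  by apply/funext => s; rewrite !mxE.
- move=> o i; under eq_Rintegral do rewrite !mxE.
  rewrite RintegralB//; last exact: integrableZ_EFin.
  by rewrite RintegralZl// !part0 mulr0 subrr.
- move=> o; set z := Z o; set z' := Z' o.
  have [i1 le1] := err_int z'; have [i2 le2] := diff_var z' z.
  pose W s := 2 * a ^+ 2 * enorm (hbar z' - h s z') ^+ 2 +
    2 * (1 - a) ^+ 2 * enorm ((hbar z' - hbar z) - (h s z' - h s z)) ^+ 2.
  have j1 := integrableZ_EFin (2 * a ^+ 2) i1.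
  have j2 := integrableZ_EFin (2 * (1 - a) ^+ 2) i2.
  have iW : D.-integrable setT (EFin \o W) by exact: integrableD_EFin.
  have IW : \int[D]_s W s <= 2 * a ^+ 2 * delta ^+ 2 + 2 * (1 - a) ^+ 2 * L ^+ 2 * enorm (z' - z) ^+ 2.
    rewrite RintegralD// !RintegralZl//; apply: lerD.
      by rewrite ler_wpM2l// mulr_ge0// sqr_ge0.
    by rewrite -mulrA -exprMn ler_wpM2l// mulr_ge0// sqr_ge0.
  rewrite -lee_fin in IW; apply: le_trans IW.
  rewrite -integral_EFin//; apply: ge0_le_integral => //.
  + by move=> s _; rewrite lee_fin sqr_ge0.
  + apply/measurable_EFinP/measurable_funX/measurable_enorm => i.
    under eq_fun do rewrite !mxE.
    apply: measurable_funB; first exact: measurable_funB.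
    by apply: measurable_funM => //; exact: measurable_funB.
  + exact: measurable_int iW.
  + move=> s _; rewrite lee_fin /W.
    have -> : hbar z' - h s z' - (1 - a) *: (hbar z - h s z) =
        a *: (hbar z' - h s z') + (1 - a) *: ((hbar z' - hbar z) - (h s z' - h s z)).
      by apply/rowP => i; rewrite !mxE; ring.
    apply: le_trans (enorm_sqrD_le _ _) _.
    by rewrite !enormZ !exprMn !real_normK ?num_real// !mulrA.
- apply: integrableD_EFin; first exact: integrable_cst_EFin.
  exact: integrableZ_EFin.
Qed.

Definition batch_mean (t : nat) (z : 'rV[R]_N) (o : Omega) : 'rV[R]_n :=
  minibatch_mean (h ^~ z) (fun i => xi (t, i) o).

Let batch (t : nat) : seq (nat * 'I_b) := [seq (t, i) | i <- index_enum 'I_b].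

Let batch_uniq t : uniq (batch t).
Proof. by rewrite map_inj_uniq ?index_enum_uniq// => i j []. Qed.

Let batch_fresh t q : q \in batch t.+1 -> (t <= T)%N ->
  (1 <= q.1 <= T.+1)%N /\ ~ history t q.
Proof.
by move=> /mapP[i _ ->] tT; split => //=; rewrite /history/= ltnn.
Qed.

Let size_batch t : size (batch t) = b.
Proof. by rewrite size_map -sum1_size sum1_card card_ord. Qed.

Let historyK t : (t <= T.+1)%N -> history t `<=` [set p | (1 <= p.1 <= T.+1)%N].
Proof. by move=> tT p /andP[p1 p2] /=; rewrite p1 (leq_trans p2). Qed.

Lemma adapted_batch_mean t (Z : Omega -> 'rV[R]_N) : adapted xi (history t.+1) Z ->
  adapted xi (history t.+1) (fun o => batch_mean t.+1 (Z o) o).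
Proof.
move=> mZ i; rewrite /batch_mean /minibatch_mean.
under eq_fun do rewrite !mxE summxE.
apply: measurable_funM => //; apply: measurable_sum => j.
by apply: measurable_sample => //; apply: measurable_xi_past; rewrite /history/= leqnn.
Qed.

(** The new error is [1 - a] times the old one, known from the past, plus the average over the batch
    of centred noises. The point [Z'] is adapted to [history t], as it is computed before batch
    [t.+1] is drawn; this is what makes the batch fresh. *)
Lemma storm_step t (a : R) (Z Z' : Omega -> 'rV[R]_N) (v v' : Omega -> 'rV[R]_n) :
  (t <= T)%N ->
  adapted xi (history t) Z -> adapted xi (history t) Z' -> adapted xi (history t) v ->
  P.-integrable setT (EFin \o (fun o => enorm (Z' o - Z o) ^+ 2)) ->
  P.-integrable setT (EFin \o (fun o => enorm (hbar (Z o) - v o) ^+ 2)) ->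
  (forall o, v' o = batch_mean t.+1 (Z' o) o + (1 - a) *: (v o - batch_mean t.+1 (Z o) o)) ->
  [/\ adapted xi (history t.+1) v',
    P.-integrable setT (EFin \o (fun o => enorm (hbar (Z' o) - v' o) ^+ 2)) &
    \int[P]_o (enorm (hbar (Z' o) - v' o) ^+ 2) <=
    (1 - a) ^+ 2 * \int[P]_o (enorm (hbar (Z o) - v o) ^+ 2) +
    b%:R^-1 * (2 * a ^+ 2 * delta ^+ 2 + 2 * (1 - a) ^+ 2 * L ^+ 2 *
      \int[P]_o (enorm (Z' o - Z o) ^+ 2))].
Proof.
move=> tT mZ mZ' mv iZ ie vE.
have ng := storm_noise a mZ mZ' iZ.
pose e o := (1 - a) *: (hbar (Z o) - v o).
have me : adapted xi (history t) e.
  move=> i; rewrite /e; under eq_fun do rewrite !mxE.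
  apply: measurable_funM => //.
  by apply: measurable_funB; [exact: adapted_mean mZ i|exact: mv].
have eE o : enorm (e o) ^+ 2 = (1 - a) ^+ 2 * enorm (hbar (Z o) - v o) ^+ 2.
  by rewrite /e enormZ exprMn real_normK ?num_real.
have iE : P.-integrable setT (EFin \o (fun o => enorm (e o) ^+ 2)).
  by under [_ \o _]eq_fun do rewrite eE; exact: integrableZ_EFin.
have [i1 le1] := fresh_batch_sqr xi_iid b%:R^-1 (historyK (leqW tT)) (batch_uniq t.+1)
   (fun q hq => batch_fresh hq tT) me iE ng.
have E o : hbar (Z' o) - v' o = e o + \sum_(q <- batch t.+1) b%:R^-1 *:
    ((hbar (Z' o) - h (xi q o) (Z' o)) - (1 - a) *: (hbar (Z o) - h (xi q o) (Z o))).
  rewrite /batch big_map vE /batch_mean /minibatch_mean /e.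
  rewrite -scaler_sumr sumrB -scaler_sumr !sumrB !sumr_const card_ord.
  apply/rowP => i; rewrite !mxE !mulmxnE; field.
  by rewrite pnatr_eq0 -lt0n.
split.
- move=> i; rewrite (_ : (fun o => _) = fun o => batch_mean t.+1 (Z' o) o 0 i +
     (1 - a) * (v o 0 i - batch_mean t.+1 (Z o) o 0 i)); last first.
    by apply/funext => o; rewrite vE !mxE.
  have hS := @historyS t.
  apply: measurable_funD; first by apply: adapted_batch_mean; exact: adaptedS hS mZ'.
  apply: measurable_funM => //; apply: measurable_funB; first exact: adaptedS hS mv i.
  by apply: adapted_batch_mean; exact: adaptedS hS mZ.
- by under [_ \o _]eq_fun do rewrite E.
under eq_Rintegral do rewrite E.
apply: le_trans le1 _; apply: lerD.
  by under eq_Rintegral do rewrite eE; rewrite RintegralZl.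
rewrite size_batch.
rewrite RintegralD//; [|exact: integrable_cst_EFin|exact: integrableZ_EFin].
rewrite Rintegral_cst1 RintegralZl// mulrA expr2 mulrA divff ?mul1r//.
by rewrite pnatr_eq0 -lt0n.
Qed.

(** The same argument from an empty past with zero previous error. *)
Lemma storm_init (z : 'rV[R]_N) (v : Omega -> 'rV[R]_n) :
  (forall o, v o = batch_mean 1 z o) ->
  [/\ adapted xi (history 1) v,
    P.-integrable setT (EFin \o (fun o => enorm (hbar z - v o) ^+ 2)) &
    \int[P]_o (enorm (hbar z - v o) ^+ 2) <= b%:R^-1 * delta ^+ 2].
Proof.
move=> vE.
have ng : noise D xi (history 0) (fun (_ : Omega) s => hbar z - h s z) (fun=> delta ^+ 2).
  split.
  - move=> i; under eq_fun do rewrite !mxE.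
    apply: measurable_funB => //.
    by apply: (measurable_sample (Z := fun=> z)); [exact: measurable_snd|].
  - move=> o i; rewrite (_ : (fun s => _) = (fun s => hbar z 0 i - h s z 0 i)).
      by apply: integrableB_EFin => //; exact: integrable_cst_EFin.
    by apply/funext => s; rewrite !mxE.
  - move=> o i; under eq_Rintegral do rewrite !mxE.
    rewrite RintegralB//; last exact: integrable_cst_EFin.
    by rewrite Rintegral_cst1 h_mean subrr.
  - by move=> o; under eq_integral do rewrite enormB; exact: h_var.
  - exact: integrable_cst_EFin.
have m0 : adapted xi (history 0) (fun _ : Omega => 0 : 'rV[R]_n) by move=> i.
have i0 : P.-integrable setT (EFin \o (fun _ : Omega => enorm (0 : 'rV[R]_n) ^+ 2)).
  exact: integrable_cst_EFin.
have [i1 le1] := fresh_batch_sqr xi_iid b%:R^-1 (historyK (leq0n T.+1)) (batch_uniq 1)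
   (fun q hq => batch_fresh hq (leq0n T)) m0 i0 ng.
have E o : hbar z - v o = 0 + \sum_(q <- batch 1) b%:R^-1 *: (hbar z - h (xi q o) z).
  rewrite add0r /batch big_map vE /batch_mean /minibatch_mean -scaler_sumr sumrB.
  rewrite sumr_const card_ord; apply/rowP => i; rewrite !mxE !mulmxnE; field.
  by rewrite pnatr_eq0 -lt0n.
split.
- move=> i; under eq_fun do rewrite vE.
  exact: (@adapted_batch_mean 0%N (fun=> z)).
- by under [_ \o _]eq_fun do rewrite E.
under eq_Rintegral do rewrite E.
apply: le_trans le1 _; rewrite !Rintegral_cst1 enorm0 expr0n add0r size_batch.
rewrite mulrA expr2 mulrA divff ?mul1r//.
by rewrite pnatr_eq0 -lt0n.
Qed.

End storm.

(** * Tangential part of the dual gradient *)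

Section tangent_projection.
Context {R : realType} {n : nat}.
Implicit Types (Q : 'M[R]_n) (u v w r : 'rV[R]_n) (Y : set 'rV[R]_n).

Lemma dotp_mulmx u w (A : 'M[R]_n) : dotp (u *m A) w = dotp u (w *m A^T).
Proof.
have E (a c : 'rV[R]_n) : dotp a c = (a *m c^T) 0 0.
  by rewrite mxE; apply: eq_bigr => i _; rewrite mxE.
by rewrite !E trmx_mul trmxK mulmxA.
Qed.

Definition linear_set (A : set 'rV[R]_n) := A 0 /\ forall a u v, A u -> A v -> A (a *: u + v).

(** A symmetric idempotent whose range lies in the span of the differences of points of [Y], the
    span being expressed as the intersection of all linear sets that contain them. *)
Definition tangent_projector Y Q := [/\ Q^T = Q, Q *m Q = Q &
  forall A, linear_set A -> (forall y z, Y y -> Y z -> A (z - y)) -> forall w, A (w *m Q)].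

Lemma tangent_projector_dotp Y Q u w : tangent_projector Y Q -> dotp (u *m Q) w = dotp u (w *m Q).
Proof. by case=> QT _ _; rewrite dotp_mulmx QT. Qed.

Lemma tangent_projector_le Y Q u : tangent_projector Y Q -> enorm (u *m Q) <= enorm u.
Proof.
move=> tQ; have [_ QQ _] := tQ.
have : enorm (u *m Q) ^+ 2 <= enorm u * enorm (u *m Q).
  by rewrite sqr_enorm (tangent_projector_dotp _ _ tQ) -mulmxA QQ dotp_le.
rewrite expr2; have := enorm_ge0 (u *m Q); rewrite le_eqVlt => /orP[/eqP <-|h].
  by rewrite enorm_ge0.
by rewrite ler_pM2r.
Qed.

(** A diagonal entry equals the sum of squares of its row, hence dominates its own square and is at
    most 1. *)
Lemma tangent_projector_trace Y Q : tangent_projector Y Q -> \tr Q <= n%:R.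
Proof.
case=> QT QQ _.
have -> : n%:R = \sum_(i < n) (1 : R) by rewrite sumr_const card_ord.
apply: ler_sum => i _.
have h : Q i i = \sum_j Q i j ^+ 2.
  rewrite -{1}QQ mxE; apply: eq_bigr => j _.
  by rewrite expr2 -{2}QT mxE.
have : Q i i ^+ 2 <= Q i i.
  by rewrite {2}h (bigD1 i)//= lerDl; apply: sumr_ge0 => j _; exact: sqr_ge0.
by rewrite expr2; nra.
Qed.

(** The vector [r] is the part of [z - y] orthogonal to the range of [Q]; adding the rank-one
    projector [r^T r / |r|^2] keeps the range tangent and raises the trace by 1. *)
Lemma tangent_projector_extend Y Q y z : tangent_projector Y Q -> Y y -> Y z ->
  (z - y) *m Q != z - y ->
  exists Q', tangent_projector Y Q' /\ \tr Q' = \tr Q + 1.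
Proof.
move=> [QT QQ Qs] Yy Yz ne.
have [r rE] : exists r, r = (z - y) - (z - y) *m Q by eexists.
have r0 : r != 0 by rewrite rE subr_eq0 eq_sym.
have rQ : r *m Q = 0 by rewrite rE mulmxBl -mulmxA QQ subrr.
have Qr : Q *m r^T = 0 by rewrite -[Q]QT -trmx_mul rQ trmx0.
pose c := (dotp r r)^-1.
have rr0 : dotp r r != 0.
  by apply: contraNneq r0 => h; apply/eqP/enorm_eq0/eqP; rewrite -sqrf_eq0 sqr_enorm h.
have rrE : r *m r^T = (dotp r r)%:M.
  apply/matrixP => i j; rewrite !ord1 [LHS]mxE [RHS]mxE eqxx mulr1n.
  by apply: eq_bigr => k _; rewrite [r^T _ _]mxE.
exists (Q + c *: (r^T *m r)); split; first split.
- by rewrite linearD linearZ/= QT trmx_mul trmxK.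
- have QS : Q *m (r^T *m r) = 0 by rewrite mulmxA Qr mul0mx.
  have SQ : (r^T *m r) *m Q = 0 by rewrite -mulmxA rQ mulmx0.
  have SS : (r^T *m r) *m (r^T *m r) = dotp r r *: (r^T *m r).
    by rewrite mulmxA -(mulmxA r^T r) rrE mul_mx_scalar scalemxAl.
  rewrite mulmxDl !mulmxDr QQ -scalemxAl -!scalemxAr QS SQ -scalemxAl SS.
  by rewrite !scaler0 addr0 add0r !scalerA -mulrA mulVf// mulr1.
- move=> A lA AY w; have [A0 AD] := lA.
  have Ar : A r.
    rewrite rE addrC -scaleN1r; apply: AD; first exact: Qs.
    exact: AY.
  rewrite mulmxDr -scalemxAr mulmxA.
  have -> : w *m r^T *m r = (w *m r^T) 0 0 *: r.
    by rewrite {1}[w *m r^T]mx11_scalar mul_scalar_mx.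
  by rewrite scalerA addrC; apply: AD => //; exact: Qs.
rewrite mxtraceD mxtraceZ mxtrace_mulC rrE mxtrace_scalar.
by rewrite mulr1n mulVf.
Qed.

(* Each failure to fix some difference of points of Y allows a rank-one
   extension, and the trace of a projector is at most n. *)
Lemma tangent_projector_exists Y : exists Q, tangent_projector Y Q /\
  forall y z, Y y -> Y z -> (z - y) *m Q = z - y.
Proof.
apply: contrapT => nex.
have H (k : nat) : exists Q, tangent_projector Y Q /\ \tr Q = k%:R.
  elim: k => [|k [Q [tQ trQ]]].
    exists 0; split; last by rewrite mxtrace0.
    split; [by rewrite trmx0|by rewrite mulmx0|].
    by move=> A [A0 _] _ w; rewrite mulmx0.
  have : ~ forall y z, Y y -> Y z -> (z - y) *m Q = z - y.
    by move=> h; apply: nex; exists Q.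
  move=> /existsNP[y /existsNP[z /not_implyP[Yy /not_implyP[Yz /eqP ne]]]].
  have [Q' [tQ' trQ']] := tangent_projector_extend tQ Yy Yz ne.
  by exists Q'; split => //; rewrite trQ' trQ natr1.
have [Q [tQ trQ]] := H n.+1.
have := tangent_projector_trace tQ.
by rewrite trQ ler_nat ltnn.
Qed.

End tangent_projection.

(** * Scalar inequalities behind the dual and primal steps *)

Section dual_step_scalar.
Context {R : realFieldType}.
Variables (eta lambda tau L : R).
Hypotheses (eta0 : 0 < eta) (eta1 : eta <= 1) (lam0 : 0 < lambda).
Hypotheses (tau0 : 0 < tau) (tL : tau <= L) (lamL : lambda * (6 * L) <= 1).

Let lt1 : lambda * tau <= 1 / 6.
Proof.
have : lambda * tau <= lambda * L by rewrite ler_wpM2l// ltW.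
by move: lamL; lra.
Qed.

(** Here [A], [B] are the squared lengths of [y* - y] and [y~ - y], [p] is their inner product, and
    [G] is the squared error of [w] over [tau]. Strong concavity at [y*], smoothness at [y~] and
    optimality of [y*] bound the inner product of the gradient with [y* - y~] from below. The
    projection inequality bounds it from above with [w] in place of the gradient, and Young with
    weight [tau / 4] absorbs the error. *)
Lemma projection_gain (A B G p fz fy ft dz dt wzt ez et : R) :
  fz <= fy + dz - tau / 2 * A -> fy + dt - L / 2 * B <= ft -> ft <= fz ->
  dz - dt = wzt + (ez + et) -> lambda * wzt <= p - B ->
  ez <= tau / 4 * A + G -> et <= tau / 4 * B + G ->
  B - lambda * (2 * G - tau / 4 * A + tau / 4 * B + L / 2 * B) <= p.
Proof.
move=> k1 k2 k3 k5 k4 y1 y2.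
have k7 : 0 <= wzt + (2 * G - tau / 4 * A + tau / 4 * B + L / 2 * B) by lra.
have := ler_wpM2l (ltW lam0) k7; rewrite mulr0 mulrDr => k8.
by clear -k8 k4; lra.
Qed.

(** Since [tau <= L] and [lambda L <= 1/6], [lambda (tau / 4 + L / 2) <= 1/8], so the coefficient of
    [eta B] is at most [-2 + 1/4 + 1 = -3/4]. *)
Lemma projected_step_contraction (A B G p A1 : R) : 0 <= B ->
  B - lambda * (2 * G - tau / 4 * A + tau / 4 * B + L / 2 * B) <= p ->
  A1 = A - 2 * eta * p + eta ^+ 2 * B ->
  A1 <= (1 - eta * lambda * tau / 2) * A - 3 * eta / 4 * B + 4 * eta * lambda * G.
Proof.
move=> B0 key ->.
have k8 : lambda * (tau / 4 + L / 2) <= 1 / 8.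
  have : lambda * tau <= lambda * L by rewrite ler_wpM2l// ltW.
  by move: lamL; lra.
have k9 := ler_wpM2l (ltW eta0) (ler_wpM2r B0 k8).
have k10 : eta * (eta * B) <= eta * B.
  by rewrite ler_wpM2l ?(ltW eta0)// ler_piMl.
have k11 := ler_wpM2l (ltW eta0) key.
by rewrite expr2; clear -k9 k10 k11; lra.
Qed.

(** Half of the contraction is traded for the motion [Z] of [y*]: with [a = eta lambda tau / 4],
    [(1 + a) (1 - 2 a) <= 1 - a]. Since [a <= 1/24], [1 + a <= 25/24] and [1 + 1/a <= 25 / (24 a)],
    which is the origin of the constants 25. *)
Lemma dual_step_drift (A B G A1 A2 C Z : R) : 0 <= A -> 0 <= B -> 0 <= G -> 0 <= C ->
  0 <= Z -> Z <= (L / tau) ^+ 2 * C ->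
  A1 <= (1 - eta * lambda * tau / 2) * A - 3 * eta / 4 * B + 4 * eta * lambda * G ->
  (forall a, 0 < a -> A2 <= (1 + a) * A1 + (1 + a^-1) * Z) ->
  A2 <= (1 - eta * tau * lambda / 4) * A - 3 * eta / 4 * B
    + 25 / 6 * (eta * lambda * G) + 25 * (L / tau) ^+ 2 / (6 * eta * tau * lambda) * C.
Proof.
move=> A0 B0 G0 C0 Z0 Zle A1le /(_ (eta * lambda * tau / 4)).
set a := eta * lambda * tau / 4.
have a0 : 0 < a by rewrite divr_gt0// !mulr_gt0.
have a1 : a <= 1 / 24.
  have : eta * (lambda * tau) <= 1 * (1 / 6).
    by rewrite ler_pM ?(ltW eta0) ?mulr_ge0 ?(ltW lam0) ?(ltW tau0).
  by rewrite /a; lra.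
have aE : eta * lambda * tau / 2 = 2 * a by rewrite /a; field.
have aE' : eta * tau * lambda / 4 = a by rewrite /a; field.
rewrite aE in A1le; rewrite aE' => /(_ a0) h; apply: le_trans h _.
have ainv : 1 + a^-1 <= 25 / (6 * eta * tau * lambda).
  have -> : 25 / (6 * eta * tau * lambda) = 25 / 24 * a^-1.
    by rewrite /a; field; rewrite !gt_eqF.
  have : 1 <= 1 / 24 * a^-1 by rewrite ler_pdivlMr//; lra.
  by lra.
have m1 : (1 + a^-1) * Z <= 25 * (L / tau) ^+ 2 / (6 * eta * tau * lambda) * C.
  have -> : 25 * (L / tau) ^+ 2 / (6 * eta * tau * lambda) * C =
      25 / (6 * eta * tau * lambda) * ((L / tau) ^+ 2 * C).
    by field; rewrite !gt_eqF.
  by apply: ler_pM => //; rewrite addr_ge0// invr_ge0 ltW.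
have a1' : 0 <= 1 + a by lra.
have m2 := ler_wpM2l a1' A1le.
have m3 : 0 <= a * (a * A) by rewrite !mulr_ge0// ltW.
have m4 : 0 <= a * (eta * B) by rewrite !mulr_ge0// ltW.
have m5 : a * (eta * lambda * G) <= 1 / 24 * (eta * lambda * G).
  by rewrite ler_wpM2r// !mulr_ge0// ltW.
by clear -m1 m2 m3 m4 m5; lra.
Qed.

End dual_step_scalar.

(** Polarization: [- g dp] equals [g / 2] times [nd - nF - nv], where [nd] is the squared distance
    from [v] to the gradient of [F]. Half of the gain in [nv] pays for the curvature term because
    [2 g M <= 1]. *)
Lemma primal_step_scalar {R : realFieldType} (g M F0 F1 nF nv nd dp D1 D2 K : R) :
  0 <= g -> g * (2 * M) <= 1 -> 0 <= nv ->
  F1 <= F0 - g * dp + M / 2 * (g ^+ 2 * nv) ->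
  nd = nF - 2 * dp + nv -> nd <= 2 * D1 + 2 * D2 -> D1 <= K ->
  F1 <= F0 - g / 2 * nF - g / 4 * nv + g * (K + D2).
Proof.
move=> g0 gM nv0 hF ndE ndle hD.
have h4 := ler_wpM2l g0 (ler_wpM2r nv0 gM).
have h5 := ler_wpM2l g0 hD; have h6 := ler_wpM2l g0 ndle.
by rewrite ndE in h6; move: hF; rewrite expr2; clear -h4 h5 h6; lra.
Qed.

(** The weighted contraction of the dual distance is [9/4 g e L^2 Dd], which absorbs the
    [g e L^2 Dd] of the primal step; the terms in [U], [X], [S] and [Z] are left to the momentum
    analysis. *)
Lemma path_step_scalar {R : realFieldType} (g e lambda tau L kappa F0 F1 G U X Z S Dd D1 : R) :
  0 < g -> 0 < e -> 0 < lambda -> 0 < tau -> 0 < L -> 0 <= Dd ->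
  F1 <= F0 - g * e / 2 * G - g * e / 4 * U + g * e * (L ^+ 2 * Dd + X) ->
  D1 <= (1 - e * tau * lambda / 4) * Dd - 3 * e / 4 * S + 25 * e * lambda / (6 * tau) * Z
    + 25 * kappa ^+ 2 / (6 * e * tau * lambda) * ((g * e) ^+ 2 * U) ->
  g * e / 2 * G <= (F0 + 9 * g * L ^+ 2 / (lambda * tau) * Dd)
    - (F1 + 9 * g * L ^+ 2 / (lambda * tau) * D1)
    + (- (g * e / 4) * U + g * e * X + 9 * g * L ^+ 2 / (lambda * tau) * (- (3 * e / 4) * S
     + 25 * e * lambda / (6 * tau) * Z + 25 * kappa ^+ 2 * e * g ^+ 2 / (6 * tau * lambda) * U)).
Proof.
move=> g0 e0 l0 t0 L0 D0 hF hD.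
pose A := 9 * g * L ^+ 2 / (lambda * tau).
have A0 : 0 <= A.
  have L2 : 0 < L ^+ 2 by rewrite exprn_gt0.
  by rewrite ltW// divr_gt0// !mulr_gt0.
have := ler_wpM2l A0 hD; rewrite -/A.
have -> : 25 * kappa ^+ 2 / (6 * e * tau * lambda) * ((g * e) ^+ 2 * U) =
    25 * kappa ^+ 2 * e * g ^+ 2 / (6 * tau * lambda) * U.
  by field; rewrite !gt_eqF.
set q := _ / (6 * tau * lambda) * U.
have AE : A * ((1 - e * tau * lambda / 4) * Dd) = A * Dd - 9 / 4 * (g * e * L ^+ 2 * Dd).
  by rewrite /A; field; rewrite !gt_eqF.
have gD : 0 <= g * e * L ^+ 2 * Dd.
  by apply: mulr_ge0 => //; rewrite ltW// mulr_gt0 ?exprn_gt0// mulr_gt0.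
move=> h; have {}h : A * D1 <= A * ((1 - e * tau * lambda / 4) * Dd) - A * (3 * e / 4 * S)
    + A * (25 * e * lambda / (6 * tau) * Z) + A * q.
  by apply: le_trans h _; rewrite !mulrDr mulrN.
rewrite AE in h; clearbody q A.
have -> : A * (- (3 * e / 4) * S + 25 * e * lambda / (6 * tau) * Z + q) =
   - (A * (3 * e / 4 * S)) + A * (25 * e * lambda / (6 * tau) * Z) + A * q by ring.
by move: h hF gD; clear; lra.
Qed.

Lemma sum_le_telescope {R : numDomainType} (a p : nat -> R) (T : nat) :
  (forall t, (1 <= t <= T)%N -> a t <= p t - p t.+1) ->
  \sum_(1 <= t < T.+1) a t <= p 1%N - p T.+1.
Proof.
move=> h.
apply: (@le_trans _ _ (\sum_(1 <= t < T.+1) - (p t.+1 - p t))).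
  by rewrite !big_nat ler_sum// => t tT; rewrite opprB h.
by rewrite sumrN telescope_sumr// opprB.
Qed.

(** * Deterministic descent estimates *)

Section minimax_analysis.
Context {R : realType} {d1 d2 : nat}.
Variables (Y : set 'rV[R]_d2) (phi : 'rV[R]_d1 -> 'rV[R]_d2 -> R).
Variables (Q : 'M[R]_d2) (L tau : R).
Hypothesis Ycl : closed Y.
Hypothesis Y0 : Y !=set0.
Hypothesis Ycvx : forall y y' (t : R),
  Y y -> Y y' -> 0 <= t <= 1 -> Y (y + t *: (y' - y)).
Hypothesis phi_diff : differentiable_on Y phi.
Hypothesis Qproj : tangent_projector Y Q.
Hypothesis Qfix : forall y y', Y y -> Y y' -> (y' - y) *m Q = y' - y.
Hypothesis L_gt0 : 0 < L.
Hypothesis tau_gt0 : 0 < tau.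

Local Notation gx := (gradx phi).
Local Notation gy := (fun x y => grady phi x y *m Q).

Hypothesis gx_lip : forall x x' y y', Y y -> Y y' ->
  enorm (gx x y - gx x' y') <= L * enorm (row_mx x y - row_mx x' y').
Hypothesis gy_lip : forall x x' y y', Y y -> Y y' ->
  enorm (gy x y - gy x' y') <= L * enorm (row_mx x y - row_mx x' y').
Hypothesis phi_sc : strongly_concave Y tau phi.

Implicit Types (x u v : 'rV[R]_d1) (y z w : 'rV[R]_d2).

Lemma gx_lipx x x' y : Y y -> enorm (gx x y - gx x' y) <= L * enorm (x - x').
Proof.
by move=> Yy; have := gx_lip x x' Yy Yy; rewrite row_mxBB subrr enorm_row_mx0r.
Qed.

Lemma gx_lipy x y z : Y y -> Y z -> enorm (gx x y - gx x z) <= L * enorm (y - z).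
Proof.
by move=> Yy Yz; have := gx_lip x x Yy Yz; rewrite row_mxBB subrr enorm_row_mx0l.
Qed.

Lemma gy_lipx x x' y : Y y -> enorm (gy x y - gy x' y) <= L * enorm (x - x').
Proof.
by move=> Yy; have := gy_lip x x' Yy Yy; rewrite row_mxBB subrr enorm_row_mx0r.
Qed.

Lemma gy_lipy x y z : Y y -> Y z -> enorm (gy x y - gy x z) <= L * enorm (y - z).
Proof.
by move=> Yy Yz; have := gy_lip x x Yy Yz; rewrite row_mxBB subrr enorm_row_mx0l.
Qed.

Lemma dotp_tangent w y z : Y y -> Y z -> dotp (w *m Q) (z - y) = dotp w (z - y).
Proof. by move=> Yy Yz; rewrite (tangent_projector_dotp _ _ Qproj) Qfix. Qed.

Lemma phi_concave x y z : Y y -> Y z ->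
  phi x z <= phi x y + dotp (gy x y) (z - y) - tau / 2 * enorm (z - y) ^+ 2.
Proof. by move=> Yy Yz; rewrite dotp_tangent//; exact: phi_sc. Qed.

Lemma phi_smooth_y x y z : Y y -> Y z ->
  phi x y + dotp (gy x y) (z - y) - L / 2 * enorm (z - y) ^+ 2 <= phi x z.
Proof.
move=> Yy Yz; rewrite dotp_tangent//.
have := @segment_descent_ge R d1 d2 Y Ycvx phi x x y z (L * enorm (z - y) ^+ 2) phi_diff Yy Yz.
rewrite subrr /gradxy dotp_row_mx dotp0r add0r (mulrAC L) => H; apply: H.
move=> t ht; rewrite scaler0 addr0 dotpBl !dotp_row_mx !dotp0r !add0r -dotpBl.
have Yt := Ycvx Yy Yz ht.
have -> : dotp (grady phi x (y + t *: (z - y)) - grady phi x y) (z - y) =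
    dotp (gy x (y + t *: (z - y)) - gy x y) (z - y).
  by rewrite -mulmxBl dotp_tangent.
have := gy_lipy x Yt Yy; rewrite addrAC subrr add0r enormZ.
case/andP: (ht) => t0 _; rewrite (ger0_norm t0) => h.
have := dotp_le (- (gy x (y + t *: (z - y)) - gy x y)) (z - y).
rewrite dotpNl enormN => h2.
have h3 := ler_wpM2r (enorm_ge0 (z - y)) h.
by rewrite expr2; lra.
Qed.

Lemma phi_smooth_x x x' y : Y y ->
  `|phi x' y - phi x y - dotp (gx x y) (x' - x)| <= L / 2 * enorm (x' - x) ^+ 2.
Proof.
move=> Yy; set u := x' - x.
have H (t : R) : 0 <= t <= 1 ->
    `|dotp (gradxy phi (x + t *: u) (y + t *: (y - y)) - gradxy phi x y) (row_mx u (y - y))|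
    <= L * enorm u ^+ 2 * t.
  move=> /andP[t0 _]; rewrite subrr scaler0 addr0 dotpBl !dotp_row_mx !dotp0r !addr0 -dotpBl.
  have := gx_lipx (x + t *: u) x Yy; rewrite addrAC subrr add0r enormZ (ger0_norm t0).
  set c := gx _ _ - _ => h.
  have := dotp_le c u; have := dotp_le (- c) u; rewrite dotpNl enormN => h2 h3.
  have h4 := ler_wpM2r (enorm_ge0 u) h.
  by rewrite ler_norml; apply/andP; split; rewrite expr2; lra.
have hle := @segment_descent_le R d1 d2 Y Ycvx phi x x' y y (L * enorm u ^+ 2) phi_diff Yy Yy.
have hge := @segment_descent_ge R d1 d2 Y Ycvx phi x x' y y (L * enorm u ^+ 2) phi_diff Yy Yy.
have {}hle := hle (fun t ht => proj2 (andP (etrans (esym (ler_norml _ _)) (H t ht)))).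
have {}hge := hge (fun t ht => proj1 (andP (etrans (esym (ler_norml _ _)) (H t ht)))).
move: hle hge; rewrite -/u subrr /gradxy dotp_row_mx dotp0r addr0 => hle hge.
by rewrite ler_norml; apply/andP; split; lra.
Qed.

Local Notation ys := (ystar Y phi).

Lemma ystar_argmax x : is_argmax Y phi x (ys x).
Proof.
apply: (@getPex _ (is_argmax Y phi x)).
case: Y0 => y1 Yy1; pose N := enorm (gy x y1).
(* If [y] does at least as well as [y1], strong concavity gives
   [tau / 2 * |y - y1|^2 <= N * |y - y1|], hence the radius. *)
apply: (@closed_coercive_argmax R d2 Y (phi x) y1 (2 * N / tau)) => //.
- move=> y Yy.
  have cd := differentiable_continuous (phi_diff x Yy).
  have cp : {for y, continuous (fun y' : 'rV[R]_d2 => (x, y'))}.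
    by apply: (@cvg_pair _ _ _ (nbhs y) (nbhs x) (nbhs y)); [exact: cvg_cst|exact: cvg_id].
  have h := continuous_comp cp cd; refine h.
- move=> y Yy hy; have := phi_concave x Yy1 Yy.
  have := dotp_le (gy x y1) (y - y1); rewrite -/N => h1 h2.
  rewrite ler_pdivlMr// mulrC.
  have := enorm_ge0 (y - y1); rewrite le_eqVlt => /orP[/eqP <-|h0].
    by rewrite mulr0 mulr_ge0// enorm_ge0.
  rewrite -(ler_pM2r h0); move: h1 h2 hy; rewrite expr2; lra.
Qed.

Lemma ystar_in x : Y (ys x).
Proof. by case: (ystar_argmax x). Qed.

Lemma primalE x : primal Y phi x = phi x (ys x).
Proof.
have [Ys hs] := ystar_argmax x.
apply/eqP; rewrite eq_le; apply/andP; split.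
  by apply: ge_sup; [exists (phi x (ys x)), (ys x)|move=> _ [y Yy <-]; exact: hs].
by apply: ub_le_sup; [exists (phi x (ys x)) => _ [y Yy <-]; exact: hs|exists (ys x)].
Qed.

Lemma primal_ge x y : Y y -> phi x y <= primal Y phi x.
Proof. by move=> Yy; rewrite primalE; case: (ystar_argmax x) => _; apply. Qed.

(** The difference quotients from the maximizer towards [y] stay in [Y] and are nonpositive, and so
    is their limit. *)
Lemma ystar_optimal x y : Y y -> dotp (gy x (ys x)) (y - ys x) <= 0.
Proof.
move=> Yy; have [Ys hs] := ystar_argmax x.
rewrite dotp_tangent//.
have := @derive_line0 R d1 d2 Y phi x (ys x) 0 (y - ys x) phi_diff Ys.
rewrite /gradxy dotp_row_mx dotp0r add0r => cv.
have <- := cvg_lim (@Rhausdorff R) cv.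
apply: limr_le; first by apply/cvg_ex; eexists; exact: cv.
apply: nearW => n; rewrite scaler0 addr0.
rewrite pmulr_rle0// subr_le0; apply: hs; apply: Ycvx => //.
by rewrite invr_ge0 ler0n/= invf_le1// ler1n.
Qed.

(** Strong concavity used in both directions makes the dual gradient at [x] strongly monotone
    between the two maximizers; the optimality conditions at [x] and [x'] leave only its change in
    [x]. *)
Lemma ystar_lip x x' : tau * enorm (ys x - ys x') <= L * enorm (x - x').
Proof.
set y := ys x; set y' := ys x'; set N := enorm (y - y').
have Yy : Y y := ystar_in x; have Yy' : Y y' := ystar_in x'.
have h1 := phi_concave x Yy' Yy; have h2 := phi_concave x Yy Yy'.
have h3 := ystar_optimal x Yy'; have h4 := ystar_optimal x' Yy.
rewrite -/y -/y' in h3 h4.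
have h5 := dotp_le (gy x y' - gy x' y') (y - y').
have h6 := gy_lipx x x' Yy'.
have h7 : enorm (gy x y' - gy x' y') * N <= L * enorm (x - x') * N.
  by rewrite ler_wpM2r ?enorm_ge0.
rewrite -/N dotpBl in h5; rewrite -/N in h1; rewrite (enormB y') -/N in h2.
have h8 : tau * N * N <= L * enorm (x - x') * N by move: h1 h2; rewrite expr2; lra.
have := enorm_ge0 (y - y'); rewrite -/N le_eqVlt => /orP[/eqP <-|N0].
  by rewrite mulr0 mulr_ge0 ?enorm_ge0// ltW.
by rewrite -(ler_pM2r N0).
Qed.

(** Strong monotonicity meets the Lipschitz bound along [y - z]. Two distinct points are necessary:
    on a singleton both conditions are void. *)
Lemma tau_le_L y z : Y y -> Y z -> y != z -> tau <= L.
Proof.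
move=> Yy Yz yz; pose N := enorm (y - z).
have N0 : 0 < N.
  by rewrite lt0r enorm_ge0 andbT; apply: contraNneq yz => /enorm_eq0/eqP; rewrite subr_eq0.
have h1 := phi_concave 0 Yz Yy; have h2 := phi_concave 0 Yy Yz.
have h5 := dotp_le (gy 0 z - gy 0 y) (y - z).
have h6 := gy_lipy 0 Yz Yy; rewrite enormB -/N in h6.
have h7 : enorm (gy 0 z - gy 0 y) * N <= L * N * N.
  by rewrite ler_wpM2r ?enorm_ge0// (le_trans _ h6)// enormB.
rewrite -(enormN (z - y)) opprB in h2.
rewrite -(opprB y z) dotpNr in h2.
rewrite -/N dotpBl in h5; rewrite -/N in h1 h2.
have h8 : tau * (N * N) <= L * (N * N) by move: h1 h2; rewrite expr2; lra.
by rewrite -(ler_pM2r (mulr_gt0 N0 N0)).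
Qed.

Local Notation F := (primal Y phi).
Local Notation gF := (fun x => gx x (ys x)).
Let Lg := L + L ^+ 2 / tau.

Lemma gF_lip x x' : enorm (gF x - gF x') <= Lg * enorm (x - x').
Proof.
have h1 := gx_lipx x x' (ystar_in x).
have h2 := gx_lipy x' (ystar_in x) (ystar_in x').
have h3 := enorm_triangle (gF x - gx x' (ys x)) (gx x' (ys x) - gF x').
rewrite addrA subrK in h3.
have h4 : L * enorm (ys x - ys x') <= L ^+ 2 / tau * enorm (x - x').
  rewrite expr2 -!mulrA ler_wpM2l ?(ltW L_gt0)// mulrA (mulrC L) -mulrA.
  by rewrite ler_pdivlMl// ystar_lip.
by apply: le_trans h3 _; rewrite /Lg mulrDl lerD// (le_trans h2).
Qed.

(** Freezing the maximizer of one endpoint bounds [F] from below at the other. The two resulting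
    inequalities pin the increment of [F] between those of [phi] at [ystar x] and at
    [ystar (x + u)], whose [x]-gradients differ by at most [L^2 / tau * |u|]. This yields Danskin's
    formula for the gradient of [F]. *)
Lemma primal_quadratic x u :
  `|F (x + u) - F x - dotp (gF x) u| <= (L / 2 + L ^+ 2 / tau) * enorm u ^+ 2.
Proof.
have Ys := ystar_in x; have Ys' := ystar_in (x + u).
have s1 := phi_smooth_x x (x + u) Ys.
have s2 := phi_smooth_x x (x + u) Ys'.
rewrite (addrC x) addrK (addrC u) ler_norml in s1.
rewrite (addrC x) addrK (addrC u) ler_norml in s2.
case/andP: s1 => s1 _; case/andP: s2 => _ s2.
have h1 := primal_ge (x + u) Ys.
have h2 := primal_ge x Ys'.
rewrite !primalE in h1 h2 *.
have h3 := dotp_le (gx x (ys (x + u)) - gx x (ys x)) u; rewrite dotpBl in h3.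
have h4 : enorm (gx x (ys (x + u)) - gx x (ys x)) <= L ^+ 2 / tau * enorm u.
  apply: le_trans (gx_lipy x Ys' Ys) _.
  rewrite expr2 -!mulrA ler_wpM2l ?(ltW L_gt0)// mulrA (mulrC L) -mulrA.
  rewrite ler_pdivlMl//; apply: le_trans (ystar_lip _ _) _.
  by rewrite (addrC x) addrK.
have h5 := ler_wpM2r (enorm_ge0 u) h4.
have h6 : 0 <= L ^+ 2 / tau * enorm u ^+ 2.
  by rewrite mulr_ge0 ?sqr_ge0// divr_ge0 ?sqr_ge0// ltW.
move: h5 h6 s1 s2; rewrite ler_norml mulrDl !expr2 => h5 h6 s1 s2.
by apply/andP; split; lra.
Qed.

Lemma is_derive_primal x u : is_derive x u (F : _ -> R^o) (dotp (gF x) u).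
Proof.
apply: (@is_derive_quadratic _ _ _ _ _ _ ((L / 2 + L ^+ 2 / tau) * enorm u ^+ 2)) => h.
have := primal_quadratic x (h *: u).
by rewrite dotpZr enormZ exprMn real_normK ?num_real// (mulrC (h ^+ 2)) mulrA.
Qed.

Lemma grad_primal x : grad F x = gF x.
Proof.
apply/rowP => i; rewrite [LHS]mxE.
have [_ ->] := is_derive_primal x (delta_mx 0 i).
by rewrite dotp_delta.
Qed.

Lemma primal_descent x x' :
  F x' <= F x + dotp (gF x) (x' - x) + Lg / 2 * enorm (x' - x) ^+ 2.
Proof.
set u := x' - x.
have := @descent_1d R (fun t => F (x + t *: u)) (fun t => dotp (gF (x + t *: u)) u)
   (Lg * enorm u ^+ 2).
rewrite scale1r scale0r addr0 (addrC x u) subrK (mulrAC Lg); apply.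
- move=> t _; have := is_derive_primal (x + t *: u) u.
  apply: is_derive_quotient => h /=.
  by rewrite [h *: 1]mulr1 addrCA -scalerDl.
- move=> t /andP[t0 _]; rewrite -dotpBl; apply: le_trans (dotp_le _ _) _.
  have := gF_lip (x + t *: u) x; rewrite (addrC x) addrK enormZ (ger0_norm t0) => h.
  have := ler_wpM2r (enorm_ge0 u) h; rewrite expr2; lra.
Qed.

Lemma primal_step x y v (g : R) : Y y -> 0 <= g -> g <= 1 / (2 * Lg) ->
  F (x - g *: v) <= F x - g / 2 * enorm (gF x) ^+ 2 - g / 4 * enorm v ^+ 2
    + g * (L ^+ 2 * enorm (y - ys x) ^+ 2 + enorm (gx x y - v) ^+ 2).
Proof.
move=> Yy g0 gle.
have Lg0 : 0 < Lg by rewrite addr_gt0// divr_gt0// exprn_gt0.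
have := primal_descent x (x - g *: v).
rewrite (addrC x) addrK dotpNr dotpZr enormN enormZ exprMn real_normK ?num_real//.
have h1 := enorm_sqrB (gF x) v.
have h2 := enorm_sqrD_le (gF x - gx x y) (gx x y - v); rewrite addrA subrK in h2.
have h3 := gx_lipy x (ystar_in x) Yy.
have {}h3 : enorm (gF x - gx x y) ^+ 2 <= L ^+ 2 * enorm (y - ys x) ^+ 2.
  rewrite -exprMn lerXn2r ?nnegrE ?enorm_ge0 ?mulr_ge0 ?enorm_ge0 ?(ltW L_gt0)//.
  by rewrite (enormB y).
have gLg : g * (2 * Lg) <= 1 by rewrite -ler_pdivlMr// mulr_gt0.
move=> hF; exact: (primal_step_scalar g0 gLg (sqr_ge0 _) hF h1 h2 h3).
Qed.

Lemma dual_step x x' y yt w (eta lambda : R) : Y y -> 0 < eta -> eta <= 1 ->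
  0 < lambda -> lambda <= 1 / (6 * L) -> yt = projection Y (y + lambda *: w) ->
  enorm (y + eta *: (yt - y) - ys x') ^+ 2 <=
  (1 - eta * tau * lambda / 4) * enorm (y - ys x) ^+ 2
  - 3 * eta / 4 * enorm (yt - y) ^+ 2
  + 25 * eta * lambda / (6 * tau) * enorm (gy x y - w) ^+ 2
  + 25 * (L / tau) ^+ 2 / (6 * eta * tau * lambda) * enorm (x' - x) ^+ 2.
Proof.
move=> Yy eta0 eta1 lam0 lamle ytE.
have Yyt : Y yt by rewrite ytE; exact: projection_in.
set z := ys x; have Yz : Y z := ystar_in x.
set z' := ys x'; have Yz' : Y z' := ystar_in x'.
have lamL : lambda * (6 * L) <= 1 by rewrite -ler_pdivlMr// mulr_gt0.
(* On a one-point [Y] the inequality [tau <= L] can fail, but there all dual distances vanish and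
   the remaining terms on the right are nonnegative. *)
have [[y0 [Yy0 y0y]]|/forallNP allY] := pselect (exists y0, Y y0 /\ y0 != y); last first.
  have eqy y0 : Y y0 -> y0 = y.
    by move=> Yy0; apply/eqP/negPn/negP => ne; apply: (allY y0).
  rewrite (eqy _ Yyt) (eqy _ Yz) (eqy _ Yz') subrr scaler0 addr0 subrr enorm0.
  have [[e0 l0] t0] := (ltW eta0, ltW lam0, ltW tau_gt0).
  rewrite expr0n/= !mulr0 subr0 add0r.
  have q0 : 0 <= 25 * eta * lambda / (6 * tau) by rewrite divr_ge0// !mulr_ge0.
  have q1 : 0 <= 25 * (L / tau) ^+ 2 / (6 * eta * tau * lambda).
    by rewrite divr_ge0// mulr_ge0 ?sqr_ge0// !mulr_ge0.
  by rewrite addr_ge0// mulr_ge0// sqr_ge0.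
have tL : tau <= L := tau_le_L Yy0 Yy y0y.
set e := gy x y - w.
pose A := enorm (y - z) ^+ 2; pose B := enorm (yt - y) ^+ 2; pose G := enorm e ^+ 2 / tau.
pose p := dotp (yt - y) (z - y).
have zE : z - yt = (z - y) - (yt - y) by rewrite opprB addrA subrK.
have key : B - lambda * (2 * G - tau / 4 * A + tau / 4 * B + L / 2 * B) <= p.
  have tau4 : 0 < tau / 4 by rewrite divr_gt0.
  have tE : 4 * (tau / 4) = tau by field.
  apply: (@projection_gain _ lambda tau L lam0 A B G p (phi x z) (phi x y) (phi x yt)
    (dotp (gy x y) (z - y)) (dotp (gy x y) (yt - y)) (dotp w (z - yt))
    (dotp e (z - y)) (dotp e (- (yt - y)))).
  - by rewrite /A (enormB y); exact: phi_concave.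
  - exact: phi_smooth_y.
  - by case: (ystar_argmax x) => _; apply.
  - by rewrite -dotpDr -zE -dotpDl -dotpBr -zE /e (addrC w) subrK.
  - have := projection_var Ycl Y0 Ycvx (y + lambda *: w) Yz; rewrite -ytE.
    have -> : y + lambda *: w - yt = lambda *: w - (yt - y) by rewrite opprB addrCA addrA.
    have pB : dotp (yt - y) (z - yt) = p - B by rewrite zE dotpBr /B sqr_enorm.
    by rewrite dotpBl dotpZl pB subr_le0.
  - have := dotp_young (z - y) e tau4.
    by rewrite tE dotpC (enormB z) -/A.
  - have := dotp_young (- (yt - y)) e tau4.
    by rewrite tE dotpC enormN -/B.
have -> : 25 * eta * lambda / (6 * tau) * enorm e ^+ 2 = 25 / 6 * (eta * lambda * G).
  by rewrite /G; field; rewrite gt_eqF.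
pose A1 := enorm (y + eta *: (yt - y) - z) ^+ 2.
have A1E : A1 = A - 2 * eta * p + eta ^+ 2 * B.
  rewrite /A1 addrAC enorm_sqrD enormZ exprMn real_normK ?num_real// -/A -/B.
  rewrite dotpZr dotpC -(opprB z y) dotpNr -/p; ring.
have A1le := projected_step_contraction eta0 eta1 lam0 tL lamL (sqr_ge0 _) key A1E.
apply: (dual_step_drift eta0 eta1 lam0 tau_gt0 tL lamL _ _ _ _ _ _ A1le).
- exact: sqr_ge0.
- exact: sqr_ge0.
- by rewrite divr_ge0 ?sqr_ge0// ltW.
- exact: sqr_ge0.
- exact: (sqr_ge0 (enorm (z - z'))).
- have zz : enorm (z - z') <= L / tau * enorm (x' - x).
    by rewrite mulrAC ler_pdivlMr// mulrC (enormB x') ystar_lip.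
  have q0 : 0 <= L / tau * enorm (x' - x) by apply: le_trans zz; exact: enorm_ge0.
  by rewrite -exprMn lerXn2r// nnegrE ?enorm_ge0.
- move=> a a0.
  have -> : y + eta *: (yt - y) - z' = (y + eta *: (yt - y) - z) + (z - z') by rewrite addrA subrK.
  rewrite enorm_sqrD -/A1.
  have ha : 0 < a / 2 by rewrite divr_gt0.
  have := dotp_young (y + eta *: (yt - y) - z) (z - z') ha.
  have -> : 4 * (a / 2) = 2 * a by field.
  have -> : enorm (z - z') ^+ 2 / (2 * a) = a^-1 * enorm (z - z') ^+ 2 / 2 by field; rewrite gt_eqF.
  by rewrite -/A1; lra.
Qed.

Variables (gamma lambda : R).
Hypotheses (gamma0 : 0 < gamma) (lambda0 : 0 < lambda) (lambda_le : lambda <= 1 / (6 * L)).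

Lemma path_step x x' v y y' yt w (e : R) : Y y -> 0 < e -> e <= 1 ->
  gamma * e <= 1 / (2 * Lg) -> yt = projection Y (y + lambda *: w) ->
  x' = x - (gamma * e) *: v -> y' = y + e *: (yt - y) ->
  gamma * e / 2 * enorm (gF x) ^+ 2 <=
    (F x + 9 * gamma * L ^+ 2 / (lambda * tau) * enorm (y - ys x) ^+ 2)
    - (F x' + 9 * gamma * L ^+ 2 / (lambda * tau) * enorm (y' - ys x') ^+ 2)
    + (- (gamma * e / 4) * enorm v ^+ 2 + gamma * e * enorm (gx x y - v) ^+ 2
       + 9 * gamma * L ^+ 2 / (lambda * tau) * (- (3 * e / 4) * enorm (yt - y) ^+ 2
         + 25 * e * lambda / (6 * tau) * enorm (gy x y - w) ^+ 2
         + 25 * (L / tau) ^+ 2 * e * gamma ^+ 2 / (6 * tau * lambda) * enorm v ^+ 2)).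
Proof.
move=> Yy e0 e1 gle ytE x'E y'E.
have h1 := primal_step x v Yy (ltW (mulr_gt0 gamma0 e0)) gle; rewrite -x'E in h1.
have h2 := dual_step x x' Yy e0 e1 lambda0 lambda_le ytE; rewrite -y'E in h2.
have xx : enorm (x' - x) ^+ 2 = (gamma * e) ^+ 2 * enorm v ^+ 2.
  by rewrite x'E (addrC x) addrK enormN enormZ exprMn real_normK ?num_real.
rewrite xx in h2.
exact: (path_step_scalar gamma0 e0 lambda0 tau_gt0 L_gt0 (sqr_ge0 _) h1 h2).
Qed.

(** A deterministic estimate for one realization: the parts in [F] and [ystar] telescope, and the
    bracket gathers what only becomes controllable after taking expectations. *)
Lemma path_bound (T : nat) (eta : nat -> R) (c : R)
    (x v : nat -> 'rV[R]_d1) (y w : nat -> 'rV[R]_d2) :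
  (forall t, (1 <= t <= T)%N -> Y (y t)) -> (forall t, 0 < eta t) -> (forall t, eta t <= 1) ->
  (forall t, gamma * eta t <= 1 / (2 * Lg)) ->
  (forall t, (1 <= t <= T)%N -> x t.+1 = x t - (gamma * eta t) *: v t) ->
  (forall t, (1 <= t <= T)%N ->
    y t.+1 = y t + eta t *: (projection Y (y t + lambda *: w t) - y t)) ->
  (forall x, c <= F x) ->
  \sum_(1 <= t < T.+1) gamma * eta t / 2 * enorm (gF (x t)) ^+ 2 <=
    F (x 1%N) - c + 9 * gamma * L ^+ 2 / (lambda * tau) * enorm (y 1%N - ys (x 1%N)) ^+ 2 +
    \sum_(1 <= t < T.+1) (- (gamma * eta t / 4) * enorm (v t) ^+ 2
       + gamma * eta t * enorm (gx (x t) (y t) - v t) ^+ 2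
       + 9 * gamma * L ^+ 2 / (lambda * tau) *
         (- (3 * eta t / 4) * enorm (projection Y (y t + lambda *: w t) - y t) ^+ 2
         + 25 * eta t * lambda / (6 * tau) * enorm (gy (x t) (y t) - w t) ^+ 2
         + 25 * (L / tau) ^+ 2 * eta t * gamma ^+ 2 / (6 * tau * lambda) * enorm (v t) ^+ 2)).
Proof.
move=> Yt eta0 eta1 gle xE yE cF.
pose brk t := - (gamma * eta t / 4) * enorm (v t) ^+ 2
       + gamma * eta t * enorm (gx (x t) (y t) - v t) ^+ 2
       + 9 * gamma * L ^+ 2 / (lambda * tau) *
         (- (3 * eta t / 4) * enorm (projection Y (y t + lambda *: w t) - y t) ^+ 2
         + 25 * eta t * lambda / (6 * tau) * enorm (gy (x t) (y t) - w t) ^+ 2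
         + 25 * (L / tau) ^+ 2 * eta t * gamma ^+ 2 / (6 * tau * lambda) * enorm (v t) ^+ 2).
rewrite -[X in _ <= _ + X]/(\sum_(1 <= t < T.+1) brk t).
pose p t := F (x t) + 9 * gamma * L ^+ 2 / (lambda * tau) * enorm (y t - ys (x t)) ^+ 2.
have H t : (1 <= t <= T)%N ->
    gamma * eta t / 2 * enorm (gF (x t)) ^+ 2 - brk t <= p t - p t.+1.
  move=> tT; rewrite lerBlDr.
  exact: (path_step (Yt t tT) (eta0 t) (eta1 t) (gle t) erefl (xE t tT) (yE t tT)).
have := sum_le_telescope H; rewrite sumrB lerBlDr => h; apply: le_trans h _.
rewrite lerD2r; have cp : c <= p T.+1.
  rewrite /p (le_trans (cF (x T.+1)))// lerDl mulr_ge0 ?sqr_ge0//.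
  have L2 : 0 < L ^+ 2 by rewrite exprn_gt0.
  by rewrite ltW// divr_gt0// !mulr_gt0.
have -> : F (x 1%N) - c + 9 * gamma * L ^+ 2 / (lambda * tau) * enorm (y 1%N - ys (x 1%N)) ^+ 2 =
  p 1%N - c by rewrite /p addrAC.
by rewrite lerD2l lerN2.
Qed.

End minimax_analysis.

(** * Lyapunov function and step sizes *)

Section lyapunov.
Context {R : realFieldType}.
Variables (gamma lambda tau L delta k c1 c2 B : R).
Hypotheses (gamma0 : 0 < gamma) (lambda0 : 0 < lambda) (tau0 : 0 < tau) (L0 : 0 < L).
Hypotheses (k0 : 0 < k) (B0 : 0 < B).

(** With [r = 1 - c e^2] in the unit interval, [r^2 <= r]; dividing by [e] then turns the
    contraction into the linear gain [c e X]. *)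
Lemma storm_error_scaled (c e X X' W : R) : 0 < e -> 0 <= c -> c * e ^+ 2 <= 1 ->
  0 <= X -> 0 <= W ->
  X' <= (1 - c * e ^+ 2) ^+ 2 * X + B^-1 * (2 * (c * e ^+ 2) ^+ 2 * delta ^+ 2
     + 2 * (1 - c * e ^+ 2) ^+ 2 * L ^+ 2 * (e ^+ 2 * W)) ->
  X' / e <= X / e - c * e * X + 2 * c ^+ 2 * e ^+ 3 * delta ^+ 2 / B + 2 * L ^+ 2 * e * W / B.
Proof.
move=> e0 c0 ce X0 W0 hX.
rewrite ler_pdivrMr//.
have -> : (X / e - c * e * X + 2 * c ^+ 2 * e ^+ 3 * delta ^+ 2 / B + 2 * L ^+ 2 * e * W / B) * e
   = (1 - c * e ^+ 2) * X + B^-1 * (2 * (c * e ^+ 2) ^+ 2 * delta ^+ 2 + 2 * L ^+ 2 * (e ^+ 2 * W)).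
  by field; rewrite !gt_eqF.
apply: le_trans hX _.
have a0 : 0 <= c * e ^+ 2 by rewrite mulr_ge0 ?sqr_ge0.
set r := 1 - c * e ^+ 2.
have r0 : 0 <= r by rewrite subr_ge0.
have r1 : r <= 1 by rewrite /r gerBl.
have rr : r ^+ 2 <= r by rewrite expr2 ler_piMl.
apply: lerD; first by rewrite ler_wpM2r.
rewrite ler_wpM2l ?invr_ge0 ?(ltW B0)// lerD2l.
have -> : 2 * r ^+ 2 * L ^+ 2 * (e ^+ 2 * W) = r ^+ 2 * (2 * L ^+ 2 * (e ^+ 2 * W)) by ring.
rewrite ler_piMl ?(le_trans rr)//.
by apply: mulr_ge0; apply: mulr_ge0; rewrite ?sqr_ge0.
Qed.

Hypothesis c1_ge : 2 / (3 * k ^+ 3) + 9 * tau ^+ 2 / 4 <= c1.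
Hypothesis c2_ge : 2 / (3 * k ^+ 3) + 75 * L ^+ 2 / 2 <= c2.
Hypothesis lambda_le : lambda <= 27 * B * tau / 16.
Hypothesis gamma_le : gamma ^+ 2 <= lambda ^+ 2 * tau ^+ 2 / (4 * L ^+ 2) *
  (2 * B / (8 * lambda ^+ 2 + 75 * (L / tau) ^+ 2 * B)).

Lemma lyapunov_coef_S (e : R) : 0 < e ->
  9 * gamma * L ^+ 2 / (lambda * tau) * (- (3 * e / 4)) + gamma / tau ^+ 2 * (4 * L ^+ 2 * e / B) <= 0.
Proof.
move=> e0.
have -> : 9 * gamma * L ^+ 2 / (lambda * tau) * (- (3 * e / 4)) + gamma / tau ^+ 2 * (4 * L ^+ 2 * e / B)
  = (gamma * L ^+ 2 * e * 4 / (lambda * tau ^+ 2 * B)) * (lambda - 27 * B * tau / 16).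
  by field; rewrite !gt_eqF.
rewrite mulr_ge0_le0 ?subr_le0//.
by rewrite divr_ge0// !mulr_ge0 ?sqr_ge0// ltW.
Qed.

(** In [Z], the term [8 lambda^2] comes from the drift of the two estimators and [75 (L / tau)^2 B]
    from the motion of [ystar]; the bound on [gamma] caps their sum by the [gamma e / 4] gained in
    the primal step. *)
Lemma lyapunov_coef_U (e : R) : 0 < e ->
  - (gamma * e / 4) + 9 * gamma * L ^+ 2 / (lambda * tau) *
     (25 * (L / tau) ^+ 2 * e * gamma ^+ 2 / (6 * tau * lambda))
  + gamma / tau ^+ 2 * (4 * L ^+ 2 * e * gamma ^+ 2 / B) <= 0.
Proof.
have gle := gamma_le; move=> e0; set Z := 8 * lambda ^+ 2 + 75 * (L / tau) ^+ 2 * B in gle.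
have Z0 : 0 < Z.
  have l2 : 0 < lambda ^+ 2 by rewrite exprn_gt0.
  have k2 : 0 < (L / tau) ^+ 2 by rewrite exprn_gt0// divr_gt0.
  by apply: addr_gt0; [apply: mulr_gt0|apply: mulr_gt0 => //; apply: mulr_gt0].
have -> : - (gamma * e / 4) + 9 * gamma * L ^+ 2 / (lambda * tau) *
     (25 * (L / tau) ^+ 2 * e * gamma ^+ 2 / (6 * tau * lambda))
  + gamma / tau ^+ 2 * (4 * L ^+ 2 * e * gamma ^+ 2 / B) =
  gamma * e * (L ^+ 2 * Z / (2 * tau ^+ 2 * lambda ^+ 2 * B) * gamma ^+ 2 - 1 / 4).
  by rewrite /Z; field; rewrite !gt_eqF.
rewrite mulr_ge0_le0 ?mulr_ge0 ?(ltW gamma0) ?(ltW e0)// subr_le0.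
have q0 : 0 <= L ^+ 2 * Z / (2 * tau ^+ 2 * lambda ^+ 2 * B).
  have [t2 l2] : 0 < tau ^+ 2 /\ 0 < lambda ^+ 2 by rewrite !exprn_gt0.
  apply: divr_ge0; first by rewrite mulr_ge0 ?sqr_ge0// ltW.
  by apply/ltW; do 3 apply: mulr_gt0 => //.
apply: le_trans (ler_wpM2l q0 gle) _.
rewrite le_eqVlt; apply/orP; left; apply/eqP.
by field; rewrite !gt_eqF.
Qed.

(** Here [e] and [e'] are the current and previous step sizes. In [c1] and [c2], [2 / (3 k^3)] pays
    for [1 / e - 1 / e']. After scaling by [gamma / tau^2], [9 tau^2 / 4] yields [9/4 gamma e X],
    above the [gamma e X] to be absorbed, and [75 L^2 / 2] cancels the term in [Z] exactly, as
    [9 * 25 / 6 = 75 / 2]. *)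
Lemma lyapunov_step (e e' X X' Z Z' U S : R) :
  0 < e -> 0 < e' -> e^-1 - e'^-1 <= 2 / (3 * k ^+ 3) * e ->
  c1 * e ^+ 2 <= 1 -> c2 * e ^+ 2 <= 1 ->
  0 <= X -> 0 <= Z -> 0 <= U -> 0 <= S ->
  X' <= (1 - c1 * e ^+ 2) ^+ 2 * X + B^-1 * (2 * (c1 * e ^+ 2) ^+ 2 * delta ^+ 2
     + 2 * (1 - c1 * e ^+ 2) ^+ 2 * L ^+ 2 * (e ^+ 2 * (gamma ^+ 2 * U + S))) ->
  Z' <= (1 - c2 * e ^+ 2) ^+ 2 * Z + B^-1 * (2 * (c2 * e ^+ 2) ^+ 2 * delta ^+ 2
     + 2 * (1 - c2 * e ^+ 2) ^+ 2 * L ^+ 2 * (e ^+ 2 * (gamma ^+ 2 * U + S))) ->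
  - (gamma * e / 4) * U + gamma * e * X
  + 9 * gamma * L ^+ 2 / (lambda * tau) * (- (3 * e / 4) * S
     + 25 * e * lambda / (6 * tau) * Z
     + 25 * (L / tau) ^+ 2 * e * gamma ^+ 2 / (6 * tau * lambda) * U)
  <= gamma / tau ^+ 2 * ((X + Z) / e') - gamma / tau ^+ 2 * ((X' + Z') / e)
     + gamma / tau ^+ 2 * (2 * (c1 ^+ 2 + c2 ^+ 2) * e ^+ 3 * delta ^+ 2 / B).
Proof.
move=> e0 e'0 he c1e c2e X0 Z0 U0 S0 hX hZ.
have k3 : 0 <= 2 / (3 * k ^+ 3) by rewrite divr_ge0// mulr_ge0// exprn_ge0// ltW.
have c10 : 0 <= c1.
  by apply: le_trans c1_ge; rewrite addr_ge0// divr_ge0// mulr_ge0// ?sqr_ge0.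
have c20 : 0 <= c2.
  by apply: le_trans c2_ge; rewrite addr_ge0// divr_ge0// mulr_ge0// ?sqr_ge0.
have W0 : 0 <= gamma ^+ 2 * U + S by rewrite addr_ge0// mulr_ge0 ?sqr_ge0.
have r1 := storm_error_scaled e0 c10 c1e X0 W0 hX.
have r2 := storm_error_scaled e0 c20 c2e Z0 W0 hZ.
have eX := ler_wpM2l X0 he; have eZ := ler_wpM2l Z0 he.
have dX := ler_wpM2r (mulr_ge0 (ltW e0) X0) c1_ge.
have dZ := ler_wpM2r (mulr_ge0 (ltW e0) Z0) c2_ge.
have q0 : 0 < gamma / tau ^+ 2 by rewrite divr_gt0// exprn_gt0.
have sS := ler_wpM2r S0 (lyapunov_coef_S e0).
have sU := ler_wpM2r U0 (lyapunov_coef_U e0).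
rewrite !mul0r in sS sU.
pose W := gamma ^+ 2 * U + S.
have WE : 2 * L ^+ 2 * e * W / B + 2 * L ^+ 2 * e * W / B =
   4 * L ^+ 2 * e * gamma ^+ 2 / B * U + 4 * L ^+ 2 * e / B * S.
  by rewrite /W; field; rewrite gt_eqF.
have main : (X' + Z') / e <= (X + Z) / e' - 9 * tau ^+ 2 / 4 * (e * X) - 75 * L ^+ 2 / 2 * (e * Z)
   + 2 * (c1 ^+ 2 + c2 ^+ 2) * e ^+ 3 * delta ^+ 2 / B
   + (4 * L ^+ 2 * e * gamma ^+ 2 / B * U + 4 * L ^+ 2 * e / B * S).
  rewrite -WE !mulrDl; move: r1 r2 eX eZ dX dZ; rewrite -/W.
  lra.
have {}main := ler_wpM2l (ltW q0) main.
have XE : gamma / tau ^+ 2 * (9 * tau ^+ 2 / 4 * (e * X)) = 9 / 4 * (gamma * e * X).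
  by field; rewrite gt_eqF.
have ZE : gamma / tau ^+ 2 * (75 * L ^+ 2 / 2 * (e * Z)) =
    9 * gamma * L ^+ 2 / (lambda * tau) * (25 * e * lambda / (6 * tau) * Z).
  by field; rewrite !gt_eqF.
have gX : 0 <= gamma * e * X by rewrite !mulr_ge0// ltW.
move: main; rewrite !mulrDr !mulrN => main.
rewrite XE ZE in main.
move: sS sU main gX; lra.
Qed.

End lyapunov.

(** * Step sizes, the logarithmic sum and the passage to averages *)

Section step_size_theory.
Context {R : realType}.
Variables (k m : R).
Hypotheses (k0 : 0 < k) (m2 : 2 <= m) (km : k ^+ 3 <= m).

Let r (t : nat) : R := (m + t%:R) `^ 3^-1.

Let m0 : 0 < m. Proof. by apply: lt_le_trans m2. Qed.

Let mt0 t : 0 < m + t%:R.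
Proof. by rewrite ltr_pwDl. Qed.

Let r0 t : 0 < r t. Proof. by rewrite powR_gt0. Qed.

Let r3 t : r t ^+ 3 = m + t%:R.
Proof. by rewrite /r -powR_mulrn ?powR_ge0// -powRrM mulVf// powRr1// ltW. Qed.

Let le_r c t : 0 <= c -> c ^+ 3 <= m -> c <= r t.
Proof.
move=> c0 cm; rewrite -(@ler_pXn2r _ 3)// ?nnegrE ?(ltW (r0 t))// r3.
by rewrite (le_trans cm)// lerDl.
Qed.

Lemma step_size_gt0 t : 0 < step_size k m t.
Proof. by rewrite divr_gt0 ?r0. Qed.

Lemma step_size_le1 t : step_size k m t <= 1.
Proof. by rewrite ler_pdivrMr ?r0// mul1r le_r// ltW. Qed.

Lemma step_size_cube t : step_size k m t ^+ 3 = k ^+ 3 / (m + t%:R).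
Proof. by rewrite /step_size expr_div_n -/(r t) r3. Qed.

Lemma step_size_sqr_le1 c t : 0 <= c -> (c * k) ^+ 3 <= m -> c * step_size k m t ^+ 2 <= 1.
Proof.
move=> c0 cm; rewrite /step_size expr_div_n -/(r t) mulrA ler_pdivrMr ?exprn_gt0 ?r0//.
rewrite mul1r expr2 mulrA expr2 ler_pM ?mulr_ge0 ?(ltW k0)// le_r ?mulr_ge0 ?(ltW k0)//.
Qed.

Lemma step_size_antitone s t : (s <= t)%N -> step_size k m t <= step_size k m s.
Proof.
move=> st; rewrite ler_pM2l// lef_pV2 ?posrE ?r0//.
by rewrite -(@ler_pXn2r _ 3)// ?nnegrE ?(ltW (r0 _))// !r3 lerD2l ler_nat.
Qed.

(** For the consecutive cube roots [a] and [b], [a^3 - b^3 = 1], so [a - b = 1 / (a^2 + a b + b^2)].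
    This is at most [2 / (3 a^2)] because [a <= 2 b], and [k <= a] exchanges a factor [a] for
    [k]. *)
Lemma step_size_inv t : (step_size k m t.+1)^-1 - (step_size k m t)^-1 <=
  2 / (3 * k ^+ 3) * step_size k m t.+1.
Proof.
rewrite /step_size -/(r t) -/(r t.+1) !invf_div.
set a := r t.+1; set b := r t.
have a0 : 0 < a := r0 _; have b0 : 0 < b := r0 _.
have ab : a ^+ 3 - b ^+ 3 = 1 by rewrite !r3 -natr1; ring.
have b1 : 2 <= b ^+ 3 by rewrite r3 (le_trans m2)// lerDl.
have ba : a <= 2 * b.
  rewrite -(@ler_pXn2r _ 3)// ?nnegrE ?mulr_ge0 ?(ltW a0) ?(ltW b0)// exprMn.
  by move: ab b1; lra.
have ka : k <= a by apply: le_r => //; exact: ltW.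
have h1 : (a - b) * (a ^+ 2 + a * b + b ^+ 2) = 1 by rewrite -ab; ring.
have S0 : 0 < a ^+ 2 + a * b + b ^+ 2 by rewrite !addr_gt0 ?exprn_gt0 ?mulr_gt0.
have h2 : 3 / 2 * a ^+ 2 <= a ^+ 2 + a * b + b ^+ 2.
  have := ler_wpM2l (ltW a0) ba; have := sqr_ge0 b; rewrite !expr2; lra.
have h3 : a - b <= 2 / (3 * a ^+ 2).
  rewrite ler_pdivlMr ?mulr_gt0 ?exprn_gt0//.
  have ab0 : 0 <= a - b by rewrite -(pmulr_lge0 _ S0) h1.
  by have := ler_wpM2l ab0 h2; rewrite h1; lra.
rewrite -mulrBl.
have h4 : (a - b) / k <= 2 / (3 * a ^+ 2) / k by rewrite ler_wpM2r ?invr_ge0 ?(ltW k0).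
apply: le_trans h4 _.
have -> : 2 / (3 * a ^+ 2) / k = 2 / (3 * (a ^+ 2 * k)) by field; rewrite !gt_eqF.
have -> : 2 / (3 * k ^+ 3) * (k / a) = 2 / (3 * (k ^+ 2 * a)) by field; rewrite !gt_eqF.
rewrite ler_pM2l// lef_pV2 ?posrE ?mulr_gt0 ?exprn_gt0// ler_pM2l//.
have := ler_wpM2l (ltW (mulr_gt0 k0 a0)) ka; rewrite !expr2; lra.
Qed.

Lemma step_size0 : step_size k m 0 = k / m `^ 3^-1.
Proof. by rewrite /step_size addr0. Qed.

Lemma step_size_lt_bound g Lg t : 0 < Lg -> g <= m `^ 3^-1 / (2 * Lg * k) -> 0 <= g ->
  g * step_size k m t <= 1 / (2 * Lg).
Proof.
move=> Lg0 hg g0.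
have h1 : g * step_size k m t <= g * step_size k m 0 by rewrite ler_wpM2l// step_size_antitone.
apply: le_trans h1 _; rewrite step_size0.
have p0 : 0 < m `^ 3^-1 by rewrite powR_gt0.
have q0 : 0 <= k / m `^ 3^-1 by rewrite divr_ge0 ?ltW.
apply: le_trans (ler_wpM2r q0 hg) _.
by rewrite le_eqVlt; apply/orP; left; apply/eqP; field; rewrite !gt_eqF.
Qed.

(** Each term is at most an increment of the logarithm, by [ln (1 - u) <= - u] with
    [u = 1 / (m + T + 1)]; the sum starts from [ln m >= 0]. *)
Lemma harmonic_le_ln (T : nat) :
  \sum_(1 <= t < T.+1) (m + t%:R)^-1 <= ln (m + T%:R).
Proof.
elim: T => [|T IH].
  by rewrite big_geq// addr0 ln_ge0// (le_trans _ m2)// ler1n.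
rewrite big_nat_recr//=.
apply: le_trans (_ : ln (m + T%:R) + (m + T.+1%:R)^-1 <= _); first by rewrite lerD2r.
set a := m + T.+1%:R; have a0 : 0 < a := mt0 _.
have bE : m + T%:R = a * (1 + - a^-1) by rewrite mulrDr mulr1 mulrN divff ?gt_eqF// /a -natr1; ring.
have u1 : 0 < 1 + - a^-1 by rewrite -(pmulr_rgt0 _ a0) -bE.
rewrite bE lnM ?posrE// -addrA gerDl.
have h : -1 < - a^-1 by lra.
by have := le_ln1Dx h; lra.
Qed.

Lemma sum_step_size_cube (T : nat) :
  \sum_(1 <= t < T.+1) step_size k m t ^+ 3 <= k ^+ 3 * ln (m + T%:R).
Proof.
under eq_bigr do rewrite step_size_cube.
rewrite -mulr_sumr ler_wpM2l ?harmonic_le_ln//.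
by rewrite exprn_ge0// ltW.
Qed.

(* The average of z is bounded through z <= (g / c + c) / 2 with c^2 = 2 M (m + T)^(1/3) / T. *)
Lemma average_bound (T : nat) (M : R) (g z : nat -> R) : (0 < T)%N -> 0 < M ->
  (forall t, 0 <= g t) ->
  (forall t c, (1 <= t <= T)%N -> 0 < c -> z t <= g t / (2 * c) + c / 2) ->
  \sum_(1 <= t < T.+1) step_size k m t * g t <= 2 * k * M ->
  T%:R^-1 * \sum_(1 <= t < T.+1) z t <=
  Num.sqrt (2 * M) * m `^ 6^-1 / T%:R `^ 2^-1 + Num.sqrt (2 * M) / T%:R `^ 3^-1.
Proof.
move=> T0 M0 g0 hz hg.
have TR : 0 < T%:R :> R by rewrite ltr0n.
pose q := 2 * M * r T / T%:R; have q0 : 0 < q by rewrite divr_gt0// !mulr_gt0 ?r0.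
pose c := Num.sqrt q; have c0 : 0 < c by rewrite sqrtr_gt0.
have cc : c ^+ 2 = q by rewrite sqr_sqrtr// ltW.
(* The step sizes decrease, so every weight is at least the last one, [k / r T]. *)
have sg : T%:R^-1 * \sum_(1 <= t < T.+1) g t <= q.
  have : step_size k m T * \sum_(1 <= t < T.+1) g t <= 2 * k * M.
    apply: le_trans hg; rewrite mulr_sumr !big_nat ler_sum// => t /andP[_ tT].
    by rewrite ler_wpM2r// step_size_antitone.
  rewrite /step_size -/(r T) => h.
  have h2 : \sum_(1 <= t < T.+1) g t <= 2 * M * r T.
    rewrite -(ler_pM2l (divr_gt0 k0 (r0 T))); apply: le_trans h _.
    by rewrite le_eqVlt; apply/orP; left; apply/eqP; field; rewrite gt_eqF ?r0.
  by rewrite mulrC ler_wpM2r// invr_ge0 ltW.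
have sz : T%:R^-1 * \sum_(1 <= t < T.+1) z t <= c.
  have : \sum_(1 <= t < T.+1) z t <= (\sum_(1 <= t < T.+1) g t) / (2 * c) + T%:R * (c / 2).
    have -> : T%:R * (c / 2) = \sum_(1 <= t < T.+1) (c / 2).
      by rewrite sumr_const_nat subn1 mulr_natl.
    by rewrite mulr_suml -big_split !big_nat ler_sum// => t tT; exact: hz.
  move=> h; have Ti : 0 <= T%:R^-1 :> R by rewrite invr_ge0 ltW.
  apply: le_trans (ler_wpM2l Ti h) _.
  rewrite mulrDr (mulKf (lt0r_neq0 TR)) mulrA.
  have c2 : 0 <= (2 * c)^-1 by rewrite invr_ge0 mulr_ge0// ltW.
  have := ler_wpM2r c2 sg; rewrite -cc.
  have -> : c ^+ 2 / (2 * c) = c / 2 by field; rewrite gt_eqF.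
  by lra.
apply: le_trans sz _.
have M20 : 0 <= 2 * M by rewrite mulr_ge0// ltW.
have cE : c = Num.sqrt (2 * M) * ((m + T%:R) `^ 6^-1 / T%:R `^ 2^-1).
  rewrite /c /q -mulrA sqrtrM//; congr (_ * _).
  rewrite -[LHS]powR12_sqrt; last by rewrite divr_ge0// ltW// r0.
  rewrite powRM ?invr_ge0 ?(ltW (r0 _)) ?(ltW TR)//; congr (_ * _).
    by rewrite /r -powRrM; congr (_ `^ _); field.
  by rewrite -powR_inv1 ?(ltW TR)// -powRrM mulrC powRrM powR_inv1// powR_ge0.
rewrite cE -mulrA -mulrDr ler_wpM2l ?sqrtr_ge0//.
have t2 : 0 < T%:R `^ 2^-1 :> R by rewrite powR_gt0.
have -> : (T%:R `^ 3^-1)^-1 = T%:R `^ 6^-1 / T%:R `^ 2^-1 :> R.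
  have -> : T%:R `^ 2^-1 = T%:R `^ 6^-1 * T%:R `^ 3^-1 :> R.
    rewrite -powRD; last by rewrite (gt_eqF TR) implybT.
    by congr (_ `^ _); field.
  by field; rewrite !gt_eqF// powR_gt0.
rewrite -mulrDl ler_wpM2r ?invr_ge0 ?(ltW t2)//.
(* Subadditivity of the sixth root, obtained by comparing sixth powers; it splits [(m + T)^(1/6)]
   into the two terms of the bound. *)
pose a : R := m `^ 6^-1; pose b : R := T%:R `^ 6^-1.
have six (x : R) : 0 <= x -> (x `^ 6^-1) ^+ 6 = x.
  by move=> x0; rewrite -powR_mulrn ?powR_ge0// -powRrM mulVf// powRr1.
have a0 : 0 <= a := powR_ge0 _ _; have b0 : 0 <= b := powR_ge0 _ _.
rewrite -(@ler_pXn2r _ 6)// ?nnegrE ?powR_ge0 ?addr_ge0// six ?(ltW (mt0 _))//.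
rewrite -/a -/b -(six m (ltW m0)) -(six T%:R (ltW TR)) -/a -/b.
have -> : (a + b) ^+ 6 = a ^+ 6 + b ^+ 6 + (6 * (a ^+ 5 * b) + 15 * (a ^+ 4 * b ^+ 2)
   + 20 * (a ^+ 3 * b ^+ 3) + 15 * (a ^+ 2 * b ^+ 4) + 6 * (a * b ^+ 5)) by ring.
by rewrite lerDl !addr_ge0// mulr_ge0// mulr_ge0// exprn_ge0.
Qed.

End step_size_theory.

(** * Moments along a run *)

Section run_moments.
Context {R : realType} {d d' : measure_display} {Omega : measurableType d}
  {Xi : measurableType d'} {d1 d2 b : nat}.
Variables (P : probability Omega R) (D : probability Xi R) (T : nat).
Hypothesis b_gt0 : (0 < b)%N.
Variable xi : nat * 'I_b -> {RV P >-> Xi}.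
Hypothesis xi_iid : iid D [set p | (1 <= p.1 <= T.+1)%N] xi.
Variables (hx : Xi -> 'rV[R]_(d1 + d2) -> 'rV[R]_d1) (hxbar : 'rV[R]_(d1 + d2) -> 'rV[R]_d1).
Variables (hy : Xi -> 'rV[R]_(d1 + d2) -> 'rV[R]_d2) (hybar : 'rV[R]_(d1 + d2) -> 'rV[R]_d2).
Variables (L delta : R).
Hypothesis L_ge0 : 0 <= L.
Hypothesis hx_meas : forall z i, measurable_fun setT (fun s => hx s z 0 i).
Hypothesis hx_lip : forall s z z', enorm (hx s z - hx s z') <= L * enorm (z - z').
Hypothesis hx_int : forall z i, D.-integrable setT (EFin \o (fun s => hx s z 0 i)).
Hypothesis hx_mean : forall z i, \int[D]_s hx s z 0 i = hxbar z 0 i.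
Hypothesis hx_var : forall z,
  (\int[D]_s (enorm (hx s z - hxbar z) ^+ 2)%:E <= (delta ^+ 2)%:E)%E.
Hypothesis hy_meas : forall z i, measurable_fun setT (fun s => hy s z 0 i).
Hypothesis hy_lip : forall s z z', enorm (hy s z - hy s z') <= L * enorm (z - z').
Hypothesis hy_int : forall z i, D.-integrable setT (EFin \o (fun s => hy s z 0 i)).
Hypothesis hy_mean : forall z i, \int[D]_s hy s z 0 i = hybar z 0 i.
Hypothesis hy_var : forall z,
  (\int[D]_s (enorm (hy s z - hybar z) ^+ 2)%:E <= (delta ^+ 2)%:E)%E.

Variables (pr : 'rV[R]_d2 -> 'rV[R]_d2) (gamma lambda c1 c2 : R) (eta : nat -> R).
Hypothesis pr_lip : forall u u', enorm (pr u - pr u') <= enorm (u - u').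
Variables (x1 : 'rV[R]_d1) (y1 : 'rV[R]_d2).
Variables (x v : nat -> Omega -> 'rV[R]_d1) (y w : nat -> Omega -> 'rV[R]_d2).
Local Notation z := (fun t o => row_mx (x t o) (y t o)).
Hypothesis x1E : forall o, x 1%N o = x1.
Hypothesis y1E : forall o, y 1%N o = y1.
Hypothesis v1E : forall o, v 1%N o = batch_mean xi hx 1 (row_mx x1 y1) o.
Hypothesis w1E : forall o, w 1%N o = batch_mean xi hy 1 (row_mx x1 y1) o.
Hypothesis xE : forall t o, (1 <= t <= T)%N -> x t.+1 o = x t o - (gamma * eta t) *: v t o.
Hypothesis yE : forall t o, (1 <= t <= T)%N ->
  y t.+1 o = y t o + eta t *: (pr (y t o + lambda *: w t o) - y t o).
Hypothesis y_fix : forall t o, (1 <= t <= T)%N -> pr (y t o) = y t o.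
Hypothesis vE : forall t o, (1 <= t <= T)%N ->
  v t.+1 o = batch_mean xi hx t.+1 (z t.+1 o) o
    + (1 - c1 * eta t ^+ 2) *: (v t o - batch_mean xi hx t.+1 (z t o) o).
Hypothesis wE : forall t o, (1 <= t <= T)%N ->
  w t.+1 o = batch_mean xi hy t.+1 (z t.+1 o) o
    + (1 - c2 * eta t ^+ 2) *: (w t o - batch_mean xi hy t.+1 (z t o) o).

Local Notation Int X := (P.-integrable setT (EFin \o X)).
Local Notation ex t o := (enorm (hxbar (z t o) - v t o) ^+ 2).
Local Notation ey t o := (enorm (hybar (z t o) - w t o) ^+ 2).
Local Notation dy t o := (enorm (pr (y t o + lambda *: w t o) - y t o) ^+ 2).

(** The invariant of the run. The squared distance to the starting point is included because the
    mean gradients grow at most linearly in it; together with the errors this bounds [v] and [w]. *)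
Definition moments (t : nat) :=
  [/\ adapted xi (history t) (x t), adapted xi (history t) (y t),
      adapted xi (history t) (v t) & adapted xi (history t) (w t)] /\
  [/\ Int (fun o => enorm (z t o - row_mx x1 y1) ^+ 2), Int (fun o => ex t o) & Int (fun o => ey t o)].

Lemma adapted_row_mx J (X : Omega -> 'rV[R]_d1) (X' : Omega -> 'rV[R]_d2) :
  adapted xi J X -> adapted xi J X' -> adapted xi J (fun o => row_mx (X o) (X' o)).
Proof.
move=> mX mX' i; case: (fintype.split_ordP i) => j ->.
  by under eq_fun do rewrite row_mxEl; exact: mX.
by under eq_fun do rewrite row_mxEr; exact: mX'.
Qed.

Lemma integrable_sqr_le J n (X : Omega -> 'rV[R]_n) G : adapted xi J X ->
  (forall o, enorm (X o) ^+ 2 <= G o) -> Int G -> Int (fun o => enorm (X o) ^+ 2).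
Proof.
move=> mX XG; apply: le_integrable_EFin => [|o]; last by rewrite ger0_norm ?sqr_ge0.
by apply: measurable_funX; apply: measurable_enorm => i; exact: adapted_measurable mX.
Qed.

Lemma adaptedB J n (X X' : Omega -> 'rV[R]_n) :
  adapted xi J X -> adapted xi J X' -> adapted xi J (fun o => X o - X' o).
Proof.
by move=> mX mX' i; under eq_fun do rewrite !mxE; exact: measurable_funB.
Qed.

Lemma adaptedD J n (X X' : Omega -> 'rV[R]_n) :
  adapted xi J X -> adapted xi J X' -> adapted xi J (fun o => X o + X' o).
Proof.
by move=> mX mX' i; under eq_fun do rewrite !mxE; exact: measurable_funD.
Qed.

Lemma adaptedZ J n a (X : Omega -> 'rV[R]_n) :
  adapted xi J X -> adapted xi J (fun o => a *: X o).
Proof.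
by move=> mX i; under eq_fun do rewrite !mxE; exact: measurable_funM.
Qed.

Lemma adapted_cst J n (c : 'rV[R]_n) : adapted xi J (fun=> c).
Proof. by move=> i; exact: measurable_cst. Qed.

Lemma adapted_pr J (X : Omega -> 'rV[R]_d2) : adapted xi J X -> adapted xi J (pr \o X).
Proof. by apply: (@adapted_lipschitz _ _ _ _ _ _ _ _ _ _ _ 1) => u u'; rewrite mul1r. Qed.

(** [X] is the mean gradient minus its error, and the mean gradient is its value at the start plus
    at most [L] times the distance travelled. *)
Lemma integrable_mean_bound J n (hb : 'rV[R]_(d1 + d2) -> 'rV[R]_n) (X : Omega -> 'rV[R]_n) t :
  adapted xi J X ->
  (forall u u', enorm (hb u - hb u') <= L * enorm (u - u')) ->
  Int (fun o => enorm (z t o - row_mx x1 y1) ^+ 2) ->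
  Int (fun o => enorm (hb (z t o) - X o) ^+ 2) -> Int (fun o => enorm (X o) ^+ 2).
Proof.
move=> mX hbL i1 i2.
apply: (integrable_sqr_le (G := fun o => 4 * enorm (hb (row_mx x1 y1)) ^+ 2 +
   (4 * L ^+ 2 * enorm (z t o - row_mx x1 y1) ^+ 2 + 2 * enorm (hb (z t o) - X o) ^+ 2)) mX).
  move=> o; set a := hb _; set c := hb (z t o).
  have h1 := enorm_sqrD_le c (- (c - X o)); rewrite opprB addrC subrK enormB in h1.
  have h2 := enorm_sqrD_le a (c - a); rewrite addrC subrK in h2.
  have h3 : enorm (c - a) ^+ 2 <= L ^+ 2 * enorm (z t o - row_mx x1 y1) ^+ 2.
    by rewrite -exprMn lerXn2r ?nnegrE ?enorm_ge0 ?mulr_ge0 ?enorm_ge0// hbL.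
  lra.
apply: integrableD_EFin; first exact: integrable_cst_EFin.
by apply: integrableD_EFin; exact: integrableZ_EFin.
Qed.

Let hxbar_lip := mean_lip L_ge0 hx_lip hx_int hx_mean.
Let hybar_lip := mean_lip L_ge0 hy_lip hy_int hy_mean.

Lemma moments_v t : moments t -> Int (fun o => enorm (v t o) ^+ 2).
Proof. by move=> [[_ _ mv _] [iz ie _]]; exact: integrable_mean_bound mv hxbar_lip iz ie. Qed.

Lemma moments_w t : moments t -> Int (fun o => enorm (w t o) ^+ 2).
Proof. by move=> [[_ _ _ mw] [iz _ ie]]; exact: integrable_mean_bound mw hybar_lip iz ie. Qed.

(** As [pr] is nonexpansive and fixes [y t], the projected step is at most [lambda * |w|]. *)
Lemma moments_dy t : (1 <= t <= T)%N -> moments t -> Int (fun o => dy t o).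
Proof.
move=> tT mt; have [[_ my _ mw] _] := mt.
apply: (integrable_sqr_le (J := history t) (G := fun o => lambda ^+ 2 * enorm (w t o) ^+ 2)).
- apply: adaptedB => //.
  by apply: (adapted_pr (X := fun o => y t o + lambda *: w t o)); apply: adaptedD => //; exact: adaptedZ.
- move=> o; have := pr_lip (y t o + lambda *: w t o) (y t o).
  rewrite y_fix// (addrC (y t o)) addrK enormZ => h.
  rewrite -[lambda ^+ 2]real_normK ?num_real// -exprMn.
  by rewrite lerXn2r ?nnegrE ?enorm_ge0 ?mulr_ge0 ?enorm_ge0.
- by apply: integrableZ_EFin; exact: moments_w.
Qed.

Let dzE t o : (1 <= t <= T)%N ->
  enorm (z t.+1 o - z t o) ^+ 2 = eta t ^+ 2 * (gamma ^+ 2 * enorm (v t o) ^+ 2 + dy t o).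
Proof.
move=> tT; rewrite row_mxBB sqr_enorm_row_mx xE// yE//.
rewrite (addrC (x t o)) addrK (addrC (y t o) (eta t *: _)) addrK enormN !enormZ.
by rewrite !exprMn !real_normK ?num_real//; ring.
Qed.

Lemma moments1 : moments 1 /\
  \int[P]_o ex 1 o <= b%:R^-1 * delta ^+ 2 /\ \int[P]_o ey 1 o <= b%:R^-1 * delta ^+ 2.
Proof.
have [mv iv lev] := storm_init b_gt0 xi_iid hx_meas hx_lip hx_int hx_mean hx_var v1E.
have [mw iw lew] := storm_init b_gt0 xi_iid hy_meas hy_lip hy_int hy_mean hy_var w1E.
have zE o : z 1%N o = row_mx x1 y1 by rewrite x1E y1E.
split; last by split; under eq_Rintegral do rewrite zE.
split; split => //.
- by move=> i; under eq_fun do rewrite x1E; exact: measurable_cst.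
- by move=> i; under eq_fun do rewrite y1E; exact: measurable_cst.
- under [_ \o _]eq_fun do rewrite zE subrr enorm0 expr0n /=.
  exact: integrable_cst_EFin.
- by under [_ \o _]eq_fun do rewrite zE.
- by under [_ \o _]eq_fun do rewrite zE.
Qed.

Lemma momentsS t : (1 <= t <= T)%N -> moments t -> moments t.+1 /\
  (\int[P]_o ex t.+1 o <= (1 - c1 * eta t ^+ 2) ^+ 2 * \int[P]_o ex t o +
    b%:R^-1 * (2 * (c1 * eta t ^+ 2) ^+ 2 * delta ^+ 2 +
      2 * (1 - c1 * eta t ^+ 2) ^+ 2 * L ^+ 2 *
      (eta t ^+ 2 * (gamma ^+ 2 * \int[P]_o enorm (v t o) ^+ 2 + \int[P]_o dy t o))) /\
  \int[P]_o ey t.+1 o <= (1 - c2 * eta t ^+ 2) ^+ 2 * \int[P]_o ey t o +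
    b%:R^-1 * (2 * (c2 * eta t ^+ 2) ^+ 2 * delta ^+ 2 +
      2 * (1 - c2 * eta t ^+ 2) ^+ 2 * L ^+ 2 *
      (eta t ^+ 2 * (gamma ^+ 2 * \int[P]_o enorm (v t o) ^+ 2 + \int[P]_o dy t o)))).
Proof.
move=> tT mt; have [[mx my mv mw] [iz iex iey]] := mt.
have iv := moments_v mt; have idy := moments_dy tT mt.
have ivy : Int (fun o => gamma ^+ 2 * enorm (v t o) ^+ 2 + dy t o).
  by apply: integrableD_EFin => //; exact: integrableZ_EFin.
(* The new iterates use only batches up to time [t], so they are already known when batch [t.+1] is
   drawn. *)
have mx' : adapted xi (history t) (x t.+1).
  move=> i; under eq_fun do rewrite xE//.
  by apply: adaptedB => //; exact: adaptedZ.
have my' : adapted xi (history t) (y t.+1).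
  move=> i; under eq_fun do rewrite yE//.
  apply: adaptedD => //; apply: adaptedZ; apply: adaptedB => //.
  by apply: (adapted_pr (X := fun o => y t o + lambda *: w t o)); apply: adaptedD => //; exact: adaptedZ.
have mz := adapted_row_mx mx my; have mz' := adapted_row_mx mx' my'.
have idz : Int (fun o => enorm (z t.+1 o - z t o) ^+ 2).
  by under [_ \o _]eq_fun do rewrite dzE//; exact: integrableZ_EFin.
have Idz : \int[P]_o (enorm (z t.+1 o - z t o) ^+ 2) =
    eta t ^+ 2 * (gamma ^+ 2 * \int[P]_o enorm (v t o) ^+ 2 + \int[P]_o dy t o).
  under eq_Rintegral do rewrite dzE//.
  rewrite RintegralZl// RintegralD//; last exact: integrableZ_EFin.
  by rewrite RintegralZl.
have tT' : (t <= T)%N by case/andP: tT.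
have [mv' iex' le1] := storm_step b_gt0 xi_iid L_ge0 hx_meas hx_lip hx_int hx_mean hx_var
  tT' mz mz' mv idz iex (fun o => vE o tT).
have [mw' iey' le2] := storm_step b_gt0 xi_iid L_ge0 hy_meas hy_lip hy_int hy_mean hy_var
  tT' mz mz' mw idz iey (fun o => wE o tT).
rewrite Idz in le1 le2.
split; last by split.
split; split => //.
- exact: adaptedS (@historyS _ t) mx'.
- exact: adaptedS (@historyS _ t) my'.
- apply: (integrable_sqr_le (J := history t) (G := fun o => 2 * enorm (z t.+1 o - z t o) ^+ 2 +
    2 * enorm (z t o - row_mx x1 y1) ^+ 2)).
  + by apply: adaptedB => //; exact: adapted_cst.
  + move=> o; apply: le_trans (enorm_sqrD_le _ _).
    by rewrite addrA subrK.
  + by apply: integrableD_EFin; exact: integrableZ_EFin.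
Qed.

Lemma momentsP t : (1 <= t <= T.+1)%N -> moments t.
Proof.
elim: t => // -[_ _|t IH]; first by case: moments1.
move=> tT; have tT' : (1 <= t.+1 <= T)%N by [].
by have [] := momentsS tT' (IH (leqW tT')).
Qed.

End run_moments.

(** * Sampled gradients extended to the whole space *)

Section sampled_gradients.
Context {R : realType} {d1 d2 : nat} {d : measure_display} {Xi : measurableType d}.
Variables (D : probability Xi R) (f : Xi -> 'rV[R]_d1 -> 'rV[R]_d2 -> R).
Variables (Y : set 'rV[R]_d2) (Q : 'M[R]_d2) (L delta : R).
Hypothesis Ycl : closed Y.
Hypothesis Y0 : Y !=set0.
Hypothesis Ycvx : forall y y' (t : R),
  Y y -> Y y' -> 0 <= t <= 1 -> Y (y + t *: (y' - y)).
Hypothesis Qproj : tangent_projector Y Q.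
Hypothesis f_meas : forall x y, measurable_fun setT (fun s => f s x y).
Hypothesis f_int : forall x y, Y y -> D.-integrable setT (fun s => (f s x y)%:E).
Hypothesis f_diff : forall s, differentiable_on Y (f s).
Hypothesis obj_diff : differentiable_on Y (objective D f).
Hypothesis L_ge0 : 0 <= L.
Hypothesis f_lip : forall s, lipschitz_gradient Y L (f s).
Hypothesis f_var : bounded_variance D f Y delta.

Local Notation obj := (objective D f).
Local Notation pY := (projection Y).

(* Composing with the projection extends the gradients from R^d1 x Y to the whole
   space, where they stay L-Lipschitz. *)
Definition gradx_ext (g : 'rV[R]_d1 -> 'rV[R]_d2 -> R) (z : 'rV[R]_(d1 + d2)) :=
  gradx g (lsubmx z) (pY (rsubmx z)).

Definition grady_ext (g : 'rV[R]_d1 -> 'rV[R]_d2 -> R) (z : 'rV[R]_(d1 + d2)) :=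
  grady g (lsubmx z) (pY (rsubmx z)) *m Q.

Let Yp u : Y (pY u). Proof. exact: projection_in. Qed.

Let gradxy_lip s (z z' : 'rV[R]_(d1 + d2)) :
  enorm (gradxy (f s) (lsubmx z) (pY (rsubmx z)) - gradxy (f s) (lsubmx z') (pY (rsubmx z')))
  <= L * enorm (z - z').
Proof.
apply: le_trans (f_lip s _ _ (Yp _) (Yp _)) _.
rewrite ler_wpM2l// row_mxBB -(@ler_pXn2r _ 2)// ?nnegrE ?enorm_ge0//.
rewrite sqr_enorm_row_mx -{3}(hsubmxK z) -{3}(hsubmxK z') row_mxBB sqr_enorm_row_mx lerD2l.
by rewrite lerXn2r ?nnegrE ?enorm_ge0// projection_lip.
Qed.

Lemma gradx_ext_lip s z z' : enorm (gradx_ext (f s) z - gradx_ext (f s) z') <= L * enorm (z - z').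
Proof.
apply: le_trans (gradxy_lip s z z'); rewrite /gradxy row_mxBB; exact: enorm_row_mx_ge_l.
Qed.

Lemma grady_ext_lip s z z' : enorm (grady_ext (f s) z - grady_ext (f s) z') <= L * enorm (z - z').
Proof.
apply: le_trans (gradxy_lip s z z'); rewrite /gradxy row_mxBB -mulmxBl.
by apply: le_trans (tangent_projector_le _ Qproj) _; exact: enorm_row_mx_ge_r.
Qed.

Lemma gradx_ext_meas z i : measurable_fun setT (fun s => gradx_ext (f s) z 0 i).
Proof. exact: measurable_gradx. Qed.

Lemma grady_ext_meas z i : measurable_fun setT (fun s => grady_ext (f s) z 0 i).
Proof.
rewrite /grady_ext; under eq_fun do rewrite mxE.
by apply: measurable_sum => j; apply: measurable_funM => //; exact: measurable_grady.
Qed.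

Lemma gradx_ext_mean z i : D.-integrable setT (EFin \o (fun s => gradx_ext (f s) z 0 i)) /\
  \int[D]_s gradx_ext (f s) z 0 i = gradx_ext obj z 0 i.
Proof.
have := expected_grad Ycvx f_meas f_int f_diff obj_diff f_lip (lsubmx z) (delta_mx 0 i)
  (Yp (rsubmx z)) (Yp (rsubmx z)).
rewrite subrr; have E g : dotp (gradxy g (lsubmx z) (pY (rsubmx z))) (row_mx (delta_mx 0 i) 0)
    = gradx_ext g z 0 i by rewrite /gradxy dotp_row_mx dotp0r addr0 dotp_delta.
rewrite E => -[h1 h2]; split; last by rewrite -h2; apply: eq_Rintegral => s _; rewrite E.
by move: h1; under eq_fun do rewrite E.
Qed.

(** The directions in which the sampled dual gradient has the right mean form a linear set [A]. It
    contains the differences of points of [Y], hence the range of [Q], in particular the rows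
    [delta_mx 0 i *m Q]. *)
Lemma grady_ext_mean z i : D.-integrable setT (EFin \o (fun s => grady_ext (f s) z 0 i)) /\
  \int[D]_s grady_ext (f s) z 0 i = grady_ext obj z 0 i.
Proof.
pose x := lsubmx z; pose y := pY (rsubmx z); have Yy : Y y by exact: Yp.
pose A := [set u | D.-integrable setT (EFin \o (fun s => dotp (grady (f s) x y) u)) /\
  \int[D]_s dotp (grady (f s) x y) u = dotp (grady obj x y) u].
have lA : linear_set A.
  split.
    split; first by under [_ \o _]eq_fun do rewrite dotp0r; exact: integrable_cst_EFin.
    by under eq_Rintegral do rewrite dotp0r; rewrite Rintegral_cst1 dotp0r.
  move=> a u v [iu Iu] [iv Iv].
  have iau := integrableZ_EFin a iu.
  split.
    by under [_ \o _]eq_fun do rewrite dotpDr dotpZr; exact: integrableD_EFin.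
  under eq_Rintegral do rewrite dotpDr dotpZr.
  by rewrite RintegralD// RintegralZl// Iu Iv dotpDr dotpZr.
have A1 y' : Y y' -> A (y' - y).
  move=> Yy'; have := expected_grad Ycvx f_meas f_int f_diff obj_diff f_lip x 0 Yy Yy'.
  have E g : dotp (gradxy g x y) (row_mx 0 (y' - y)) = dotp (grady g x y) (y' - y).
    by rewrite /gradxy dotp_row_mx dotp0r add0r.
  rewrite E => -[h1 h2]; split; last by rewrite -h2; apply: eq_Rintegral => s _; rewrite E.
  by move: h1; under eq_fun do rewrite E.
have AY y' z' : Y y' -> Y z' -> A (z' - y').
  move=> Yy' Yz'; have [_ lin] := lA.
  have -> : z' - y' = -1 *: (y' - y) + (z' - y) by rewrite scaleN1r opprB [RHS]addrC addrA subrK.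
  by apply: lin; exact: A1.
have [_ _ span] := Qproj.
have E g : dotp (grady g x y) (delta_mx 0 i *m Q) = grady_ext g z 0 i.
  by rewrite -(tangent_projector_dotp _ _ Qproj) dotp_delta.
have [h1 h2] := span A lA AY (delta_mx 0 i).
split; last by rewrite -E -h2; apply: eq_Rintegral => s _; rewrite E.
by move: h1; under [_ \o _]eq_fun do rewrite E.
Qed.

Lemma gradx_ext_var z :
  (\int[D]_s (enorm (gradx_ext (f s) z - gradx_ext obj z) ^+ 2)%:E <= (delta ^+ 2)%:E)%E.
Proof. by have [+ _] := f_var (lsubmx z) (Yp (rsubmx z)); rewrite unlock. Qed.

Lemma grady_ext_var z :
  (\int[D]_s (enorm (grady_ext (f s) z - grady_ext obj z) ^+ 2)%:E <= (delta ^+ 2)%:E)%E.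
Proof.
have [_] := f_var (lsubmx z) (Yp (rsubmx z)); rewrite unlock; apply: le_trans.
apply: ge0_le_integral => //.
- by move=> s _; rewrite lee_fin sqr_ge0.
- apply/measurable_EFinP/measurable_funX/measurable_enorm => i.
  under eq_fun do rewrite mxE [X in _ + X]mxE.
  by apply: measurable_funB => //; exact: grady_ext_meas.
- apply/measurable_EFinP/measurable_funX/measurable_enorm => i.
  under eq_fun do rewrite mxE [X in _ + X]mxE.
  apply: measurable_funB; last exact: measurable_cst.
  exact: measurable_grady.
- move=> s _; rewrite lee_fin lerXn2r ?nnegrE ?enorm_ge0// -mulmxBl.
  exact: tangent_projector_le Qproj.
Qed.

Lemma gradx_extE g x y : Y y -> gradx_ext g (row_mx x y) = gradx g x y.
Proof. by move=> Yy; rewrite /gradx_ext row_mxKl row_mxKr projection_id. Qed.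

Lemma grady_extE g x y : Y y -> grady_ext g (row_mx x y) = grady g x y *m Q.
Proof. by move=> Yy; rewrite /grady_ext row_mxKl row_mxKr projection_id. Qed.

(** The projection is characterized by variational inequalities against [q - p] with [p], [q] in
    [Y], which see only the tangential part of [w]. The two projection predicates thus coincide, and
    so do the values chosen by [get]. *)
Lemma projection_tangent y w (a : R) : Y y ->
  (forall u q, Y u -> Y q -> dotp (w *m Q) (q - u) = dotp w (q - u)) ->
  pY (y + a *: w) = pY (y + a *: (w *m Q)).
Proof.
move=> Yy wQ; rewrite /projection; congr get; apply/funext => p; apply/propext.
have E q : Y p -> Y q -> dotp (y + a *: w - p) (q - p) = dotp (y + a *: (w *m Q) - p) (q - p).
  by move=> Yp' Yq; rewrite !dotpBl !dotpDl !dotpZl wQ.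
split=> h; have [Yp' _] := h; apply: is_projection_of_var => // q Yq.
  by rewrite -E//; exact: is_projection_var h Yq.
by rewrite E//; exact: is_projection_var h Yq.
Qed.

End sampled_gradients.

(** * Summation of the momentum errors *)

Section lyapunov_sum.
Context {R : realType}.
Variables (gamma lambda tau L delta k m c1 c2 B : R).
Hypotheses (gamma0 : 0 < gamma) (lambda0 : 0 < lambda) (tau0 : 0 < tau) (L0 : 0 < L).
Hypotheses (k0 : 0 < k) (B0 : 0 < B).
Hypothesis c1_ge : 2 / (3 * k ^+ 3) + 9 * tau ^+ 2 / 4 <= c1.
Hypothesis c2_ge : 2 / (3 * k ^+ 3) + 75 * L ^+ 2 / 2 <= c2.
Hypotheses (m2 : 2 <= m) (km : k ^+ 3 <= m).
Hypotheses (c1m : (c1 * k) ^+ 3 <= m) (c2m : (c2 * k) ^+ 3 <= m).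
Hypothesis lambda_le : lambda <= 27 * B * tau / 16.
Hypothesis gamma_le : gamma ^+ 2 <= lambda ^+ 2 * tau ^+ 2 / (4 * L ^+ 2) *
  (2 * B / (8 * lambda ^+ 2 + 75 * (L / tau) ^+ 2 * B)).
Local Notation eta := (step_size k m).

Lemma lyapunov_sum (T : nat) (U S X Z : nat -> R) :
  (forall t, 0 <= U t) -> (forall t, 0 <= S t) -> (forall t, 0 <= X t) -> (forall t, 0 <= Z t) ->
  X 1%N <= B^-1 * delta ^+ 2 -> Z 1%N <= B^-1 * delta ^+ 2 ->
  (forall t, (1 <= t <= T)%N ->
    X t.+1 <= (1 - c1 * eta t ^+ 2) ^+ 2 * X t + B^-1 * (2 * (c1 * eta t ^+ 2) ^+ 2 * delta ^+ 2
     + 2 * (1 - c1 * eta t ^+ 2) ^+ 2 * L ^+ 2 * (eta t ^+ 2 * (gamma ^+ 2 * U t + S t)))) ->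
  (forall t, (1 <= t <= T)%N ->
    Z t.+1 <= (1 - c2 * eta t ^+ 2) ^+ 2 * Z t + B^-1 * (2 * (c2 * eta t ^+ 2) ^+ 2 * delta ^+ 2
     + 2 * (1 - c2 * eta t ^+ 2) ^+ 2 * L ^+ 2 * (eta t ^+ 2 * (gamma ^+ 2 * U t + S t)))) ->
  \sum_(1 <= t < T.+1) (- (gamma * eta t / 4) * U t + gamma * eta t * X t
    + 9 * gamma * L ^+ 2 / (lambda * tau) * (- (3 * eta t / 4) * S t
     + 25 * eta t * lambda / (6 * tau) * Z t
     + 25 * (L / tau) ^+ 2 * eta t * gamma ^+ 2 / (6 * tau * lambda) * U t))
  <= gamma * k * (2 * m `^ 3^-1 * delta ^+ 2 / (B * tau ^+ 2 * k ^+ 2)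
           + 2 * (c1 ^+ 2 + c2 ^+ 2) * delta ^+ 2 * k ^+ 2 / (B * tau ^+ 2) * ln (m + T%:R)).
Proof.
move=> U0 S0 X0 Z0 X1 Z1 hX hZ.
have k3 : 0 <= 2 / (3 * k ^+ 3) by rewrite divr_ge0// mulr_ge0// exprn_ge0// ltW.
have c10 : 0 <= c1.
  by apply: le_trans c1_ge; rewrite addr_ge0// divr_ge0// mulr_ge0// ?sqr_ge0.
have c20 : 0 <= c2.
  by apply: le_trans c2_ge; rewrite addr_ge0// divr_ge0// mulr_ge0// ?sqr_ge0.
pose q := gamma / tau ^+ 2.
have q0 : 0 < q by rewrite divr_gt0// exprn_gt0.
(* The predecessor makes [p 1] involve the step size at index 0, [k / m^(1/3)]; this is the origin
   of the [m^(1/3)] term of the bound. *)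
pose p t := q * ((X t + Z t) / eta t.-1).
pose N := 2 * (c1 ^+ 2 + c2 ^+ 2) * delta ^+ 2 / B.
pose brk t := - (gamma * eta t / 4) * U t + gamma * eta t * X t
    + 9 * gamma * L ^+ 2 / (lambda * tau) * (- (3 * eta t / 4) * S t
     + 25 * eta t * lambda / (6 * tau) * Z t
     + 25 * (L / tau) ^+ 2 * eta t * gamma ^+ 2 / (6 * tau * lambda) * U t).
rewrite -[leLHS]/(\sum_(1 <= t < T.+1) brk t).
have e0 := step_size_gt0 k0 m2.
have H t : (1 <= t <= T)%N -> brk t - q * N * eta t ^+ 3 <= p t - p t.+1.
  case: t => // t tT; rewrite lerBlDr.
  have h := lyapunov_step gamma0 lambda0 tau0 L0 k0 B0 c1_ge c2_ge lambda_le gamma_le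
    (e0 t.+1) (e0 t) (step_size_inv k0 m2 km t)
    (step_size_sqr_le1 k0 m2 km t.+1 c10 c1m) (step_size_sqr_le1 k0 m2 km t.+1 c20 c2m)
    (X0 _) (Z0 _) (U0 _) (S0 _) (hX _ tT) (hZ _ tT).
  apply: le_trans h _; rewrite lerD2l.
  by rewrite le_eqVlt; apply/orP; left; apply/eqP; rewrite /q /N; ring.
have := sum_le_telescope H; rewrite sumrB lerBlDr -mulr_sumr => h.
apply: le_trans h _.
have pT : 0 <= p T.+1.
  by rewrite mulr_ge0 ?(ltW q0)// divr_ge0 ?addr_ge0// ltW.
have N0 : 0 <= N.
  by rewrite divr_ge0 ?(ltW B0)// mulr_ge0 ?sqr_ge0// mulr_ge0// addr_ge0 ?sqr_ge0.
have h1 : q * N * \sum_(1 <= t < T.+1) eta t ^+ 3 <= q * N * (k ^+ 3 * ln (m + T%:R)).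
  by apply: ler_wpM2l; [rewrite mulr_ge0// ltW|exact: sum_step_size_cube].
have r0 : 0 < m `^ 3^-1 by rewrite powR_gt0// (lt_le_trans _ m2).
have h2 : p 1%N <= q * (2 * (B^-1 * delta ^+ 2) * (m `^ 3^-1 / k)).
  rewrite /p /= step_size0 invf_div ler_pM2l// ler_wpM2r ?divr_ge0 ?(ltW r0) ?(ltW k0)//.
  by lra.
have E : gamma * k * (2 * m `^ 3^-1 * delta ^+ 2 / (B * tau ^+ 2 * k ^+ 2)
     + 2 * (c1 ^+ 2 + c2 ^+ 2) * delta ^+ 2 * k ^+ 2 / (B * tau ^+ 2) * ln (m + T%:R)) =
   q * (2 * (B^-1 * delta ^+ 2) * (m `^ 3^-1 / k)) + q * N * (k ^+ 3 * ln (m + T%:R)).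
  by rewrite /q /N; field; rewrite !gt_eqF.
rewrite E; apply: lerD h1.
by apply: le_trans h2; rewrite gerBl.
Qed.

End lyapunov_sum.

(** * Expectation of the pathwise estimate and the final rate *)

Lemma integral_bracket {R : realType} {d : measure_display} {T : measurableType d}
    (P : probability T R) (U X S Z : T -> R) (a b' A s r u : R) :
  P.-integrable setT (EFin \o U) -> P.-integrable setT (EFin \o X) ->
  P.-integrable setT (EFin \o S) -> P.-integrable setT (EFin \o Z) ->
  P.-integrable setT (EFin \o (fun o => a * U o + b' * X o + A * (s * S o + r * Z o + u * U o))) /\
  \int[P]_o (a * U o + b' * X o + A * (s * S o + r * Z o + u * U o)) =
  a * \int[P]_o U o + b' * \int[P]_o X o
    + A * (s * \int[P]_o S o + r * \int[P]_o Z o + u * \int[P]_o U o).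
Proof.
move=> iU iX iS iZ.
have i1 := integrableD_EFin (integrableZ_EFin a iU) (integrableZ_EFin b' iX).
have i2 := integrableD_EFin (integrableZ_EFin s iS) (integrableZ_EFin r iZ).
have i3 := integrableD_EFin i2 (integrableZ_EFin u iU).
have i4 := integrableZ_EFin A i3.
split; first exact: integrableD_EFin i1 i4.
rewrite (RintegralD measurableT i1 i4)// (RintegralZl _ measurableT i3)//.
rewrite (RintegralD measurableT i2 (integrableZ_EFin u iU))//.
rewrite (RintegralD measurableT (integrableZ_EFin s iS) (integrableZ_EFin r iZ))//.
rewrite (RintegralD measurableT (integrableZ_EFin a iU) (integrableZ_EFin b' iX))//.
by rewrite !RintegralZl.
Qed.

Theorem theorem12 (R : realType) (d1 d2 : nat)
  (* the minimax problem *)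
  (dXi : measure_display) (Xi : measurableType dXi) (D : probability Xi R)
  (f : Xi -> 'rV[R]_d1 -> 'rV[R]_d2 -> R)
  (Y : set 'rV[R]_d2)
  (hY : (compact Y /\ convex_set Y) \/ Y = setT)
  (hf_meas : forall x y, measurable_fun setT (fun s => f s x y))
  (hf_int : forall x y, Y y -> D.-integrable setT (fun s => (f s x y)%:E))
  (hf_diff : forall s, differentiable_on Y (f s))
  (hobj_diff : differentiable_on Y (objective D f))
  (* standing assumptions *)
  (delta Lf tau : R) (hdelta : 0 < delta) (hLf : 0 < Lf) (htau : 0 < tau)
  (C1 : bounded_variance D f Y delta)
  (C2 : forall s, lipschitz_gradient Y Lf (f s))
  (C3 : strongly_concave Y tau (objective D f))
  (C4 : has_lbound (range (primal Y (objective D f))))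
  (* the algorithm *)
  (gamma lambda k m c1 c2 : R) (b T : nat) (hb : (1 <= b)%N) (hT : (1 <= T)%N)
  (x1 : 'rV[R]_d1) (y1 : 'rV[R]_d2) (hy1 : Y y1)
  (dO : measure_display) (Omega : measurableType dO) (P : probability Omega R)
  (xi : nat * 'I_b -> {RV P >-> Xi})
  (hxi : iid D [set p | (1 <= p.1 <= T.+1)%N] xi)
  (x v : nat -> Omega -> 'rV[R]_d1) (y w : nat -> Omega -> 'rV[R]_d2)
  (hrun : forall o, acc_mda_run f Y gamma lambda k m c1 c2 T x1 y1
    (fun t i => xi (t, i) o) (x^~ o) (y^~ o) (v^~ o) (w^~ o)) :
  let F := primal Y (objective D f) in
  let Fstar := inf (range F) in
  let kappa := Lf / tau in
  let Lg := Lf + Lf ^+ 2 / tau in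
  let Delta1 := enorm (y1 - ystar Y (objective D f) x1) ^+ 2 in
  let M := (F x1 - Fstar) / (gamma * k)
           + 9 * Lf ^+ 2 * Delta1 / (k * lambda * tau)
           + 2 * m `^ 3^-1 * delta ^+ 2 / (b%:R * tau ^+ 2 * k ^+ 2)
           + 2 * (c1 ^+ 2 + c2 ^+ 2) * delta ^+ 2 * k ^+ 2 / (b%:R * tau ^+ 2)
             * ln (m + T%:R) in
  2 / (3 * k ^+ 3) + 9 * tau ^+ 2 / 4 <= c1 ->
  2 / (3 * k ^+ 3) + 75 * Lf ^+ 2 / 2 <= c2 ->
  0 < k ->
  Num.max 2 (Num.max (k ^+ 3) (Num.max ((c1 * k) ^+ 3) ((c2 * k) ^+ 3))) <= m ->
  0 < lambda ->
  lambda <= Num.min (1 / (6 * Lf)) (27 * b%:R * tau / 16) ->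
  0 < gamma ->
  gamma <= Num.min
    (lambda * tau / (2 * Lf)
     * Num.sqrt (2 * b%:R / (8 * lambda ^+ 2 + 75 * kappa ^+ 2 * b%:R)))
    (m `^ 3^-1 / (2 * Lg * k)) ->
  ((T%:R^-1)%:E * \sum_(1 <= t < T.+1)
     'E_P[fun o => enorm (grad F (x t o))]
   <= (Num.sqrt (2 * M) * m `^ 6^-1 / T%:R `^ 2^-1
       + Num.sqrt (2 * M) / T%:R `^ 3^-1)%:E)%E.
Proof.
move=> F Fstar kappa Lg Delta1 M hc1 hc2 k0 hm lam0 hlam g0 hgam.
have [Ycl Ycvx] := feasible_closed_convex hY.
have Y0 : Y !=set0 by exists y1.
have [Q [Qproj Qfix]] := tangent_projector_exists Y.
move: hm; rewrite !ge_max => /and4P[m2 km c1m c2m].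
move: hlam; rewrite le_min => /andP[lam1 lam2].
move: hgam; rewrite le_min => /andP[gam1 gam2].
have B0 : 0 < b%:R :> R by rewrite ltr0n.
have L0 := ltW hLf.
set eta := step_size k m.
have e0 t : 0 < eta t by exact: step_size_gt0.
have e1 t : eta t <= 1 by exact: step_size_le1.
have Lg0 : 0 < Lg by rewrite addr_gt0// divr_gt0// exprn_gt0.
have gle t : gamma * eta t <= 1 / (2 * Lg).
  by apply: step_size_lt_bound => //; exact: ltW.
set obj := objective D f.
pose hx s := gradx_ext Y (f s); pose hxb := gradx_ext Y obj.
pose hy s := grady_ext Y Q (f s); pose hyb := grady_ext Y Q obj.
have hx_meas z i : measurable_fun setT (fun s => hx s z 0 i) by exact: gradx_ext_meas.
have hy_meas z i : measurable_fun setT (fun s => hy s z 0 i) by exact: grady_ext_meas.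
have hx_lip s z z' : enorm (hx s z - hx s z') <= Lf * enorm (z - z') by exact: gradx_ext_lip.
have hy_lip s z z' : enorm (hy s z - hy s z') <= Lf * enorm (z - z') by exact: grady_ext_lip.
have hx_int z i : D.-integrable setT (EFin \o (fun s => hx s z 0 i)).
  by have [] := gradx_ext_mean Ycl Y0 Ycvx hf_meas hf_int hf_diff hobj_diff C2 z i.
have hx_mean z i : \int[D]_s hx s z 0 i = hxb z 0 i.
  by have [] := gradx_ext_mean Ycl Y0 Ycvx hf_meas hf_int hf_diff hobj_diff C2 z i.
have hy_int z i : D.-integrable setT (EFin \o (fun s => hy s z 0 i)).
  by have [] := grady_ext_mean Ycl Y0 Ycvx Qproj hf_meas hf_int hf_diff hobj_diff C2 z i.
have hy_mean z i : \int[D]_s hy s z 0 i = hyb z 0 i.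
  by have [] := grady_ext_mean Ycl Y0 Ycvx Qproj hf_meas hf_int hf_diff hobj_diff C2 z i.
have hx_var z : (\int[D]_s (enorm (hx s z - hxb z) ^+ 2)%:E <= (delta ^+ 2)%:E)%E.
  exact: gradx_ext_var.
have hy_var z : (\int[D]_s (enorm (hy s z - hyb z) ^+ 2)%:E <= (delta ^+ 2)%:E)%E.
  exact: grady_ext_var.
have gx_lip p p' q q' : Y q -> Y q' ->
    enorm (gradx obj p q - gradx obj p' q') <= Lf * enorm (row_mx p q - row_mx p' q').
  move=> Yq Yq'; rewrite -(gradx_extE Ycl Y0 Ycvx obj p Yq) -(gradx_extE Ycl Y0 Ycvx obj p' Yq').
  exact: mean_lip L0 hx_lip hx_int hx_mean _ _.
have gy_lip p p' q q' : Y q -> Y q' ->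
    enorm (grady obj p q *m Q - grady obj p' q' *m Q) <= Lf * enorm (row_mx p q - row_mx p' q').
  move=> Yq Yq'; rewrite -(grady_extE Q Ycl Y0 Ycvx obj p Yq) -(grady_extE Q Ycl Y0 Ycvx obj p' Yq').
  exact: mean_lip L0 hy_lip hy_int hy_mean _ _.
(* Only the tangential part of w enters the projected step, and it follows the
   same recursion with projected gradients. *)
pose wq t o := w t o *m Q.
have wQ u p q : Y p -> Y q -> dotp (u *m Q) (q - p) = dotp u (q - p).
  by move=> Yp Yq; rewrite (tangent_projector_dotp _ _ Qproj) Qfix.
have yin t o : (1 <= t <= T.+1)%N -> Y (y t o).
  elim: t => // -[_ _|t IH tT]; first by rewrite (run_y1 (hrun o)).
  have tT' : (1 <= t.+1 <= T)%N by [].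
  rewrite (run_y (hrun o) tT'); apply: Ycvx; first exact: IH (leqW tT').
    exact: projection_in.
  by rewrite (ltW (e0 _)) e1.
have yin' t o : (1 <= t <= T)%N -> Y (y t o).
  by case/andP=> t1 tT; apply: yin; rewrite t1 leqW.
have prE t o : (1 <= t <= T)%N ->
    projection Y (y t o + lambda *: w t o) = projection Y (y t o + lambda *: wq t o).
  move=> tT; apply: (@projection_tangent _ _ Y Q Ycvx (y t o) (w t o) lambda (yin' t o tT)).
  exact: wQ.
have hxE t x' y' o : Y y' ->
    gradx_batch f x' y' (fun i => xi (t, i) o) = batch_mean xi hx t (row_mx x' y') o.
  move=> Yy'; rewrite /gradx_batch /batch_mean /minibatch_mean; congr (_ *: _).
  by apply: eq_bigr => i _; rewrite /hx gradx_extE.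
have hyE t x' y' o : Y y' ->
    grady_batch f x' y' (fun i => xi (t, i) o) *m Q = batch_mean xi hy t (row_mx x' y') o.
  move=> Yy'; rewrite /grady_batch /batch_mean /minibatch_mean -scalemxAl mulmx_suml.
  by congr (_ *: _); apply: eq_bigr => i _; rewrite /hy grady_extE.
have x1E o : x 1%N o = x1 := run_x1 (hrun o).
have y1E o : y 1%N o = y1 := run_y1 (hrun o).
have v1E o : v 1%N o = batch_mean xi hx 1 (row_mx x1 y1) o.
  by rewrite (run_v1 (hrun o)) hxE.
have w1E o : wq 1%N o = batch_mean xi hy 1 (row_mx x1 y1) o.
  by rewrite /wq (run_w1 (hrun o)) hyE.
have xE t o : (1 <= t <= T)%N -> x t.+1 o = x t o - (gamma * eta t) *: v t o := run_x (hrun o) (t := t).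
have yE t o : (1 <= t <= T)%N ->
    y t.+1 o = y t o + eta t *: (projection Y (y t o + lambda *: wq t o) - y t o).
  by move=> tT; rewrite (run_y (hrun o) tT) prE.
have y_fix t o : (1 <= t <= T)%N -> projection Y (y t o) = y t o.
  by move=> tT; apply: projection_id => //; exact: yin'.
have vE t o : (1 <= t <= T)%N ->
    v t.+1 o = batch_mean xi hx t.+1 (row_mx (x t.+1 o) (y t.+1 o)) o
    + (1 - c1 * eta t ^+ 2) *: (v t o - batch_mean xi hx t.+1 (row_mx (x t o) (y t o)) o).
  move=> tT; rewrite (run_v (hrun o) tT) !hxE//; first exact: yin'.
  by case/andP: tT => _ tT; apply: yin.
have wE t o : (1 <= t <= T)%N ->
    wq t.+1 o = batch_mean xi hy t.+1 (row_mx (x t.+1 o) (y t.+1 o)) o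
    + (1 - c2 * eta t ^+ 2) *: (wq t o - batch_mean xi hy t.+1 (row_mx (x t o) (y t o)) o).
  move=> tT; have tT' : (1 <= t.+1 <= T.+1)%N by case/andP: tT.
  have Yt := yin' t o tT; have Yt' := yin t.+1 o tT'.
  by rewrite /wq (run_w (hrun o) tT) mulmxDl hyE// -scalemxAl mulmxBl hyE.
have pr_lip := projection_lip Ycl Y0 Ycvx.
have mom t : (1 <= t <= T.+1)%N -> moments xi hxb hyb x1 y1 x v y wq t.
  exact: (momentsP hb hxi L0 hx_meas hx_lip hx_int hx_mean hx_var hy_meas hy_lip hy_int hy_mean hy_var
    pr_lip x1E y1E v1E w1E xE yE y_fix vE wE).
have mom' t : (1 <= t <= T)%N -> moments xi hxb hyb x1 y1 x v y wq t.
  by case/andP=> t1 tT; apply: mom; rewrite t1 leqW.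
have momS t tT := (momentsS hb hxi L0 hx_meas hx_lip hx_int hx_mean hx_var hy_meas hy_lip hy_int hy_mean hy_var
    pr_lip xE yE y_fix vE wE tT (mom' t tT)).2.
pose U t := \int[P]_o (enorm (v t o) ^+ 2).
pose S t := \int[P]_o (enorm (projection Y (y t o + lambda *: wq t o) - y t o) ^+ 2).
pose X t := \int[P]_o (enorm (hxb (row_mx (x t o) (y t o)) - v t o) ^+ 2).
pose Z t := \int[P]_o (enorm (hyb (row_mx (x t o) (y t o)) - wq t o) ^+ 2).
have sq0 n (W : Omega -> 'rV[R]_n) : 0 <= \int[P]_o (enorm (W o) ^+ 2).
  by apply: Rintegral_ge0 => o _; exact: sqr_ge0.
have [_ [X1 Z1]] := moments1 hb hxi hx_meas hx_lip hx_int hx_mean hx_var hy_meas hy_lip hy_int hy_mean hy_var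
    x1E y1E v1E w1E.
have gam_sq : gamma ^+ 2 <= lambda ^+ 2 * tau ^+ 2 / (4 * Lf ^+ 2) *
    (2 * b%:R / (8 * lambda ^+ 2 + 75 * (Lf / tau) ^+ 2 * b%:R)).
  set q := 2 * _ / _; have q0 : 0 <= q.
    apply: divr_ge0; first by rewrite mulr_ge0// ltW.
    apply: addr_ge0; first by rewrite mulr_ge0 ?sqr_ge0.
    by apply: mulr_ge0 (ltW B0); rewrite mulr_ge0 ?sqr_ge0.
  have -> : lambda ^+ 2 * tau ^+ 2 / (4 * Lf ^+ 2) * q =
      (lambda * tau / (2 * Lf) * Num.sqrt q) ^+ 2.
    by rewrite exprMn sqr_sqrtr//; field; rewrite gt_eqF.
  have r0 : 0 <= lambda * tau / (2 * Lf) * Num.sqrt q.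
    by rewrite mulr_ge0 ?sqrtr_ge0// divr_ge0// mulr_ge0// ltW.
  by rewrite lerXn2r// nnegrE ltW.
have lsum := lyapunov_sum (delta := delta) g0 lam0 htau hLf k0 B0 hc1 hc2 m2 km c1m c2m lam2 gam_sq
  (T := T) (U := U) (S := S) (X := X) (Z := Z)
  (fun t => sq0 _ _) (fun t => sq0 _ _) (fun t => sq0 _ _) (fun t => sq0 _ _) X1 Z1
  (fun t tT => (momS t tT).1) (fun t tT => (momS t tT).2).
pose gF x' := gradx obj x' (ystar Y obj x').
have gradF x' : grad F x' = gF x'.
  exact: (grad_primal Ycl Y0 Ycvx hobj_diff Qproj Qfix hLf htau gx_lip gy_lip C3).
have gFlip := gF_lip Ycl Y0 Ycvx hobj_diff Qproj Qfix hLf htau gx_lip gy_lip C3.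
have Fge x' : Fstar <= F x' by apply: ge_inf => //; exists x'.
pose brk t o := - (gamma * eta t / 4) * enorm (v t o) ^+ 2
       + gamma * eta t * enorm (hxb (row_mx (x t o) (y t o)) - v t o) ^+ 2
       + 9 * gamma * Lf ^+ 2 / (lambda * tau) *
         (- (3 * eta t / 4) * enorm (projection Y (y t o + lambda *: wq t o) - y t o) ^+ 2
         + 25 * eta t * lambda / (6 * tau) * enorm (hyb (row_mx (x t o) (y t o)) - wq t o) ^+ 2
         + 25 * (Lf / tau) ^+ 2 * eta t * gamma ^+ 2 / (6 * tau * lambda) * enorm (v t o) ^+ 2).
pose C := F x1 - Fstar + 9 * gamma * Lf ^+ 2 / (lambda * tau) * Delta1.
(* The telescoped estimate for each outcome; expectations are taken only afterwards, on the finite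
   sums. *)
have path o : \sum_(1 <= t < T.+1) gamma * eta t / 2 * enorm (gF (x t o)) ^+ 2 <=
    C + \sum_(1 <= t < T.+1) brk t o.
  have := path_bound Ycl Y0 Ycvx hobj_diff Qproj Qfix hLf htau gx_lip gy_lip C3 g0 lam0 lam1
    (T := T) (x := x^~ o) (v := v^~ o) (y := y^~ o) (w := wq^~ o)
    (fun t tT => yin' t o tT) e0 e1 gle (fun t tT => xE t o tT) (fun t tT => yE t o tT) Fge.
  rewrite x1E y1E => h; apply: (le_trans h); apply: lerD; first by rewrite /C.
  apply: ler_sum_nat => t tT; have Yt := yin' t o tT.
  have Ex : hxb (row_mx (x t o) (y t o)) = gradx obj (x t o) (y t o) by exact: gradx_extE.
  have Ey : hyb (row_mx (x t o) (y t o)) = grady obj (x t o) (y t o) *m Q by exact: grady_extE.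
  by rewrite /brk Ex Ey.
(* The gradient of [F] is Lipschitz with constant [Lg], so it grows at most linearly in the distance
   from the starting point, whose square is integrable. *)
have igF t : (1 <= t <= T)%N -> P.-integrable setT (EFin \o (fun o => enorm (gF (x t o)) ^+ 2)).
  move=> tT; have [[mx _ _ _] [iz _ _]] := mom' t tT.
  apply: (integrable_sqr_le (xi := xi) (J := history t) (G := fun o => 2 * enorm (gF x1) ^+ 2
    + 2 * Lg ^+ 2 * enorm (row_mx (x t o) (y t o) - row_mx x1 y1) ^+ 2)).
  - exact: (adapted_lipschitz (h := gF) gFlip mx).
  - move=> o; have h1 := enorm_sqrD_le (gF x1) (gF (x t o) - gF x1).
    rewrite (addrC (gF x1)) subrK in h1; apply: le_trans h1 _.
    rewrite lerD2l -mulrA ler_wpM2l// -exprMn lerXn2r ?nnegrE ?enorm_ge0//.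
      by rewrite mulr_ge0 ?enorm_ge0// ltW.
    apply: le_trans (gFlip _ _) _; rewrite ler_wpM2l ?(ltW Lg0)//.
    by rewrite row_mxBB enorm_row_mx_ge_l.
  - apply: integrableD_EFin; first exact: integrable_cst_EFin.
    exact: integrableZ_EFin.
have ibrk t : (1 <= t <= T)%N -> P.-integrable setT (EFin \o brk t) /\ \int[P]_o brk t o =
   - (gamma * eta t / 4) * U t + gamma * eta t * X t + 9 * gamma * Lf ^+ 2 / (lambda * tau) *
   (- (3 * eta t / 4) * S t + 25 * eta t * lambda / (6 * tau) * Z t
     + 25 * (Lf / tau) ^+ 2 * eta t * gamma ^+ 2 / (6 * tau * lambda) * U t).
  move=> tT; have mt := mom' t tT; have [_ [_ iX iZ]] := mt.
  have i1 := moments_v L0 hx_lip hx_int hx_mean mt.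
  have i2 := moments_dy L0 hy_lip hy_int hy_mean lambda pr_lip y_fix tT mt.
  exact: integral_bracket.
pose g t := \int[P]_o (enorm (gF (x t o)) ^+ 2).
have rng t : t \in index_iota 1 T.+1 -> (1 <= t <= T)%N by rewrite mem_index_iota.
have total : \sum_(1 <= t < T.+1) eta t * g t <= 2 * k * M.
  have i1 : P.-integrable setT (EFin \o (fun o =>
      \sum_(1 <= t < T.+1) gamma * eta t / 2 * enorm (gF (x t o)) ^+ 2)).
    by apply: integrable_sum_EFin => t /rng tT; apply: integrableZ_EFin; exact: igF.
  have i2 : P.-integrable setT (EFin \o (fun o => \sum_(1 <= t < T.+1) brk t o)).
    by apply: integrable_sum_EFin => t /rng /ibrk[].
  have i3 := integrableD_EFin (integrable_cst_EFin P C) i2.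
  have := le_Rintegral measurableT i1 i3 (fun o _ => path o).
  rewrite (RintegralD measurableT (integrable_cst_EFin P C) i2) Rintegral_cst1.
  rewrite Rintegral_sum; last by move=> t /rng tT; apply: integrableZ_EFin; exact: igF.
  rewrite Rintegral_sum; last by move=> t /rng /ibrk[].
  rewrite [X in _ <= C + X]big_nat.
  under [X in _ <= C + X]eq_bigr => t tT do rewrite (ibrk t tT).2.
  rewrite -big_nat => h.
  have {}h := le_trans h (lerD (lexx C) lsum).
  (* [M] is the initial potential gap [C] plus the summed noise bound, divided by [gamma * k]. *)
  have ME : gamma * k * M = C + gamma * k * (2 * m `^ 3^-1 * delta ^+ 2 / (b%:R * tau ^+ 2 * k ^+ 2)
       + 2 * (c1 ^+ 2 + c2 ^+ 2) * delta ^+ 2 * k ^+ 2 / (b%:R * tau ^+ 2) * ln (m + T%:R)).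
    by rewrite /M /C; field; rewrite !gt_eqF.
  rewrite -ME in h.
  have gE : \sum_(1 <= t < T.+1) \int[P]_o (gamma * eta t / 2 * enorm (gF (x t o)) ^+ 2) =
      gamma / 2 * \sum_(1 <= t < T.+1) eta t * g t.
    rewrite mulr_sumr !big_nat; apply: eq_bigr => t tT.
    by rewrite RintegralZl//; [rewrite /g; ring|exact: igF].
  rewrite gE in h.
  have g2 : 0 < gamma / 2 by rewrite divr_gt0.
  rewrite -(ler_pM2l g2); apply: le_trans h _.
  by rewrite le_eqVlt; apply/orP; left; apply/eqP; field.
have m0 : 0 < m by rewrite (lt_le_trans _ m2).
have c10 : 0 < c1.
  apply: lt_le_trans hc1; rewrite addr_gt0// divr_gt0// mulr_gt0// exprn_gt0//.
(* The logarithmic term is strictly positive, as [c1 > 0] and [m + T > 1]; the other three terms are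
   nonnegative. *)
have M0 : 0 < M.
  rewrite /M; apply: ltr_wpDl; last first.
    apply: mulr_gt0; last by rewrite ln_gt0// (lt_le_trans _ (lerD m2 (ler0n _ T)))// addr0 ltr1n.
    apply: divr_gt0; last by rewrite mulr_gt0// exprn_gt0.
    rewrite mulr_gt0 ?exprn_gt0// mulr_gt0 ?exprn_gt0// mulr_gt0//.
    by rewrite ltr_wpDr ?sqr_ge0// exprn_gt0.
  apply: addr_ge0; first apply: addr_ge0.
  - by apply: divr_ge0; [rewrite subr_ge0; exact: Fge|rewrite ltW// mulr_gt0].
  - apply: divr_ge0; last by rewrite ltW// !mulr_gt0.
    by apply: mulr_ge0; [rewrite mulr_ge0 ?sqr_ge0|exact: sqr_ge0].
  - apply: divr_ge0; last by rewrite ltW// !mulr_gt0// exprn_gt0.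
    by rewrite mulr_ge0 ?sqr_ge0// mulr_ge0// powR_ge0.
pose zz t := \int[P]_o enorm (grad F (x t o)).
have izz t : (1 <= t <= T)%N -> P.-integrable setT (EFin \o (fun o => enorm (grad F (x t o)))).
  move=> tT; have [[mx _ _ _] _] := mom' t tT.
  under [_ \o _]eq_fun do rewrite gradF.
  apply: (@le_integrable_EFin _ _ _ P _ (fun o => 1 + enorm (gF (x t o)) ^+ 2)).
  - apply: measurable_enorm => i; apply: (adapted_measurable (xi := xi) (J := history t)).
    exact: (adapted_lipschitz (h := gF) gFlip mx).
  - move=> o; rewrite ger0_norm ?enorm_ge0//.
    by have := sqr_ge0 (enorm (gF (x t o)) - 1); have := sqr_ge0 (enorm (gF (x t o))); nra.
  - by apply: integrableD_EFin; [exact: integrable_cst_EFin|exact: igF].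
have EzE t : (1 <= t <= T)%N -> ('E_P[fun o => enorm (grad F (x t o))] = (zz t)%:E)%E.
  by move=> tT; rewrite unlock integral_EFin//; exact: izz.
have hz t c : (1 <= t <= T)%N -> 0 < c -> zz t <= g t / (2 * c) + c / 2.
  move=> tT c0.
  have i1 := integrableZ_EFin (2 * c)^-1 (igF t tT).
  have i2 := integrableD_EFin i1 (integrable_cst_EFin P (c / 2)).
  have gE : g t / (2 * c) + c / 2 = \int[P]_o ((2 * c)^-1 * enorm (gF (x t o)) ^+ 2 + c / 2).
    rewrite (RintegralD measurableT i1 (integrable_cst_EFin P (c / 2))) Rintegral_cst1.
    by rewrite RintegralZl ?(mulrC (g t))//; exact: igF.
  rewrite gE; apply: (le_Rintegral measurableT (izz t tT) i2) => o _; rewrite gradF.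
  set n := enorm _; have -> : (2 * c)^-1 * n ^+ 2 + c / 2 = (n ^+ 2 + c ^+ 2) / (2 * c).
    by field; rewrite gt_eqF.
  rewrite ler_pdivlMr ?mulr_gt0//.
  by have := sqr_ge0 (n - c); nra.
have := average_bound k0 m2 hT M0 (fun t => sq0 _ _) hz total.
rewrite -lee_fin EFinM => h; apply: le_trans h.
rewrite big_nat; under eq_bigr => t tT do rewrite (EzE t tT).
by rewrite -big_nat sumEFin.
Qed.
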